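(* Let $0<\alpha<\tfrac12$, $0<\beta<\tfrac12$, let $\Omega$, $\Gamma$, $q_2$ and $\partial/\partial n$ be as described in the context, and let $\mu_2\in C[0,l]$. Consider the double-layer potential $$w^{(2)}(x_0,y_0)=\int_0^l x^{2\alpha}y^{2\beta}\mu_2(s)\,\frac{\partial q_2(x,y;x_0,y_0)}{\partial n}\,ds,\qquad x=x(s),\ y=y(s).$$ For a point $(x_0(t),y_0(t))=(x(t),y(t))$ of $\Gamma$ lying in $\mathbb{R}^2_+$ (that is, $0<t<l$), let $w^{(2)}_i(t)$ and $w^{(2)}_e(t)$ denote the limiting values of $w^{(2)}(x_0,y_0)$ as $(x_0,y_0)\to(x_0(t),y_0(t))$ from the inside of $\Omega$ and from the outside of $\Omega$ (within $\mathbb{R}^2_+$), respectively. Then these limits exist and $$w^{(2)}_i(t)=-\frac12\mu_2(t)+\int_0^l\mu_2(s)K_2(s,t)\,ds,$$ $$w^{(2)}_e(t)=\frac12\mu_2(t)+\int_0^l\mu_2(s)K_2(s,t)\,ds,$$ where $$K_2(s,t)=[x(s)]^{2\alpha}[y(s)]^{2\beta}\,\frac{\partial}{\partial n}\left\{q_2\left[x(s),y(s);x_0(t),y_0(t)\right]\right\}.$$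
   Context: $\mathbb{R}^2_+=\{(x,y):x>0,\ y>0\}$. Domain and curve. $\Omega\subset\mathbb{R}^2_+$ is a domain bounded by the interval $(0,a)$ of the $x$-axis, the interval $(0,b)$ of the $y$-axis, and a curve $\Gamma$ with endpoints $A(a,0)$ and $B(0,b)$. The curve $\Gamma$ is given by $x=x(s)$, $y=y(s)$, $s\in[0,l]$, where $s$ is arc length and $l$ is the length of $\Gamma$, and satisfies: (i) $x(s),y(s)$ have continuous derivatives $x'(s),y'(s)$ on $[0,l]$ that do not vanish simultaneously; (ii) the second derivatives $x''(s),y''(s)$ satisfy a Hölder condition on $[0,l]$; (iii) in some neighbourhoods of the points $A$ and $B$, $\left|\frac{dx}{ds}\right|\le c\,y^{1+\varepsilon}(s)$ and $\left|\frac{dy}{ds}\right|\le c\,x^{1+\varepsilon}(s)$, where $0<\varepsilon<1$ and $c$ is a constant. Normal derivative. $n$ is the normal to $\Gamma$ exterior to $\Omega$, and $\frac{\partial}{\partial n}=\frac{dy}{ds}\frac{\partial}{\partial x}-\frac{dx}{ds}\frac{\partial}{\partial y}$ with $\frac{dy}{ds}=\cos(n,x)$, $\frac{dx}{ds}=-\cos(n,y)$; the derivative of $q_2(x,y;x_0,y_0)$ is taken in $(x,y)$, at the point $(x(s),y(s))$ of $\Gamma$. Fundamental solution. With $r^2=(x-x_0)^2+(y-y_0)^2$, $r_1^2=(x+x_0)^2+(y-y_0)^2$, $r_2^2=(x-x_0)^2+(y+y_0)^2$, $\xi=\frac{r^2-r_1^2}{r^2}$, $\eta=\frac{r^2-r_2^2}{r^2}$,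 $$q_2(x,y;x_0,y_0)=k_2\,(r^2)^{\alpha-\beta-1}x^{1-2\alpha}x_0^{1-2\alpha}F_2(1-\alpha+\beta;1-\alpha,\beta;2-2\alpha,2\beta;\xi,\eta),$$ $$k_2=\frac{2^{2-2\alpha+2\beta}}{4\pi}\,\frac{\Gamma(1-\alpha)\Gamma(\beta)\Gamma(1-\alpha+\beta)}{\Gamma(2-2\alpha)\Gamma(2\beta)} .$$ Here $\Gamma(\cdot)$ with a numerical argument is the Gamma function, and $F_2$ is Appell's function $$F_2(a;b_1,b_2;c_1,c_2;x,y)=\sum_{m,n=0}^\infty\frac{(a)_{m+n}(b_1)_m(b_2)_n}{(c_1)_m(c_2)_n\,m!\,n!}x^my^n,\qquad (a)_\nu=\frac{\Gamma(a+\nu)}{\Gamma(a)},$$ continued analytically from the convergence region of the series to the arguments $\xi\le0$, $\eta\le0$ that occur here. *)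

(* Defs.v *)
From mathcomp Require Export all_boot all_order all_algebra.
From mathcomp Require Export all_classical all_reals all_analysis.
Export Order.TTheory GRing.Theory Num.Theory.
Export numFieldNormedType.Exports.

Set Implicit Arguments.
Unset Strict Implicit.
Unset Printing Implicit Defensive.

#[export] Set Implicit Arguments.
#[export] Unset Strict Implicit.
#[export] Unset Printing Implicit Defensive.

Local Open Scope classical_set_scope.
Local Open Scope ring_scope.

(* Only used for positive arguments, where the integral converges. *)
Definition Gamma_fun (R : realType) (z : R) : R :=
  \int[lebesgue_measure]_(t in `]0, +oo[) (t `^ (z - 1) * expR (- t)).

Definition pochhammer (R : realType) (a : R) (n : nat) : R :=
  Gamma_fun (a + n%:R) / Gamma_fun a.

(* The double series of the u m n is absolutely convergent, with sum v; the
   order of summation is then irrelevant, and square partial sums are used. *)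
Definition double_series_sum (R : realType) (u : nat -> nat -> R) (v : R) :
    Prop :=
  summable [set: nat * nat] (fun k => (u k.1 k.2)%:E) /\
  \sum_(m < N) \sum_(n < N) u m n @[N --> \oo] --> v.

Definition real_analytic2 (R : realType) (U : set (R * R)) (f : R * R -> R) :
    Prop :=
  forall p, U p -> exists c : nat -> nat -> R, \forall q \near p,
    double_series_sum
      (fun m n => c m n * (q.1 - p.1) ^+ m * (q.2 - p.2) ^+ n) (f q).

Definition appellF2_term (R : realType) (a b1 b2 c1 c2 : R) (p : R * R)
    (m n : nat) : R :=
  pochhammer a (m + n) * pochhammer b1 m * pochhammer b2 n
  / (pochhammer c1 m * pochhammer c2 n * m`!%:R * n`!%:R)
  * p.1 ^+ m * p.2 ^+ n.

(* An open set, star-shaped about the origin, which contains the convergence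
   region |xi| + |eta| < 1 of the series and the quadrant xi, eta <= 0. *)
Definition appellF2_domain (R : realType) : set (R * R) :=
  [set p | [/\ p.1 < 1, p.2 < 1 & p.1 + p.2 < 1]].

Definition appellF2_continuation (R : realType) (a b1 b2 c1 c2 : R)
    (F : R * R -> R) : Prop :=
  real_analytic2 (@appellF2_domain R) F /\
  forall p : R * R, `|p.1| + `|p.2| < 1 ->
    double_series_sum (appellF2_term a b1 b2 c1 c2 p) (F p).

(* The domain being connected, the continuation is unique on it: the choice
   made by get only affects values outside the domain. *)
Definition appellF2 (R : realType) (a b1 b2 c1 c2 xi eta : R) : R :=
  get (appellF2_continuation a b1 b2 c1 c2) (xi, eta).

Definition k2 (R : realType) (alpha beta : R) : R :=
  2 `^ (2 - 2 * alpha + 2 * beta) / (4 * pi)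
  * (Gamma_fun (1 - alpha) * Gamma_fun beta * Gamma_fun (1 - alpha + beta)
     / (Gamma_fun (2 - 2 * alpha) * Gamma_fun (2 * beta))).

Definition q2 (R : realType) (alpha beta x y x0 y0 : R) : R :=
  let rr  := (x - x0) ^+ 2 + (y - y0) ^+ 2 in
  let rr1 := (x + x0) ^+ 2 + (y - y0) ^+ 2 in
  let rr2 := (x - x0) ^+ 2 + (y + y0) ^+ 2 in
  let xi  := (rr - rr1) / rr in
  let eta := (rr - rr2) / rr in
  k2 alpha beta * rr `^ (alpha - beta - 1)
  * x `^ (1 - 2 * alpha) * x0 `^ (1 - 2 * alpha)
  * appellF2 (1 - alpha + beta) (1 - alpha) beta (2 - 2 * alpha) (2 * beta)
             xi eta.

Definition quadrant (R : realType) : set (R * R) :=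
  [set p | 0 < p.1 /\ 0 < p.2].

(* Derivative relative to I, hence one-sided at the endpoints of an interval. *)
Definition has_derivative_on (R : realType) (I : set R) (f df : R -> R) :
    Prop :=
  forall s, I s -> (f u - f s) / (u - s) @[u --> within I s^'] --> df s.

Definition hoelder_continuous_on (R : realType) (I : set R) (f : R -> R) :
    Prop :=
  exists k lam : R, [/\ 0 < lam, lam <= 1 &
    forall s t, I s -> I t -> `|f s - f t| <= k * `|s - t| `^ lam].

(* (dx, dy) and (ddx, ddy) are the first and second derivatives of (x, y). *)
Record admissible_arc (R : realType) (a b l : R)
    (x y dx dy ddx ddy : R -> R) : Prop := AdmissibleArc {
  arc_l_gt0 : 0 < l ;
  arc_dx : has_derivative_on `[0, l] x dx ;
  arc_dy : has_derivative_on `[0, l] y dy ;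
  arc_dx_continuous : {within `[0, l], continuous dx} ;
  arc_dy_continuous : {within `[0, l], continuous dy} ;
  arc_regular : forall s, s \in `[0, l] -> ~ (dx s = 0 /\ dy s = 0) ;
  (* the parameter is the arc length *)
  arc_unit_speed : forall s, s \in `[0, l] -> dx s ^+ 2 + dy s ^+ 2 = 1 ;
  arc_ddx : has_derivative_on `[0, l] dx ddx ;
  arc_ddy : has_derivative_on `[0, l] dy ddy ;
  arc_ddx_hoelder : hoelder_continuous_on `[0, l] ddx ;
  arc_ddy_hoelder : hoelder_continuous_on `[0, l] ddy ;
  arc_start : x 0 = a /\ y 0 = 0 ;
  arc_end : x l = 0 /\ y l = b ;
  arc_simple : forall s t, s \in `[0, l] -> t \in `[0, l] ->
    x s = x t -> y s = y t -> s = t ;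
  arc_in_quadrant : forall s, s \in `]0, l[ -> quadrant (x s, y s) ;
  arc_near_axes : exists c eps : R, [/\ 0 < eps, eps < 1 &
    forall P : R * R, P = (a, 0) \/ P = (0, b) ->
      \forall p \near P, forall s, s \in `[0, l] -> p = (x s, y s) ->
        `|dx s| <= c * y s `^ (1 + eps) /\ `|dy s| <= c * x s `^ (1 + eps)]
}.

Definition arc_image (R : realType) (l : R) (x y : R -> R) : set (R * R) :=
  [set (x s, y s) | s in `[0, l]].

Record domain_bounded_by (R : realType) (a b l : R) (x y dx dy : R -> R)
    (Om : set (R * R)) : Prop := DomainBoundedBy {
  dom_open : open Om ;
  dom_nonempty : Om !=set0 ;
  dom_connected : connected Om ;
  dom_in_quadrant : Om `<=` @quadrant R ;
  dom_boundary : closure Om `\` interior Om =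
    [set p | p.1 \in `[0, a] /\ p.2 = 0] `|`
    [set p | p.1 = 0 /\ p.2 \in `[0, b]] `|`
    arc_image l x y ;
  (* the normal n = (dy/ds, - dx/ds) points out of the domain *)
  dom_exterior_normal : forall s, s \in `]0, l[ ->
    \forall h \near 0^'+, ~ Om (x s + h * dy s, y s - h * dx s)
}.

Definition normal_derivative_q2 (R : realType) (alpha beta : R)
    (x y dx dy : R -> R) (s x0 y0 : R) : R :=
  dy s * derive1 (fun u => q2 alpha beta u (y s) x0 y0) (x s)
  - dx s * derive1 (fun v => q2 alpha beta (x s) v x0 y0) (y s).

Definition potential_integrand (R : realType) (alpha beta : R)
    (x y dx dy mu : R -> R) (p : R * R) (s : R) : R :=
  x s `^ (2 * alpha) * y s `^ (2 * beta) * mu s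
  * normal_derivative_q2 alpha beta x y dx dy s p.1 p.2.

Definition double_layer_potential (R : realType) (alpha beta l : R)
    (x y dx dy mu : R -> R) (p : R * R) : R :=
  \int[lebesgue_measure]_(s in `[0, l])
    potential_integrand alpha beta x y dx dy mu p s.

(* At s = t the value is meaningless (r = 0); it does not affect integrals. *)
Definition K2 (R : realType) (alpha beta : R) (x y dx dy : R -> R) (s t : R) :
    R :=
  x s `^ (2 * alpha) * y s `^ (2 * beta)
  * normal_derivative_q2 alpha beta x y dx dy s (x t) (y t).

(* Main.v *)
Require Import Defs.
From mathcomp Require Import measurable_realfun.
From mathcomp Require Import ring lra.
Local Open Scope classical_set_scope.
Local Open Scope ring_scope.

(** The double-layer potential jumps across the arc because its kernel is, up
    to weakly singular terms, - 1 / (2 pi) times the density of the angle under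
    which the arc is seen from the point p; as p crosses the arc, the angle
    under which a short piece of it is seen changes from pi to - pi.

    The kernel.  For c1 = 2 b1 and c2 = 2 b2 Appell's function is, up to a
    constant factor, the Laplace integral
      int_0^oo t^(a - 1) e^(- t) Phi_b1(- t xi) Phi_b2(- t eta) dt,
      where Phi_b(z) = int_0^1 (u (1 - u))^(b - 1) e^(- z u) du.
    This integral continues the double series analytically, and a continuation
    is determined by its values near the origin because the domain is
    star-shaped; this is appellF2E.  Rescaling t by r^2 turns q2 into a power of
    x x0 times a Laplace integral H(r^2, 4 x x0, 4 y y0) (q2E), which may be
    differentiated under the integral sign (normal_derivative_q2E).  Only one of
    the resulting terms is strongly singular, the one proportional to the
    numerator (x - x0) dy - (y - y0) dx of the angle density.  Its coefficient
    follows from z^b Phi_b(z) = Gamma(b) + O(z^(- 1/2)), see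
    laplace_pair_leading, and the factor k2 is such that the coefficient of the
    angle density tends to - 1 / (2 pi) on the diagonal (leading_coef_q2_diag,
    dl_kernel_angle).  The other terms are O(r^(- 1/2)) by laplace_pair_weak.

    The angle.  Let U and V be the coordinates of the arc seen from p along the
    tangent and the normal at the parameter t.  A point p close to the arc has
    one foot s0 near t, where U vanishes; there V is the signed distance v0 from
    p to the arc along the normal of t.  The angle density is bounded by a
    constant plus a Poisson kernel of width |v0|, hence has bounded integrals
    (angle_density_le), and it is the derivative of
    2 atan (U / (sqrt (U^2 + V^2) + V)) if v0 > 0, so that its integral over a
    short arc is nearly pi times the sign of v0 (Rintegral_angle_density).
    Outside a short arc the kernel converges uniformly as p tends to the arc,
    and near t the density mu2 is nearly constant: this gives jump_near, in
    which the potential differs from its direct value by - mu2 / 2 times the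
    sign of v0.

    The sides.  The points with v0 < 0 near the arc form a connected set which
    misses the boundary of the domain and meets the exterior normal at t, so it
    lies outside; then the points with v0 > 0 must lie inside (side_of_foot). *)

(** * Affine changes of variable *)

Section affine.
Variable R : realType.
Notation mu := (@lebesgue_measure R).

Definition affine_map (c d : R) (x : measurableTypeR R) : measurableTypeR R := c * x + d.

Lemma measurable_affine (c d : R) :
  measurable_fun [set: measurableTypeR R] (affine_map c d).
Proof. by apply: measurable_realfun.measurable_funD => //; exact: measurable_funM. Qed.

Lemma affine_preimage_itvoc (c d x y : R) : 0 < c ->
  affine_map c d @^-1` `]x, y]%classic
  = `](x - d) / c, (y - d) / c]%classic.
Proof.
move=> c0; apply/seteqP; split=> z /=; rewrite /affine_map !in_itv/= => /andP[h1 h2];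
  apply/andP; split.
- by rewrite ltr_pdivrMr// ltrBlDr mulrC.
- by rewrite ler_pdivlMr// lerBrDr mulrC.
- by rewrite -ltrBlDr mulrC -ltr_pdivrMr.
- by rewrite -lerBrDr mulrC -ler_pdivlMr.
Qed.

(** Both sides are measures in A which agree on half-open intervals. *)
Lemma lebesgue_measure_affine (c d : R) (A : set (measurableTypeR R)) :
  0 < c -> measurable A ->
  mu A = (c%:E * mu (affine_map c d @^-1` A))%E.
Proof.
move=> c0 mA.
pose c' : {nonneg R} := NngNum (ltW c0).
pose P0 : {measure set (measurableTypeR R) -> \bar R} := pushforward mu (affine_map c d).
pose P := P0 (measurable_affine c d).
have hP : forall X, ocitv X -> mu X = mscale c' P X.
  move=> _ [[u v]] _ <-; rewrite /mscale/= /P/= /pushforward affine_preimage_itvoc//.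
  rewrite !lebesgue_measure_itv/= !lte_fin ltr_pM2r ?invr_gt0// ltrD2r.
  case: ifPn => uv; last by rewrite mule0.
  by rewrite -!EFinB -EFinM; congr EFin; field; rewrite gt_eqF.
by rewrite (lebesgue_measure_unique hP mA).
Qed.

Lemma ge0_integral_affine (c d : R) (D : set R) (f : R -> \bar R) :
  0 < c -> measurable D -> measurable_fun D f -> (forall x, D x -> (0 <= f x)%E) ->
  (\int[mu]_(x in D) f x
   = c%:E * \int[mu]_(x in affine_map c d @^-1` D) f (c * x + d)%R)%E.
Proof.
move=> c0 mD mf f0.
pose c' : {nonneg R} := NngNum (ltW c0).
pose P0 : {measure set (measurableTypeR R) -> \bar R} := pushforward mu (affine_map c d).
pose P := P0 (measurable_affine c d).
rewrite (_ : (\int[mu]_(x in D) f x = \int[mscale c' P]_(x in D) f x)%E); last first.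
  apply: eq_measure_integral => A mA _.
  exact: (lebesgue_measure_affine d c0 mA).
rewrite ge0_integral_mscale// ge0_integral_pushforward//.
- exact: measurable_affine.
- by move=> x /set_mem; exact: f0.
Qed.

Lemma ge0_integral_scale (c : R) (f : R -> \bar R) :
  0 < c -> measurable_fun [set: R] f -> (forall x, 0 < x -> (0 <= f x)%E) ->
  (\int[mu]_(x in `]0%R, +oo[) f x
   = c%:E * \int[mu]_(x in `]0%R, +oo[) f (c * x)%R)%E.
Proof.
move=> c0 mf f0.
rewrite (ge0_integral_affine 0 c0)//; last 2 first.
- exact: measurable_funTS.
- by move=> x; rewrite /= in_itv/= andbT; exact: f0.
congr (_ * _)%E; rewrite (_ : _ @^-1` _ = `]0, +oo[%classic).
  by apply: eq_integral => x _; rewrite addr0.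
by apply/seteqP; split=> x; rewrite /affine_map /= !in_itv/= !andbT addr0 pmulr_rgt0.
Qed.

Lemma ge0_integral_scale01 (c : R) (f : R -> \bar R) :
  0 < c -> measurable_fun [set: R] f -> (forall x, 0 < x -> x < c -> (0 <= f x)%E) ->
  (\int[mu]_(x in `]0%R, c[) f x
   = c%:E * \int[mu]_(x in `]0%R, 1%R[) f (c * x)%R)%E.
Proof.
move=> c0 mf f0.
rewrite (ge0_integral_affine 0 c0)//; last 2 first.
- exact: measurable_funTS.
- by move=> x; rewrite /= in_itv/= => /andP[]; exact: f0.
congr (_ * _)%E; rewrite (_ : _ @^-1` _ = `]0, 1[%classic).
  by apply: eq_integral => x _; rewrite addr0.
apply/seteqP; split=> x; rewrite /affine_map /= !in_itv/= addr0 pmulr_rgt0//.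
  by rewrite gtr_pMr.
by rewrite gtr_pMr.
Qed.

Lemma ge0_integral_shift (d : R) (f : R -> \bar R) :
  measurable_fun [set: R] f -> (forall x, d < x -> (0 <= f x)%E) ->
  (\int[mu]_(x in `]d, +oo[) f x
   = \int[mu]_(x in `]0%R, +oo[) f (x + d)%R)%E.
Proof.
move=> mf f0.
rewrite (ge0_integral_affine d ltr01)//; last 2 first.
- exact: measurable_funTS.
- by move=> x; rewrite /= in_itv/= andbT; exact: f0.
rewrite mul1e (_ : _ @^-1` _ = `]0, +oo[%classic).
  by apply: eq_integral => x _; rewrite mul1r.
by apply/seteqP; split=> x; rewrite /affine_map /= !in_itv/= !andbT mul1r ltrDr.
Qed.

End affine.

(** * Integrability of powers and exponentials *)

Section power_integrals.
Variable R : realType.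
Notation mu := (@lebesgue_measure R).

Lemma eq_integral_on (D : set R) (g f : R -> \bar R) :
  (forall x, D x -> f x = g x) ->
  (\int[mu]_(x in D) f x = \int[mu]_(x in D) g x)%E.
Proof. by move=> fg; apply: eq_integral => x /[!inE]; exact: fg. Qed.

Lemma eq_Rintegral_on (D : set R) (g f : R -> R) :
  (forall x, D x -> f x = g x) ->
  \int[mu]_(x in D) f x = \int[mu]_(x in D) g x.
Proof. by move=> fg; apply: eq_Rintegral => x /[!inE]; exact: fg. Qed.

Lemma le_integrable_fin (D : set R) (f g : R -> R) :
  measurable D -> measurable_fun D f -> (forall x, D x -> `|f x| <= g x) ->
  mu.-integrable D (EFin \o g) -> mu.-integrable D (EFin \o f).
Proof.
move=> mD mf fg; apply: le_integrable => //; first exact/measurable_EFinP.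
move=> x Dx /=; rewrite lee_fin (le_trans (fg _ Dx))//; exact: ler_norm.
Qed.

Lemma integrableZ_fin (D : set R) (k : R) (f : R -> R) : measurable D ->
  mu.-integrable D (EFin \o f) -> mu.-integrable D (EFin \o (fun x => k * f x)).
Proof. by move=> mD hf; exact: (@integrableZl _ (measurableTypeR R) R mu D mD k _ hf). Qed.

Lemma integrableZr_fin (D : set R) (k : R) (f : R -> R) : measurable D ->
  mu.-integrable D (EFin \o f) -> mu.-integrable D (EFin \o (fun x => f x * k)).
Proof.
move=> mD hf; have := integrableZ_fin k mD hf.
by congr integrable; apply/funext => x /=; rewrite mulrC.
Qed.

Lemma integrableD_fin (D : set R) (f g : R -> R) : measurable D ->
  mu.-integrable D (EFin \o f) -> mu.-integrable D (EFin \o g) ->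
  mu.-integrable D (EFin \o (fun x => f x + g x)).
Proof. by move=> mD hf hg; exact: (@integrableD _ (measurableTypeR R) R mu D mD _ _ hf hg). Qed.

Lemma integrableB_fin (D : set R) (f g : R -> R) : measurable D ->
  mu.-integrable D (EFin \o f) -> mu.-integrable D (EFin \o g) ->
  mu.-integrable D (EFin \o (fun x => f x - g x)).
Proof. by move=> mD hf hg; exact: (@integrableB _ (measurableTypeR R) R mu D mD _ _ hf hg). Qed.

Lemma integrableS_fin (D E : set R) (f : R -> R) : measurable D -> measurable E ->
  D `<=` E -> mu.-integrable E (EFin \o f) -> mu.-integrable D (EFin \o f).
Proof. by move=> mD mE DE; exact: (@integrableS _ (measurableTypeR R) R mu E D _ mE mD DE). Qed.

Lemma integrable_setU (A B : set R) (f : R -> \bar R) :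
  measurable A -> measurable B ->
  mu.-integrable A f -> mu.-integrable B f -> mu.-integrable (A `|` B) f.
Proof.
move=> mA mB iA iB; have /integrableP[mfA fA] := iA; have /integrableP[mfB fB] := iB.
apply/integrableP; split; first by rewrite measurable_funU.
have mfU : measurable_fun (A `|` B) (fun x => `|f x|%E).
  by apply: measurableT_comp => //; rewrite measurable_funU.
have mBA : measurable (B `\` A) by exact: measurableD.
have AB : A `|` B = A `|` (B `\` A) by rewrite setDE setUIr setUCr setIT.
rewrite AB ge0_integral_setU//; last 2 first.
- by rewrite -AB.
- by rewrite /disj_set setDE setICA setICr setI0.
apply: lte_add_pinfty => //; apply: le_lt_trans fB.
apply: ge0_subset_integral => //.
by apply: measurableT_comp.
Qed.

Lemma integral_is_derive (f F : R -> R) (a b : R) : a < b ->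
  {within `[a, b], continuous f} ->
  (forall x, x \in `[a, b] -> is_derive x 1 F (f x)) ->
  (\int[mu]_(x in `[a, b]) (f x)%:E = (F b - F a)%:E)%E.
Proof.
move=> ab cf dF; rewrite EFinB; apply: continuous_FTC2 => //.
- split.
  + by move=> x xab; apply: ex_derive; apply: dF; exact: subset_itv_oo_cc.
  + have h : is_derive a 1 F (f a) by apply: dF; rewrite in_itv/= lexx ltW.
    apply: cvg_at_right_filter; apply: differentiable_continuous.
    exact/derivable1_diffP/ex_derive.
  + have h : is_derive b 1 F (f b) by apply: dF; rewrite in_itv/= lexx ltW.
    apply: cvg_at_left_filter; apply: differentiable_continuous.
    exact/derivable1_diffP/ex_derive.
- move=> x xab; have h : is_derive x 1 F (f x) by apply: dF; exact: subset_itv_oo_cc.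
  by rewrite derive1E derive_val.
Qed.

Lemma continuous_powR_gt0 (k x : R) : 0 < x -> {for x, continuous (fun t => t `^ k)}.
Proof.
move=> x0; apply: differentiable_continuous; apply/derivable1_diffP.
by apply: ex_derive; exact: is_derive1_powR.
Qed.

Lemma bigcup_itv_gt0 (c : R) : 0 < c ->
  \bigcup_n `[c / n.+2%:R, c]%classic = `]0, c]%classic.
Proof.
move=> c0; apply/seteqP; split => x /=.
  move=> [n _] /=; rewrite !in_itv/= => /andP[h ->]; rewrite andbT.
  by apply: lt_le_trans h; rewrite divr_gt0.
rewrite in_itv/= => /andP[x0 xc].
exists (Num.trunc (c / x)) => //=; rewrite in_itv/= xc andbT.
rewrite ler_pdivrMr// mulrC -ler_pdivrMr//.
have /andP[_ /ltW h] := truncn_itv (ltW (divr_gt0 c0 x0)).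
by apply: le_trans h _; rewrite ler_nat.
Qed.

Lemma powR_cvg_div (k c : R) : 0 < k -> 0 < c ->
  (c / n.+2%:R) `^ k @[n --> \oo] --> (0 : R).
Proof.
move=> k0 c0.
have /cvg_at_rightP := @powR_cvg0 R _ k0; apply; split.
  by move=> n; rewrite divr_gt0.
rewrite -[X in _ --> X](mulr0 c); apply: cvgMr.
have := @cvg_harmonic R; rewrite -cvg_shiftS; exact.
Qed.

(** The fundamental theorem of calculus applies on [c / (n + 2), c]; the domains
    increase to ]0, c]. *)
Lemma integral_powR0 (k c : R) : 0 < k -> 0 < c ->
  (\int[mu]_(x in `]0%R, c]) (x `^ (k - 1))%:E = (c `^ k / k)%:E)%E.
Proof.
move=> k0 c0.
have mf : measurable_fun [set: R] (fun x : R => (x `^ (k - 1))%:E).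
  by apply/measurable_EFinP; exact: measurable_powR.
have h := @ge0_nondecreasing_set_cvg_integral _ (measurableTypeR R) R (fun n => `[c / n.+2%:R, c]%classic)
  (fun x : R => (x `^ (k - 1))%:E) mu.
rewrite -bigcup_itv_gt0//; apply: cvg_unique (h _ _ _ _) _ => //.
- apply/nondecreasing_seqP => n; rewrite subsetEset; apply: subset_itvr.
  by rewrite bnd_simp ler_pM2l// lef_pV2 ?posrE// ler_nat.
- by move=> n; exact: measurable_funTS.
- by move=> n x _; rewrite lee_fin powR_ge0.
have e n : (\int[mu]_(x in `[(c / n.+2%:R)%R, c]) (x `^ (k - 1))%:E
    = ((c `^ k - (c / n.+2%:R) `^ k) / k)%:E)%E.
  have cn0 : 0 < c / n.+2%:R by rewrite divr_gt0.
  rewrite mulrBl; apply: (@integral_is_derive _ (fun x => x `^ k / k)).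
  - by rewrite gtr_pMr// invf_lt1// ltr1n.
  - apply: continuous_in_subspaceT => x /[!inE]/=; rewrite in_itv/= => /andP[xc _].
    by apply: continuous_powR_gt0; exact: lt_le_trans xc.
  - move=> x; rewrite in_itv/= => /andP[xc _].
    have x0 : 0 < x by exact: lt_le_trans xc.
    have hd := is_derive1_powR k x0.
    rewrite [X in is_derive _ _ X _](_ : _ = k^-1 *: (fun z : R => z `^ k : R)); last first.
      by apply/funext => z /=; rewrite mulrC.
    by apply: is_derive_eq; rewrite /GRing.scale/= mulrA mulVf ?gt_eqF// mul1r.
rewrite /mkset (eq_cvg _ _ e).
apply: cvg_EFin; first by near=> n.
rewrite /comp/=; apply: cvgMl.
rewrite -[X in _ --> X]subr0; apply: cvgB; first exact: cvg_cst.
exact: powR_cvg_div.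
Unshelve. end_near. Qed.

Lemma integrable_powR0 (k c : R) : 0 < k -> 0 < c ->
  mu.-integrable `]0%R, c] (fun x => (x `^ (k - 1))%:E).
Proof.
move=> k0 c0; apply/integrableP; split.
  by apply: measurable_funTS; apply/measurable_EFinP; exact: measurable_powR.
under eq_integral do rewrite gee0_abs ?lee_fin ?powR_ge0//.
by rewrite integral_powR0// ltry.
Qed.

Lemma integrable_expR_decay (r : R) : 0 < r ->
  mu.-integrable `]0%R, +oo[ (fun x => (expR (- (r * x)))%:E).
Proof.
move=> r0; apply/integrableP; split.
  apply: measurable_funTS; apply/measurable_EFinP; apply: measurableT_comp => //.
  by apply: measurableT_comp => //; exact: measurable_funM.
under eq_integral do rewrite gee0_abs ?lee_fin ?expR_ge0//.
have h := integral_exponential_pdf r0.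
apply: (@le_lt_trans _ _ (r^-1%:E * \int[mu]_x (exponential_pdf r x)%:E)%E); last first.
  by rewrite h mule1 ltry.
have mp : measurable_fun [set: R] (EFin \o exponential_pdf r).
  by apply/measurable_EFinP; exact: measurable_exponential_pdf.
rewrite -ge0_integralZl//; last 2 first.
- by move=> x _; rewrite lee_fin exponential_pdf_ge0// ltW.
- by rewrite lee_fin invr_ge0 ltW.
apply: (@le_trans _ _ (\int[mu]_(x in `]0%R, +oo[) (r^-1%:E * (exponential_pdf r x)%:E))%E).
  apply: ge0_le_integral => //.
  - apply: measurable_funTS; apply/measurable_EFinP; apply: measurableT_comp => //.
    by apply: measurableT_comp => //; exact: measurable_funM.
  - by apply: measurable_funTS; apply: emeasurable_funM.
  - move=> x /=; rewrite in_itv/= andbT => x0.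
    by rewrite -EFinM lee_fin exponential_pdfE ?(ltW x0) // mulrA mulVf ?gt_eqF// mul1r mulNr.
apply: ge0_subset_integral => //.
- by apply: emeasurable_funM.
- by move=> x _; rewrite mule_ge0// lee_fin ?invr_ge0 ?(ltW r0)// exponential_pdf_ge0// ltW.
Qed.

(** This is the k-th power of u <= e^u at u = c t / k. *)
Lemma powR_le_expR (k c t : R) : 0 < k -> 0 < c -> 0 <= t ->
  t `^ k <= (k / c) `^ k * expR (c * t).
Proof.
move=> k0 c0 t0.
have -> : expR (c * t) = (expR (c * t / k)) `^ k.
  by rewrite -expRM divfK// gt_eqF.
have kc0 : 0 <= k / c by rewrite divr_ge0 ?(ltW k0) ?(ltW c0).
rewrite -powRM ?expR_ge0//.
apply: ge0_ler_powR; rewrite ?nnegrE ?(ltW k0)//.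
- by rewrite mulr_ge0 ?expR_ge0.
- rewrite -ler_pdivrMl ?divr_gt0// invf_div mulrC mulrA.
  by apply: le_trans (expR_ge1Dx _); rewrite [t * c]mulrC lerDr.
Qed.

End power_integrals.

(** * Gamma and Beta integrals *)

Section gamma_beta.
Variable R : realType.
Notation mu := (@lebesgue_measure R).

Definition gamma_kernel (k r t : R) : R := t `^ (k - 1) * expR (- (r * t)).

Lemma gamma_kernel_ge0 (k r t : R) : 0 <= gamma_kernel k r t.
Proof. by rewrite mulr_ge0 ?powR_ge0 ?expR_ge0. Qed.

Lemma measurable_gamma_kernel (k r : R) D : measurable_fun D (gamma_kernel k r).
Proof.
apply: measurable_funTS; apply: measurable_funM; first exact: measurable_powR.
apply: measurableT_comp => //.
by apply: measurableT_comp => //; exact: measurable_funM.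
Qed.

Lemma integrable_gamma_kernel (k r : R) : 0 < k -> 0 < r ->
  mu.-integrable `]0%R, +oo[ (EFin \o gamma_kernel k r).
Proof.
move=> k0 r0.
have -> : `]0, +oo[%classic = `]0, 1]%classic `|` `]1, +oo[%classic :> set R.
  by rewrite -itv_bndbnd_setU// bnd_simp.
apply: integrable_setU => //.
- apply: (le_integrable_fin _ _ _ (integrable_powR0 k0 ltr01)) => //.
    exact: measurable_gamma_kernel.
  move=> x /=; rewrite in_itv/= => /andP[x0 _].
  rewrite ger0_norm ?gamma_kernel_ge0// ler_piMr ?powR_ge0//.
  by rewrite expR_le1 oppr_le0 mulr_ge0// ltW.
- have r20 : 0 < r / 2 by rewrite divr_gt0.
  have := integrableZl _ ((k / (r / 2)) `^ k) (integrable_expR_decay r20).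
  move=> /(_ (measurable_itv _)) /(integrableS _ _ _) h.
  apply: (le_integrable_fin _ _ _ (h _ _ _ _)) => //.
  + exact: measurable_gamma_kernel.
  + move=> x /=; rewrite in_itv/= andbT => x1.
    rewrite ger0_norm ?gamma_kernel_ge0//.
    have x0 : 0 < x by exact: lt_trans x1.
    apply: (@le_trans _ _ (x `^ k * expR (- (r * x)))).
      by rewrite ler_wpM2r ?expR_ge0// ler_powR ?(ltW x1)// gerBl.
    have -> : - (r * x) = - (r / 2 * x) - r / 2 * x by field.
    rewrite expRD mulrA ler_wpM2r ?expR_ge0//.
    rewrite expRN ler_pdivrMr ?expR_gt0//.
    by apply: powR_le_expR => //; exact: ltW.
  + by apply: subset_itvr; rewrite bnd_simp.
Qed.

Lemma Gamma_funE (k : R) : Gamma_fun k = \int[mu]_(t in `]0, +oo[) gamma_kernel k 1 t.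
Proof. by apply: eq_Rintegral => t _; rewrite /gamma_kernel mul1r. Qed.

Lemma integral_gamma_kernel1 (k : R) : 0 < k ->
  (\int[mu]_(t in `]0%R, +oo[) (gamma_kernel k 1 t)%:E = (Gamma_fun k)%:E)%E.
Proof.
move=> k0; rewrite Gamma_funE /Rintegral fineK//.
by apply: integrable_fin_num => //; exact: integrable_gamma_kernel.
Qed.

Lemma integral_gamma_kernel (k r : R) : 0 < k -> 0 < r ->
  (\int[mu]_(t in `]0%R, +oo[) (gamma_kernel k r t)%:E
   = (Gamma_fun k * r `^ (- k))%:E)%E.
Proof.
move=> k0 r0; have ir0 : 0 < r^-1 by rewrite invr_gt0.
rewrite (ge0_integral_scale ir0)//; last 2 first.
- by apply/measurable_EFinP; exact: measurable_gamma_kernel.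
- by move=> x _; rewrite lee_fin gamma_kernel_ge0.
rewrite (eq_integral_on (g := fun x => ((r `^ (1 - k))%:E * (gamma_kernel k 1 x)%:E)%E)); last first.
  move=> x /=; rewrite in_itv/= andbT => x0; rewrite -EFinM; congr EFin.
  rewrite /gamma_kernel (_ : r * (r^-1 * x) = 1 * x); last first.
    by rewrite mulrA mulfV ?gt_eqF.
  rewrite powRM ?(ltW x0) ?(ltW ir0)//.
  by rewrite -{1}powR_inv1 ?(ltW r0)// -powRrM mulN1r opprB mulrA.
rewrite ge0_integralZl//; last 3 first.
- by apply/measurable_EFinP; exact: measurable_gamma_kernel.
- by move=> x _; rewrite lee_fin gamma_kernel_ge0.
- by rewrite lee_fin powR_ge0.
rewrite integral_gamma_kernel1// -!EFinM; congr EFin.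
rewrite mulrA mulrC; congr (_ * _).
rewrite -powR_inv1 ?(ltW r0)// -powRD; last by rewrite (gt_eqF r0)/= implybT.
by congr (_ `^ _); ring.
Qed.

Lemma Gamma_fun_gt0 (k : R) : 0 < k -> 0 < Gamma_fun k.
Proof.
move=> k0; rewrite -lte_fin -integral_gamma_kernel1//.
pose m := Num.min 1 (2 `^ (k - 1)) * expR (- 2) : R.
have m0 : 0 < m by rewrite mulr_gt0 ?expR_gt0// lt_min ltr01 powR_gt0.
apply: (@lt_le_trans _ _ (\int[mu]_(x in `]1%R, 2%R]) m%:E)%E).
  rewrite integral_cst//= lebesgue_measure_itv/= lte_fin ltr1n/=.
  by rewrite -EFinB -EFinM lte_fin mulr_gt0// subr_gt0 ltr1n.
apply: (@le_trans _ _ (\int[mu]_(x in `]1%R, 2%R]) (gamma_kernel k 1 x)%:E)%E).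
  apply: ge0_le_integral => //.
  - by move=> x _; rewrite lee_fin ltW.
  - by apply/measurable_EFinP; exact: measurable_gamma_kernel.
  - move=> x /=; rewrite in_itv/= => /andP[x1 x2]; rewrite lee_fin.
    rewrite /gamma_kernel ler_pM ?expR_ge0//; last by rewrite ler_expR lerN2 mul1r.
    have x0 : 0 < x by exact: lt_trans x1.
    rewrite ge_min; have [k1|k1] := leP 1 k.
      by apply/orP; left; rewrite -[leLHS](powRr0 x); apply: (ler_powR (ltW x1)); rewrite subr_ge0.
    apply/orP; right.
    rewrite -(opprB 1) !powRN lef_pV2 ?posrE ?powR_gt0//.
    by apply: ge0_ler_powR; rewrite ?nnegrE// ?subr_ge0 ltW.
apply: ge0_subset_integral => //.
- by apply/measurable_EFinP; exact: measurable_gamma_kernel.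
- by move=> x _; rewrite lee_fin gamma_kernel_ge0.
- by move=> x /=; rewrite !in_itv/= andbT => /andP[x1 _]; exact: lt_trans x1.
Qed.

Definition beta_kernel (p q u : R) : R := u `^ (p - 1) * (1 - u) `^ (q - 1).

Lemma beta_kernel_ge0 (p q u : R) : 0 <= beta_kernel p q u.
Proof. by rewrite mulr_ge0 ?powR_ge0. Qed.

Lemma measurable_beta_kernel (p q : R) D : measurable_fun D (beta_kernel p q).
Proof.
apply: measurable_funTS; apply: measurable_funM; first exact: measurable_powR.
by apply: (measurableT_comp (measurable_powR _)); exact: measurable_funB.
Qed.

(** The density of (s, s + s') for independent s and s' with densities
    gamma_kernel p 1 and gamma_kernel q 1, not normalised.  Its two iterated
    integrals are Gamma(p) Gamma(q) and Gamma(p + q) times the Beta integral. *)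
Definition beta_joint (p q : R) (z : R * R) : R :=
  if (0 < z.1) && (z.1 < z.2) then
    z.1 `^ (p - 1) * (z.2 - z.1) `^ (q - 1) * expR (- z.2) else 0.

Lemma beta_joint_ge0 (p q : R) z : 0 <= beta_joint p q z.
Proof. by rewrite /beta_joint; case: ifP => // _; rewrite !mulr_ge0 ?powR_ge0 ?expR_ge0. Qed.

Lemma measurable_beta_joint (p q : R) :
  measurable_fun [set: measurableTypeR R * measurableTypeR R] (beta_joint p q).
Proof.
apply: measurable_fun_ifT => //.
  by apply: measurable_and => /=; apply: measurable_fun_ltr.
apply: measurable_funM; last first.
  apply: measurableT_comp => //; exact: measurableT_comp.
apply: measurable_funM.
  by apply: (measurableT_comp (measurable_powR _)).
by apply: (measurableT_comp (measurable_powR _)); exact: measurable_funB.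
Qed.

Lemma beta_joint_int_snd (p q s : R) : 0 < q ->
  (\int[mu]_(tau in [set: R]) (beta_joint p q (s, tau))%:E =
   ((fun s => (gamma_kernel p 1 s * Gamma_fun q)%:E) \_ `]0%R, +oo[) s)%E.
Proof.
move=> q0; rewrite patchE mem_setE in_itv/= andbT; case: ltP => s0; last first.
  by rewrite integral0_eq// => x _; rewrite /beta_joint/= ltNge s0.
rewrite (eq_integral_on (g := (fun tau => (s `^ (p - 1) * expR (- s))%:E *
   (gamma_kernel q 1 (tau - s))%:E) \_ `]s, +oo[)%E); last first.
  move=> x _; rewrite patchE /beta_joint/= s0/= mem_setE in_itv/= andbT.
  case: ifP => // _; rewrite -EFinM; congr EFin; rewrite /gamma_kernel.
  have -> : - x = - s - 1 * (x - s) by ring.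
  by rewrite expRD; ring.
rewrite -integral_mkcond.
rewrite ge0_integral_shift//; last 2 first.
- apply: emeasurable_funM => //; apply/measurable_EFinP.
  apply: (measurableT_comp (f := gamma_kernel q 1) (g := fun x : R => x - s)); first exact: measurable_gamma_kernel.
  exact: measurable_funB.
- by move=> x _; rewrite -EFinM lee_fin !mulr_ge0 ?expR_ge0 ?powR_ge0.
under eq_integral do rewrite addrK.
rewrite ge0_integralZl//; last 3 first.
- by apply/measurable_EFinP; exact: measurable_gamma_kernel.
- by move=> x _; rewrite lee_fin gamma_kernel_ge0.
- by rewrite lee_fin mulr_ge0 ?expR_ge0 ?powR_ge0.
by rewrite integral_gamma_kernel1// -EFinM /gamma_kernel mul1r.
Qed.

Lemma beta_joint_int_fst (p q tau : R) :
  (\int[mu]_(s in [set: R]) (beta_joint p q (s, tau))%:E =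
   ((fun tau => (gamma_kernel (p + q) 1 tau)%:E *
     \int[mu]_(u in `]0%R, 1%R[) (beta_kernel p q u)%:E) \_ `]0%R, +oo[) tau)%E.
Proof.
rewrite patchE mem_setE in_itv/= andbT; case: ltP => t0; last first.
  rewrite integral0_eq// => x _; rewrite /beta_joint/= ifF//.
  apply/negbTE; rewrite negb_and; case: (ltP 0 x) => //= x0.
  by rewrite -leNgt (le_trans t0)// ltW.
rewrite (eq_integral_on (g := (fun s => (s `^ (p - 1) * (tau - s) `^ (q - 1) * expR (- tau))%:E)
   \_ `]0%R, tau[)%E); last first.
  by move=> x _; rewrite patchE /beta_joint/= mem_setE in_itv/=; case: ifP.
rewrite -integral_mkcond ge0_integral_scale01//; last 2 first.
- apply/measurable_EFinP; apply: measurable_funM => //; apply: measurable_funM.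
    exact: measurable_powR.
  by apply: (measurableT_comp (measurable_powR _)); exact: measurable_funB.
- by move=> x _ _; rewrite lee_fin !mulr_ge0 ?expR_ge0 ?powR_ge0.
rewrite (eq_integral_on (g := fun u => ((tau `^ (p - 1) * tau `^ (q - 1) * expR (- tau))%:E *
   (beta_kernel p q u)%:E)%E)); last first.
  move=> u /=; rewrite in_itv/= => /andP[u0 u1]; rewrite -EFinM; congr EFin.
  have -> : tau - tau * u = tau * (1 - u) by ring.
  rewrite !powRM ?(ltW t0) ?(ltW u0) ?subr_ge0 ?(ltW u1)// /beta_kernel; ring.
rewrite ge0_integralZl//; last 3 first.
- by apply/measurable_EFinP; exact: measurable_beta_kernel.
- by move=> x _; rewrite lee_fin beta_kernel_ge0.
- by rewrite lee_fin !mulr_ge0 ?expR_ge0 ?powR_ge0.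
rewrite muleA -EFinM; congr (_%:E * _)%E; rewrite /gamma_kernel mul1r !mulrA; congr (_ * _).
rewrite -{1}(powRr1 (ltW t0)) -!powRD; try by rewrite (gt_eqF t0)/= implybT.
by congr (_ `^ _); ring.
Qed.

Lemma integral_beta_kernel (p q : R) : 0 < p -> 0 < q ->
  (\int[mu]_(u in `]0%R, 1%R[) (beta_kernel p q u)%:E =
   (Gamma_fun p * Gamma_fun q / Gamma_fun (p + q))%:E)%E.
Proof.
move=> p0 q0.
have pq0 : 0 < p + q by exact: addr_gt0.
have := @fubini_tonelli _ _ (measurableTypeR R) (measurableTypeR R) R mu mu
  (fun z => (beta_joint p q z)%:E).
move=> /(_ _ _)/wrap[].
  by apply/measurable_EFinP; exact: measurable_beta_joint.
  by move=> z; rewrite lee_fin beta_joint_ge0.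
rewrite (eq_integral_on (fun s _ => beta_joint_int_snd p s q0)) -integral_mkcond.
rewrite (eq_integral_on (fun s _ => beta_joint_int_fst p q s)) -integral_mkcond.
set B := (\int[mu]_(u in _) _)%E.
have B0 : (0 <= B)%E by apply: integral_ge0 => x _; rewrite lee_fin beta_kernel_ge0.
have -> : (\int[mu]_(x in `]0%R, +oo[) (gamma_kernel p 1 x * Gamma_fun q)%:E =
    (Gamma_fun p * Gamma_fun q)%:E)%E.
  rewrite [RHS](_ : _ = ((Gamma_fun q)%:E * (Gamma_fun p)%:E)%E); last first.
    by rewrite -EFinM mulrC.
  rewrite -[X in (_ * X)%E](integral_gamma_kernel1 p0) -ge0_integralZl//.
  - by apply: eq_integral_on => x _; rewrite mulrC EFinM.
  - by apply/measurable_EFinP; exact: measurable_gamma_kernel.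
  - by move=> x _; rewrite lee_fin gamma_kernel_ge0.
  - by rewrite lee_fin ltW// Gamma_fun_gt0.
have -> : (\int[mu]_(x in `]0%R, +oo[) ((gamma_kernel (p + q) 1 x)%:E * B) =
    (Gamma_fun (p + q))%:E * B)%E.
  rewrite muleC -(integral_gamma_kernel1 pq0) -ge0_integralZl//.
  - by apply: eq_integral_on => x _; rewrite muleC.
  - by apply/measurable_EFinP; exact: measurable_gamma_kernel.
  - by move=> x _; rewrite lee_fin gamma_kernel_ge0.
move=> H; rewrite mulrC EFinM H muleA -EFinM mulVf ?mul1e//.
by rewrite gt_eqF// Gamma_fun_gt0.
Qed.

End gamma_beta.

(** * Integrals depending on a parameter *)

Section integral_tools.
Variable R : realType.
Notation mu := (@lebesgue_measure R).

Lemma le_RintegralW (D : set R) (f g : R -> R) : measurable D ->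
  measurable_fun D f -> mu.-integrable D (EFin \o g) ->
  (forall x, D x -> `|f x| <= g x) ->
  `|\int[mu]_(x in D) f x| <= \int[mu]_(x in D) g x.
Proof.
move=> mD mf ig fg.
have if_ : mu.-integrable D (EFin \o f) by exact: le_integrable_fin fg ig.
apply: (@le_trans _ _ (\int[mu]_(x in D) `|f x|)); first exact: le_normr_Rintegral.
by apply: le_Rintegral => //; exact: integrable_norm.
Qed.

Lemma is_derive_Rintegral (D : set R) (f df : R -> R -> R) (G : R -> R) (a u v : R) :
  measurable D -> a \in `]u, v[ ->
  (forall x, x \in `]u, v[ -> mu.-integrable D (EFin \o f x)) ->
  (forall x y, x \in `]u, v[ -> D y -> is_derive x 1 (f^~ y) (df x y)) ->
  (forall x y, x \in `]u, v[ -> D y -> `|df x y| <= G y) ->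
  mu.-integrable D (EFin \o G) ->
  is_derive a 1 (fun x => \int[mu]_(y in D) f x y) (\int[mu]_(y in D) df a y).
Proof.
move=> mD auv if_ hd dG iG.
have d1E x y : x \in `]u, v[ -> D y -> partial1of2 f x y = df x y.
  move=> xuv Dy; have h := hd _ _ xuv Dy.
  by rewrite partial1of2E derive_val.
have h1 x y : `]u, v[%classic x -> D y -> derivable (f ^~ y) x 1.
  by move=> xuv Dy; have [] := hd _ _ xuv Dy.
have iG' : mu.-integrable D (EFin \o (fun y => `|G y|)) by exact: integrable_norm.
have h2 x y : `]u, v[%classic x -> D y -> `|partial1of2 f x y| <= `|G y|.
  by move=> xuv Dy; rewrite d1E// (le_trans (dG _ _ xuv Dy))// ler_norm.
have auv' : `]u, v[%classic a by [].
apply: DeriveDef.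
  exact: (@derivable_under_integral R _ (measurableTypeR R) mu f D mD a u v auv' if_ h1
    (fun y => `|G y|) (fun y => normr_ge0 _) iG' h2).
rewrite -derive1E.
rewrite (@differentiation_under_integral R _ (measurableTypeR R) mu f D mD a u v auv' if_ h1
    (fun y => `|G y|) (fun y => normr_ge0 _) iG' h2).
by apply: eq_Rintegral => y /[!inE] Dy; exact: d1E.
Qed.

Lemma Rintegral_dominated_cvg (D : set R) (f_ : nat -> R -> R) (f g : R -> R) :
  measurable D -> (forall n, measurable_fun D (f_ n)) ->
  (forall x, D x -> f_ n x @[n --> \oo] --> f x) ->
  mu.-integrable D (EFin \o g) ->
  (forall n x, D x -> `|f_ n x| <= g x) ->
  mu.-integrable D (EFin \o f) /\
  \int[mu]_(x in D) f_ n x @[n --> \oo] --> \int[mu]_(x in D) f x.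
Proof.
move=> mD mf_ cf ig fg.
have mf : measurable_fun D f by apply: measurable_fun_cvg cf => //.
have [|||||h1 _ h2] := @dominated_convergence _ (measurableTypeR R) R mu D mD
  (fun n => EFin \o f_ n) (EFin \o f) (EFin \o g).
- by move=> n; apply/measurable_EFinP; exact: mf_.
- by apply/measurable_EFinP; exact: mf.
- by apply: aeW => x Dx; apply: cvg_EFin; [exact: nearW|exact: cf].
- exact: ig.
- by apply: aeW => x n Dx; rewrite /= lee_fin; exact: fg.
split => //; apply: fine_cvg.
rewrite /Rintegral fineK.
  exact: h2.
exact: integrable_fin_num.
Qed.

End integral_tools.

(** * The Laplace transform of the symmetric Beta kernel *)

Section beta_laplace.
Variable R : realType.
Notation mu := (@lebesgue_measure R).

(** The index i counts derivatives in z, up to sign. *)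
Definition beta_laplace_density (b : R) (i : nat) (z u : R) : R :=
  u ^+ i * beta_kernel b b u * expR (- (z * u)).

(** For i = 0 this is, up to the factor Gamma(b)^2 / Gamma(2 b), Kummer's function
    M(b; 2 b; - z). *)
Definition beta_laplace (b : R) (i : nat) (z : R) : R :=
  \int[mu]_(u in `]0, 1[) beta_laplace_density b i z u.

Lemma beta_laplace00 (b : R) :
  beta_laplace b 0 0 = \int[mu]_(u in `]0, 1[) beta_kernel b b u.
Proof.
apply: eq_Rintegral => u _.
by rewrite /beta_laplace_density expr0 mul1r mul0r oppr0 expR0 mulr1.
Qed.

Lemma beta_laplace_density_ge0 (b : R) i (z u : R) : 0 < u -> 0 <= beta_laplace_density b i z u.
Proof. by move=> u0; rewrite !mulr_ge0 ?expR_ge0 ?exprn_ge0 ?powR_ge0// ltW. Qed.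

Lemma measurable_beta_laplace_density (b : R) i (z : R) D :
  measurable_fun D (beta_laplace_density b i z).
Proof.
apply: measurable_funTS; apply: measurable_funM; last first.
  apply: measurableT_comp => //.
  by apply: measurableT_comp => //; exact: measurable_funM.
apply: measurable_funM; last exact: measurable_beta_kernel.
exact: measurable_funX.
Qed.

Lemma integrable_beta_kernel (p q : R) : 0 < p -> 0 < q ->
  mu.-integrable `]0, 1[ (EFin \o beta_kernel p q).
Proof.
move=> p0 q0; apply/integrableP; split.
  by apply/measurable_EFinP; exact: measurable_beta_kernel.
rewrite (eq_integral_on (g := EFin \o beta_kernel p q)).
  by rewrite integral_beta_kernel// ltry.
by move=> u _; rewrite /= ger0_norm// beta_kernel_ge0.
Qed.

Lemma expR_le_on01 (z u : R) : 0 < u -> u < 1 ->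
  expR (- (z * u)) <= expR (Num.max 0 (- z)).
Proof.
move=> u0 u1; rewrite ler_expR -mulNr; have [z0|z0] := leP 0 (- z).
  by rewrite ler_piMr// ltW.
by rewrite nmulr_rle0// ltW.
Qed.

Lemma beta_laplace_density_le (b : R) i (z u : R) : 0 < u -> u < 1 ->
  `|beta_laplace_density b i z u| <= beta_kernel b b u * expR (Num.max 0 (- z)).
Proof.
move=> u0 u1; rewrite ger0_norm ?beta_laplace_density_ge0//.
rewrite /beta_laplace_density ler_pM ?expR_le_on01 ?expR_ge0//.
  by rewrite mulr_ge0 ?exprn_ge0 ?beta_kernel_ge0// ltW.
by rewrite ler_piMl ?beta_kernel_ge0// exprn_ile1// ltW.
Qed.

Lemma integrable_beta_laplace (b : R) i (z : R) : 0 < b ->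
  mu.-integrable `]0, 1[ (EFin \o beta_laplace_density b i z).
Proof.
move=> b0.
have h := integrableZ_fin (expR (Num.max 0 (- z))) (measurable_itv _) (integrable_beta_kernel b0 b0).
apply: (le_integrable_fin _ _ _ h) => //.
  exact: measurable_beta_laplace_density.
move=> u /=; rewrite in_itv/= => /andP[u0 u1].
by rewrite mulrC; exact: beta_laplace_density_le.
Qed.

Lemma beta_laplace_ge0 (b : R) i (z : R) : 0 <= beta_laplace b i z.
Proof.
apply: Rintegral_ge0 => u /=; rewrite in_itv/= => /andP[u0 u1].
exact: beta_laplace_density_ge0.
Qed.

Lemma beta_laplace_le (b : R) i (z : R) : 0 < b ->
  beta_laplace b i z <= beta_laplace b 0 0 * expR (Num.max 0 (- z)).
Proof.
move=> b0; rewrite -[leLHS]ger0_norm ?beta_laplace_ge0//.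
rewrite -RintegralZr//; last exact: integrable_beta_laplace.
apply: le_RintegralW => //.
- exact: measurable_beta_laplace_density.
- by apply: integrableZr_fin => //; exact: integrable_beta_laplace.
- move=> u /=; rewrite in_itv/= => /andP[u0 u1].
  apply: (le_trans (beta_laplace_density_le _ _ _ u0 u1)).
  by rewrite /beta_laplace_density expr0 mul1r mul0r oppr0 expR0 mulr1.
Qed.

Lemma beta_laplace_le0 (b : R) i (z : R) : 0 < b -> 0 <= z ->
  beta_laplace b i z <= beta_laplace b 0 0.
Proof.
move=> b0 z0; apply: (le_trans (beta_laplace_le i z b0)).
by rewrite max_l ?oppr_le0// expR0 mulr1.
Qed.

Lemma is_derive_expR_scale (u z : R) :
  is_derive z 1 (fun z => expR (- (z * u))) (- (u * expR (- (z * u)))).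
Proof.
have h : is_derive z 1 (fun z => - (z * u)) (- u).
  rewrite [X in is_derive _ _ X _](_ : _ = (- u) \*: id); last first.
    by apply/funext => x /=; rewrite /GRing.scale/= mulNr mulrC.
  by apply: is_derive_eq; rewrite /GRing.scale/= mulr1.
have := @is_derive1_comp R expR (fun z => - (z * u)) z _ _ (is_derive_expR _) h.
by rewrite mulrN mulrC.
Qed.

Lemma is_derive_beta_laplace (b : R) i (z : R) : 0 < b ->
  is_derive z 1 (beta_laplace b i) (- beta_laplace b i.+1 z).
Proof.
move=> b0.
have zI : z \in `]z - 1, z + 1[ by rewrite in_itv/= ltrBlDr ltrDl ltr01.
have -> : - beta_laplace b i.+1 z
    = \int[mu]_(u in `]0, 1[) (- beta_laplace_density b i.+1 z u).
  rewrite /beta_laplace -[in LHS]mulN1r -RintegralZl//; last exact: integrable_beta_laplace.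
  by apply: eq_Rintegral => u _; rewrite mulN1r.
apply: (is_derive_Rintegral (f := beta_laplace_density b i)
  (df := fun x u => - beta_laplace_density b i.+1 x u)
  (G := fun u => expR (`|z| + 1) * beta_kernel b b u) _ zI) => //.
- by move=> x _; exact: integrable_beta_laplace.
- move=> x u _ _; rewrite /beta_laplace_density.
  have h := is_derive_expR_scale u x.
  rewrite [X in is_derive _ _ X _](_ : _ =
    (u ^+ i * beta_kernel b b u) \*: (fun z => expR (- (z * u)))); last by apply/funext.
  by apply: is_derive_eq; rewrite /GRing.scale/= exprS; ring.
- move=> x u /=; rewrite !in_itv/= => /andP[x1 x2] /andP[u0 u1].
  rewrite normrN; apply: (le_trans (beta_laplace_density_le _ _ _ u0 u1)).
  rewrite mulrC ler_wpM2r ?beta_kernel_ge0// ler_expR ge_max addr_ge0//=.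
  by have := ler_norm (- z); rewrite normrN => hz; lra.
- by apply: integrableZ_fin => //; exact: integrable_beta_kernel.
Qed.

Lemma continuous_beta_laplace (b : R) i : 0 < b -> continuous (beta_laplace b i).
Proof.
move=> b0 z; apply: differentiable_continuous; apply/derivable1_diffP.
by apply: ex_derive; exact: is_derive_beta_laplace.
Qed.

Lemma beta_laplace_lip (b : R) i (z1 z2 : R) : 0 < b -> 0 <= z1 -> 0 <= z2 ->
  `|beta_laplace b i z1 - beta_laplace b i z2| <= beta_laplace b 0 0 * `|z1 - z2|.
Proof.
move=> b0; wlog z12 : z1 z2 / z1 < z2 => [hw|] z10 z20.
  have [h|h|->] := ltgtP z1 z2; [exact: hw| |by rewrite !subrr normr0 mulr0].
  by rewrite distrC [`|z1 - _|]distrC; exact: hw.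
have [||c /[!in_itv]/=/andP[c1 c2] e] := @MVT R (beta_laplace b i) (fun z => - beta_laplace b i.+1 z) z1 z2 z12.
- by move=> x _; exact: is_derive_beta_laplace.
- by apply: continuous_subspaceT => x; exact: continuous_beta_laplace.
rewrite distrC [`|z1 - _|]distrC e normrM ler_wpM2r// normrN ger0_norm ?beta_laplace_ge0//.
by rewrite beta_laplace_le0// (le_trans z10)// ltW.
Qed.

Lemma beta_laplace_moment (b : R) i : 0 < b ->
  beta_laplace b i 0 = Gamma_fun (b + i%:R) * Gamma_fun b / Gamma_fun (2 * b + i%:R).
Proof.
move=> b0; have bi0 : 0 < b + i%:R by rewrite ltr_wpDr.
rewrite /beta_laplace /Rintegral (eq_integral_on (g := fun u => (beta_kernel (b + i%:R) b u)%:E)).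
  have -> : 2 * b + i%:R = b + i%:R + b by ring.
  by rewrite integral_beta_kernel.
move=> u /=; rewrite in_itv/= => /andP[u0 u1]; congr EFin.
rewrite /beta_laplace_density mul0r oppr0 expR0 mulr1 /beta_kernel mulrA; congr (_ * _).
rewrite -powR_mulrn ?(ltW u0)// -powRD; last by rewrite (gt_eqF u0)/= implybT.
by congr (_ `^ _); ring.
Qed.

(** On u <= 1 / 2 the factor (1 - u)^(b - 1) is at most 2; on u > 1 / 2 the
    exponential is at most e^(- z / 2). *)
Lemma beta_laplace_density_split (b : R) i (z u : R) : 0 < b -> b < 1 -> 0 <= z ->
  0 < u -> u < 1 ->
  beta_laplace_density b i z u
  <= 2 * gamma_kernel (b + i%:R) z u + expR (- (z / 2)) * beta_kernel b b u.
Proof.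
move=> b0 b1 z0 u0 u1; have [u2|u2] := leP u (1 / 2).
  apply: (@le_trans _ _ (2 * gamma_kernel (b + i%:R) z u)); last first.
    by rewrite lerDl mulr_ge0 ?expR_ge0 ?beta_kernel_ge0.
  rewrite /beta_laplace_density /gamma_kernel mulrA ler_wpM2r ?expR_ge0//.
  rewrite /beta_kernel mulrA.
  have -> : u ^+ i * u `^ (b - 1) = u `^ (b + i%:R - 1).
    rewrite -powR_mulrn ?(ltW u0)// -powRD; last by rewrite (gt_eqF u0)/= implybT.
    by congr (_ `^ _); ring.
  rewrite mulrC ler_wpM2r ?powR_ge0//.
  have h : 1 / 2 <= 1 - u by lra.
  have -> : b - 1 = - (1 - b) by ring.
  rewrite powRN -[leRHS]invrK lef_pV2 ?posrE ?powR_gt0 ?invr_gt0//; last by lra.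
  apply: (@le_trans _ _ ((1 / 2) `^ (1 - b))).
    suff : 1 / 2 <= (1 / 2) `^ (1 - b) by move=> hs; lra.
    by apply: ger1_powR; [apply/andP; split|]; lra.
  by apply: ge0_ler_powR; rewrite ?nnegrE//; lra.
apply: (@le_trans _ _ (expR (- (z / 2)) * beta_kernel b b u)); last first.
  by rewrite lerDr mulr_ge0// gamma_kernel_ge0.
rewrite /beta_laplace_density mulrC ler_pM ?expR_ge0//.
- by rewrite mulr_ge0 ?exprn_ge0 ?beta_kernel_ge0// ltW.
- by rewrite ler_expR lerN2 -[z / 2]mulr1 ; nra.
- by rewrite ler_piMl ?beta_kernel_ge0// exprn_ile1// ltW.
Qed.

(** The mass near u = 0 gives the power z^(- (b + i)) of a complete Gamma integral,
    and the rest is exponentially small. *)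
Lemma powR_beta_laplace_le (b : R) i : 0 < b -> b < 1 ->
  exists2 C, 0 < C & forall z, 0 < z -> z `^ (b + i%:R) * beta_laplace b i z <= C.
Proof.
move=> b0 b1; have bi0 : 0 < b + i%:R by rewrite ltr_wpDr.
pose k := b + i%:R.
exists (2 * Gamma_fun k + (k / 2^-1) `^ k * beta_laplace b 0 0).
  apply: ltr_pwDl; first by rewrite mulr_gt0// Gamma_fun_gt0.
  by rewrite mulr_ge0 ?powR_ge0 ?beta_laplace_ge0.
move=> z z0.
have iG : mu.-integrable `]0, 1[ (EFin \o gamma_kernel k z).
  apply: (integrableS_fin _ _ _ (integrable_gamma_kernel bi0 z0)) => //.
  exact: subset_itvl.
have i1 : mu.-integrable `]0, 1[ (EFin \o (fun u => 2 * gamma_kernel k z u)).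
  exact: integrableZ_fin.
have i2 : mu.-integrable `]0, 1[ (EFin \o (fun u => expR (- (z / 2)) * beta_kernel b b u)).
  by apply: integrableZ_fin => //; exact: integrable_beta_kernel.
have h : beta_laplace b i z <= 2 * (Gamma_fun k * z `^ (- k)) + expR (- (z / 2)) * beta_laplace b 0 0.
  apply: (@le_trans _ _ (\int[mu]_(u in `]0, 1[)
     (2 * gamma_kernel k z u + expR (- (z / 2)) * beta_kernel b b u))).
    apply: le_Rintegral => //.
    - exact: integrable_beta_laplace.
    - exact: integrableD_fin.
    - move=> u /=; rewrite in_itv/= => /andP[u0 u1].
      by apply: beta_laplace_density_split => //; exact: ltW.
  rewrite RintegralD// RintegralZl// RintegralZl//; last exact: integrable_beta_kernel.
  apply: lerD.
    rewrite ler_pM2l// -[leRHS]/(fine (_%:E)) -integral_gamma_kernel//.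
    apply: fine_le.
    - exact: integrable_fin_num.
    - by apply: integrable_fin_num => //; exact: integrable_gamma_kernel.
    - apply: ge0_subset_integral => //.
      + by apply/measurable_EFinP; exact: measurable_gamma_kernel.
      + by move=> x _; rewrite lee_fin gamma_kernel_ge0.
      + exact: subset_itvl.
  by rewrite beta_laplace00.
apply: (le_trans (ler_wpM2l (powR_ge0 z k) h)).
rewrite mulrDr lerD//.
  rewrite powRN; have : z `^ k != 0 by rewrite gt_eqF// powR_gt0.
  move=> hk.
  by rewrite [leLHS](_ : _ = 2 * Gamma_fun k)//; field.
rewrite mulrA ler_wpM2r ?beta_laplace_ge0// expRN ler_pdivrMr ?expR_gt0//.
by rewrite [z / 2]mulrC; apply: powR_le_expR => //; rewrite ?ltW// invr_gt0.
Qed.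

End beta_laplace.

(** * Asymptotics and Taylor expansion of the transform *)

Section beta_laplace_asymptotics.
Variable R : realType.
Notation mu := (@lebesgue_measure R).

Lemma beta_kernel_near0 (b u : R) : 0 < b -> b < 1 -> 0 < u -> u < 1 ->
  `|beta_kernel b b u - u `^ (b - 1)| <= u * beta_kernel b b u.
Proof.
move=> b0 b1 u0 u1; rewrite /beta_kernel.
set v := 1 - u; set p := u `^ (b - 1); set q := v `^ (b - 1).
have v0 : 0 < v by rewrite subr_gt0.
have p0 : 0 <= p by exact: powR_ge0.
have q0 : 0 <= q by exact: powR_ge0.
have q1 : 1 <= q.
  rewrite /q -[b - 1]opprB powRN -[leLHS]invr1 lef_pV2 ?posrE ?powR_gt0//.
  rewrite -[leRHS](powRr0 v); apply: ger_powR; last by rewrite subr_ge0 ltW.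
  by rewrite v0/= /v gerBl ltW.
have vq : v * q <= 1.
  rewrite mulr_powRB1 ?(ltW v0)// -[leRHS](powRr0 v); apply: ger_powR; last exact: ltW.
  by rewrite v0/= /v gerBl ltW.
have -> : p * q - p = p * (q - 1) by ring.
rewrite ger0_norm; last by rewrite mulr_ge0// subr_ge0.
have -> : u * (p * q) = p * (q - v * q) by rewrite /v; ring.
by rewrite ler_wpM2l// lerB.
Qed.

(** Replacing (1 - u)^(b - 1) by 1 costs at most beta_laplace b 1 z, which is
    O(z^(- (b + 1))); so does the extension of the integral to ]0, oo[. *)
Lemma beta_laplace_asymp1 (b : R) : 0 < b -> b < 1 -> exists2 C, 0 < C &
  forall z, 0 < z -> `|z `^ b * beta_laplace b 0 z - Gamma_fun b| <= C / z.
Proof.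
move=> b0 b1; have [C C0 hC] := powR_beta_laplace_le 1 b0 b1.
have b10 : 0 < b + 1 by rewrite addr_gt0.
exists (C + Gamma_fun (b + 1)); first by rewrite addr_gt0// Gamma_fun_gt0.
move=> z z0; have zb0 := powR_gt0 b z0.
have ig := integrable_gamma_kernel b0 z0.
have ig1 := integrable_gamma_kernel b10 z0.
have U : `]0, +oo[%classic = `]0, 1[%classic `|` `[1, +oo[%classic :> set R.
  by rewrite -itv_bndbnd_setU// bnd_simp.
have i01 : mu.-integrable `]0, 1[ (EFin \o gamma_kernel b z).
  by apply: integrableS_fin ig => //; exact: subset_itvl.
have sub1 : (`[1, +oo[%classic : set R) `<=` `]0, +oo[%classic by apply: subset_itvr; rewrite bnd_simp.
have i1y : mu.-integrable `[1, +oo[ (EFin \o gamma_kernel b z) by apply: integrableS_fin ig.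
have i1y1 : mu.-integrable `[1, +oo[ (EFin \o gamma_kernel (b + 1) z) by apply: integrableS_fin ig1.
have eG : Gamma_fun b = z `^ b * (\int[mu]_(u in `]0, 1[) gamma_kernel b z u
    + \int[mu]_(u in `[1, +oo[) gamma_kernel b z u).
  rewrite -Rintegral_setU//; last 2 first.
  - by rewrite -U.
  - rewrite disj_set2E; apply/eqP/seteqP; split => // u [] /=; rewrite !in_itv/= andbT.
    by move=> /andP[_ u1]; rewrite leNgt u1.
  rewrite -U /Rintegral integral_gamma_kernel//= powRN.
  by rewrite mulrC divfK// gt_eqF.
have h1 : `|beta_laplace b 0 z - \int[mu]_(u in `]0, 1[) gamma_kernel b z u| <= beta_laplace b 1 z.
  rewrite -RintegralB//; last exact: integrable_beta_laplace.
  apply: le_RintegralW => //.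
  - apply: measurable_funB; first exact: measurable_beta_laplace_density.
    exact: measurable_gamma_kernel.
  - exact: integrable_beta_laplace.
  move=> u /=; rewrite in_itv/= => /andP[u0 u1].
  rewrite /beta_laplace_density /gamma_kernel expr0 mul1r expr1 -mulrBl normrM.
  by rewrite [X in _ * X]ger0_norm ?expR_ge0// ler_wpM2r ?expR_ge0// beta_kernel_near0.
have h2 : `|\int[mu]_(u in `[1, +oo[) gamma_kernel b z u| <= Gamma_fun (b + 1) * z `^ (- (b + 1)).
  apply: (@le_trans _ _ (\int[mu]_(u in `[1, +oo[) gamma_kernel (b + 1) z u)).
    apply: le_RintegralW => //; first exact: measurable_gamma_kernel.
    move=> u /=; rewrite in_itv/= andbT => u1; rewrite ger0_norm ?gamma_kernel_ge0//.
    by rewrite ler_wpM2r ?expR_ge0// ler_powR// lerD2r lerDl.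
  rewrite -[leRHS]/(fine (_%:E)) -integral_gamma_kernel//; apply: fine_le.
  - exact: integrable_fin_num.
  - exact: integrable_fin_num.
  - apply: ge0_subset_integral => //.
    + by apply/measurable_EFinP; exact: measurable_gamma_kernel.
    + by move=> x _; rewrite lee_fin gamma_kernel_ge0.
rewrite eG -mulrBr normrM (gtr0_norm zb0) opprD addrA.
apply: (@le_trans _ _ (z `^ b * (beta_laplace b 1 z + Gamma_fun (b + 1) * z `^ (- (b + 1))))).
  by rewrite ler_pM2l//; apply: (le_trans (ler_normB _ _)); exact: lerD.
have zb1 : z `^ (b + 1) = z * z `^ b.
  by rewrite powRD ?(gt_eqF z0) ?implybT// powRr1 ?ltW// mulrC.
rewrite ler_pdivlMr// mulrDr mulrDl lerD//.
  by rewrite mulrAC [_ * z]mulrC -zb1; exact: hC.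
rewrite powRN zb1 [leLHS](_ : _ = Gamma_fun (b + 1))//; field.
by rewrite !gt_eqF.
Qed.

(** The error is weakened from 1 / z to z^(- 1/2), which is integrable at 0: the
    bound has to be integrated in t with z = t X. *)
Lemma beta_laplace_asymp (b : R) : 0 < b -> b < 1 -> exists2 C, 0 < C &
  forall z, 0 < z -> `|z `^ b * beta_laplace b 0 z - Gamma_fun b| <= C * z `^ (- 2^-1).
Proof.
move=> b0 b1; have [C1 C10 h1] := beta_laplace_asymp1 b0 b1.
have [C2 C20 h2] := powR_beta_laplace_le 0 b0 b1.
have G0 := Gamma_fun_gt0 b0.
exists (C1 + (C2 + Gamma_fun b)); first by rewrite !addr_gt0.
move=> z z0; have [z1|z1] := leP 1 z.
  apply: (le_trans (h1 _ z0)); apply: (@le_trans _ _ (C1 * z `^ (- 2^-1))).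
    by rewrite -(powR_inv1 (ltW z0)) ler_pM2l//; apply: ler_powR => //; lra.
  by rewrite ler_wpM2r ?powR_ge0// lerDl addr_ge0 ?ltW.
apply: (@le_trans _ _ (C2 + Gamma_fun b)).
  apply: (le_trans (ler_normB _ _)); rewrite (gtr0_norm G0) lerD2r.
  have := h2 _ z0; rewrite addr0 ger0_norm//.
  by rewrite mulr_ge0 ?powR_ge0 ?beta_laplace_ge0.
apply: (@le_trans _ _ (C1 + (C2 + Gamma_fun b))); first by rewrite lerDr ltW.
have C0 : 0 <= C1 + (C2 + Gamma_fun b) by rewrite ltW// !addr_gt0.
rewrite ler_peMr// -[leLHS](powRr0 z); apply: ger_powR; last by lra.
by rewrite z0 ltW.
Qed.

Definition beta_laplace_taylor (b z h : R) (N : nat) : R :=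
  \sum_(m < N) (h ^+ m / m`!%:R * beta_laplace b m z).

Lemma beta_laplace_taylorE (b z h : R) (N : nat) : 0 < b ->
  mu.-integrable `]0, 1[ (EFin \o (fun u => series (exp_coeff (h * u)) N * beta_laplace_density b 0 z u))
  /\ beta_laplace_taylor b z h N =
  \int[mu]_(u in `]0, 1[) (series (exp_coeff (h * u)) N * beta_laplace_density b 0 z u).
Proof.
move=> b0; rewrite /beta_laplace_taylor; elim: N => [|N [IH1 IH2]].
  rewrite big_ord0; have e u : series (exp_coeff (h * u)) 0 * beta_laplace_density b 0 z u = 0.
    by rewrite /series/= big_geq// mul0r.
  split.
    rewrite (_ : EFin \o _ = cst 0%E); first exact: integrable0.
    by apply/funext => u /=; rewrite e.
  by rewrite (eq_Rintegral_on (g := cst 0)) ?Rintegral_cst ?mul0r// => u _; rewrite e.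
have e u : series (exp_coeff (h * u)) N.+1 * beta_laplace_density b 0 z u =
    series (exp_coeff (h * u)) N * beta_laplace_density b 0 z u
    + h ^+ N / N`!%:R * beta_laplace_density b N z u.
  rewrite /series/= big_nat_recr//= mulrDl; congr (_ + _).
  by rewrite /exp_coeff/= /beta_laplace_density exprMn expr0; ring.
have ef : (fun u => series (exp_coeff (h * u)) N.+1 * beta_laplace_density b 0 z u) =
   (fun u => series (exp_coeff (h * u)) N * beta_laplace_density b 0 z u
    + h ^+ N / N`!%:R * beta_laplace_density b N z u) by apply/funext => u; exact: e.
have iN : mu.-integrable `]0, 1[ (EFin \o (fun u => h ^+ N / N`!%:R * beta_laplace_density b N z u)).
  by apply: integrableZ_fin => //; exact: integrable_beta_laplace.
rewrite ef; split; first exact: integrableD_fin.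
rewrite RintegralD// -IH2 big_ord_recr/=; congr (_ + _).
by rewrite RintegralZl//; exact: integrable_beta_laplace.
Qed.

Lemma series_exp_coeff_le (x : R) N : `|series (exp_coeff x) N| <= expR `|x|.
Proof.
apply: (@le_trans _ _ (series (exp_coeff `|x|) N)).
  rewrite /series/=; apply: (le_trans (ler_norm_sum _ _ _)).
  by apply: ler_sum => i _; rewrite /exp_coeff/= normrM normrX normfV [`|_%:R|]ger0_norm.
apply: nondecreasing_cvgn_le; last exact: is_cvg_series_exp_coeff.
apply/nondecreasing_seqP => n; rewrite /series/= big_nat_recr//= lerDl.
exact: exp_coeff_ge0.
Qed.

Lemma beta_laplace_density_shift (b z h u : R) :
  expR (h * u) * beta_laplace_density b 0 z u = beta_laplace_density b 0 (z - h) u.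
Proof.
by rewrite /beta_laplace_density mulrCA -expRD; congr (_ * expR _); ring.
Qed.

(** The partial sums of e^(h u) are at most e^(|h| u), which shifts z by |h|. *)
Lemma series_density_le (b z h u : R) N : 0 < u ->
  `|series (exp_coeff (h * u)) N * beta_laplace_density b 0 z u|
  <= beta_laplace_density b 0 (z - `|h|) u.
Proof.
move=> u0; rewrite normrM -beta_laplace_density_shift.
rewrite (ger0_norm (beta_laplace_density_ge0 _ _ _ u0)).
rewrite ler_wpM2r ?beta_laplace_density_ge0//.
by apply: (le_trans (series_exp_coeff_le _ _)); rewrite normrM (gtr0_norm u0).
Qed.

Lemma beta_laplace_taylor_le (b z h : R) N : 0 < b ->
  `|beta_laplace_taylor b z h N| <= beta_laplace b 0 (z - `|h|).
Proof.
move=> b0; have [i1 ->] := beta_laplace_taylorE z h N b0.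
apply: le_RintegralW => //.
- by have /integrableP[/measurable_EFinP] := i1.
- exact: integrable_beta_laplace.
- by move=> u /=; rewrite in_itv/= => /andP[u0 u1]; exact: series_density_le.
Qed.

Lemma beta_laplace_taylor_cvg (b z h : R) : 0 < b ->
  beta_laplace_taylor b z h N @[N --> \oo] --> beta_laplace b 0 (z - h).
Proof.
move=> b0.
rewrite (_ : beta_laplace_taylor b z h = fun N =>
  \int[mu]_(u in `]0, 1[) (series (exp_coeff (h * u)) N * beta_laplace_density b 0 z u)); last first.
  by apply/funext => N; have [] := beta_laplace_taylorE z h N b0.
apply: (Rintegral_dominated_cvg (g := beta_laplace_density b 0 (z - `|h|)) _ _ _ _ _).2 => //.
- move=> N; have [/integrableP[/measurable_EFinP]//] := beta_laplace_taylorE z h N b0.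
- move=> u _; rewrite -beta_laplace_density_shift; apply: cvgMl.
  exact: is_cvg_series_exp_coeff.
- exact: integrable_beta_laplace.
- by move=> N u /=; rewrite in_itv/= => /andP[u0 u1]; exact: series_density_le.
Qed.

End beta_laplace_asymptotics.

(** * Laplace integrals of a product of two transforms *)

Section laplace_pair.
Variable R : realType.
Notation mu := (@lebesgue_measure R).
Variables b1 b2 : R.
Hypotheses (b10 : 0 < b1) (b11 : b1 < 1) (b20 : 0 < b2) (b21 : b2 < 1).

Definition laplace_pair_density (k : R) (i j : nat) (rho X Y t : R) : R :=
  gamma_kernel k rho t * (beta_laplace b1 i (t * X) * beta_laplace b2 j (t * Y)).

(** For k = a, i = j = 0 and rho = 1 this is a multiple of Appell's function at
    (- X, - Y).  The indices i and j count derivatives in X and Y, up to sign, and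
    k grows by one with each derivative. *)
Definition laplace_pair (k : R) (i j : nat) (rho X Y : R) : R :=
  \int[mu]_(t in `]0, +oo[) laplace_pair_density k i j rho X Y t.

Let B := beta_laplace b1 0 0 * beta_laplace b2 0 0.

Lemma laplace_pair_const_ge0 : 0 <= B.
Proof. by rewrite mulr_ge0 ?beta_laplace_ge0. Qed.

Lemma laplace_pair_density_ge0 k i j (rho X Y t : R) :
  0 <= laplace_pair_density k i j rho X Y t.
Proof. by rewrite mulr_ge0 ?gamma_kernel_ge0// mulr_ge0 ?beta_laplace_ge0. Qed.

Lemma measurable_beta_laplace_scale (b X : R) i : 0 < b ->
  measurable_fun [set: R] (fun t => beta_laplace b i (t * X)).
Proof.
move=> b0; have h : continuous (beta_laplace b i \o (fun t : R => t * X)).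
  move=> t; apply: continuous_comp; last exact: continuous_beta_laplace.
  by apply: cvgMl; exact: cvg_id.
exact: continuous_measurable_fun.
Qed.

Lemma measurable_laplace_pair_density k i j (rho X Y : R) D :
  measurable_fun D (laplace_pair_density k i j rho X Y).
Proof.
apply: measurable_funTS; apply: measurable_funM; first exact: measurable_gamma_kernel.
by apply: measurable_funM; exact: measurable_beta_laplace_scale.
Qed.

Lemma beta_laplace_scale_le (b X t : R) i : 0 < b -> 0 < t ->
  beta_laplace b i (t * X) <= beta_laplace b 0 0 * expR (- (Num.min 0 X * t)).
Proof.
move=> b0 t0; apply: (le_trans (beta_laplace_le i _ b0)).
rewrite ler_wpM2l ?beta_laplace_ge0// ler_expR; have [X0|X0] := leP 0 X.
  by rewrite mul0r oppr0 max_l// oppr_le0 mulr_ge0// ltW.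
by rewrite max_r; [rewrite mulrC|rewrite oppr_ge0 pmulr_rle0// ltW].
Qed.

(** Negative X and Y are covered, as long as rho outweighs them: near the origin
    the arguments of Appell's function have both signs. *)
Lemma laplace_pair_density_le k i j (rho X Y t : R) : 0 < t ->
  laplace_pair_density k i j rho X Y t
  <= B * gamma_kernel k (rho + Num.min 0 X + Num.min 0 Y) t.
Proof.
move=> t0; rewrite /laplace_pair_density /gamma_kernel.
have h1 := beta_laplace_scale_le X i b10 t0.
have h2 := beta_laplace_scale_le Y j b20 t0.
apply: (@le_trans _ _ (t `^ (k - 1) * expR (- (rho * t)) *
  ((beta_laplace b1 0 0 * expR (- (Num.min 0 X * t))) * (beta_laplace b2 0 0 * expR (- (Num.min 0 Y * t)))))).
  by rewrite ler_wpM2l ?mulr_ge0 ?powR_ge0 ?expR_ge0// ler_pM ?beta_laplace_ge0.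
rewrite !mulrDl !opprD !expRD /B le_eqVlt; apply/orP; left; apply/eqP; ring.
Qed.

Lemma integrable_laplace_pair k i j (rho X Y : R) : 0 < k ->
  0 < rho + Num.min 0 X + Num.min 0 Y ->
  mu.-integrable `]0, +oo[ (EFin \o laplace_pair_density k i j rho X Y).
Proof.
move=> k0 s0.
apply: (le_integrable_fin _ _ _ (integrableZ_fin B (measurable_itv _) (integrable_gamma_kernel k0 s0))) => //.
  exact: measurable_laplace_pair_density.
move=> t /=; rewrite in_itv/= andbT => t0.
by rewrite ger0_norm ?laplace_pair_density_ge0//; exact: laplace_pair_density_le.
Qed.

Lemma integrable_laplace_pair0 k i j (rho X Y : R) : 0 < k -> 0 < rho -> 0 <= X -> 0 <= Y ->
  mu.-integrable `]0, +oo[ (EFin \o laplace_pair_density k i j rho X Y).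
Proof.
move=> k0 r0 X0 Y0; apply: integrable_laplace_pair => //.
by rewrite !min_l// !addr0.
Qed.

Lemma laplace_pair_ge0 k i j (rho X Y : R) : 0 <= laplace_pair k i j rho X Y.
Proof. by apply: Rintegral_ge0 => t _; exact: laplace_pair_density_ge0. Qed.

Lemma expRN_lip (m x y : R) : m <= x -> m <= y ->
  `|expR (- x) - expR (- y)| <= expR (- m) * `|x - y|.
Proof.
wlog xy : x y / x <= y => [hw|] mx my.
  have [h|/ltW h] := leP x y; first exact: hw.
  by rewrite distrC [`|x - y|]distrC; exact: hw.
rewrite ger0_norm; last by rewrite subr_ge0 ler_expR lerN2.
rewrite distrC ger0_norm ?subr_ge0//.
have -> : - y = - x + (x - y) by ring.
rewrite expRD -[X in X - _]mulr1 -mulrBr ler_pM ?expR_ge0//.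
- by rewrite subr_ge0 -expR0 ler_expR subr_le0.
- by rewrite ler_expR lerN2.
- by have := expR_ge1Dx (x - y) => h; lra.
Qed.

Lemma laplace_pair_density_lip k i j (m rho X Y rho' X' Y' t : R) : 0 < t ->
  m <= rho -> m <= rho' -> 0 <= X -> 0 <= X' -> 0 <= Y -> 0 <= Y' ->
  `|laplace_pair_density k i j rho X Y t - laplace_pair_density k i j rho' X' Y' t|
  <= B * (`|rho - rho'| + `|X - X'| + `|Y - Y'|) * gamma_kernel (k + 1) m t.
Proof.
move=> t0 mr mr' X0 X0' Y0 Y0'; rewrite /laplace_pair_density /gamma_kernel.
have tk : t `^ (k + 1 - 1) = t * t `^ (k - 1).
  rewrite -{2}(powRr1 (ltW t0)) -powRD; last by rewrite (gt_eqF t0) implybT.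
  by congr (_ `^ _); ring.
rewrite tk; set p := t `^ (k - 1).
have p0 : 0 <= p by exact: powR_ge0.
have tX : 0 <= t * X by rewrite mulr_ge0// ltW.
have tX' : 0 <= t * X' by rewrite mulr_ge0// ltW.
have tY : 0 <= t * Y by rewrite mulr_ge0// ltW.
have tY' : 0 <= t * Y' by rewrite mulr_ge0// ltW.
have hX := beta_laplace_lip i b10 tX tX'.
have hY := beta_laplace_lip j b20 tY tY'.
rewrite -mulrBr normrM (gtr0_norm t0) in hX.
rewrite -mulrBr normrM (gtr0_norm t0) in hY.
have he : `|expR (- (rho * t)) - expR (- (rho' * t))| <= expR (- (m * t)) * (t * `|rho - rho'|).
  apply: (le_trans (expRN_lip (m := m * t) _ _)).
  - by rewrite ler_pM2r.
  - by rewrite ler_pM2r.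
  - by rewrite -mulrBl normrM (gtr0_norm t0) [`|_| * t]mulrC.
have e1 : expR (- (rho * t)) <= expR (- (m * t)) by rewrite ler_expR lerN2 ler_pM2r.
have e2 : expR (- (rho' * t)) <= expR (- (m * t)) by rewrite ler_expR lerN2 ler_pM2r.
have P1 := beta_laplace_le0 i b10 tX.
have P1' := beta_laplace_le0 i b10 tX'.
have P2 := beta_laplace_le0 j b20 tY.
have Q1 := beta_laplace_ge0 b1 i (t * X).
have Q1' := beta_laplace_ge0 b1 i (t * X').
have Q2 := beta_laplace_ge0 b2 j (t * Y).
have E0 := expR_ge0 (- (m * t)).
have E1 := expR_ge0 (- (rho * t)).
have E2 := expR_ge0 (- (rho' * t)).
rewrite /B; move: (beta_laplace b1 0 0) (beta_laplace b2 0 0) P1 P1' P2 hX hY => b b' P1 P1' P2 hX hY.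
move: (beta_laplace b1 i (t * X)) (beta_laplace b1 i (t * X')) (beta_laplace b2 j (t * Y)) (beta_laplace b2 j (t * Y')) Q1 Q1' Q2 P1 P1' P2 hX hY => u u' v v' Q1 Q1' Q2 P1 P1' P2 hX hY.
move: (expR (- (m * t))) (expR (- (rho * t))) (expR (- (rho' * t))) E0 E1 E2 e1 e2 he => em e e' E0 E1 E2 e1 e2 he.
have -> : p * e * (u * v) - p * e' * (u' * v')
  = p * ((e - e') * (u * v) + e' * ((u - u') * v) + e' * (u' * (v - v'))) by ring.
have -> : b * b' * (`|rho - rho'| + `|X - X'| + `|Y - Y'|) * (t * p * em)
  = p * (em * (t * `|rho - rho'|) * (b * b') + em * ((b * (t * `|X - X'|)) * b')
     + em * (b * (b' * (t * `|Y - Y'|)))) by ring.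
rewrite normrM (ger0_norm p0) ler_wpM2l//.
apply: (le_trans (ler_normD _ _)); apply: lerD.
  apply: (le_trans (ler_normD _ _)); apply: lerD.
    by rewrite normrM (ger0_norm (mulr_ge0 Q1 Q2)) ler_pM// ?mulr_ge0// ler_pM.
  by rewrite normrM (ger0_norm E2) ler_pM// normrM (ger0_norm Q2) ler_pM.
by rewrite normrM (ger0_norm E2) ler_pM// normrM (ger0_norm Q1') ler_pM.
Qed.

(** Each difference costs one factor t, hence the exponent k + 1. *)
Lemma laplace_pair_lip k i j (m rho X Y rho' X' Y' : R) : 0 < k -> 0 < m ->
  m <= rho -> m <= rho' -> 0 <= X -> 0 <= X' -> 0 <= Y -> 0 <= Y' ->
  `|laplace_pair k i j rho X Y - laplace_pair k i j rho' X' Y'|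
  <= B * (`|rho - rho'| + `|X - X'| + `|Y - Y'|) * (Gamma_fun (k + 1) * m `^ (- (k + 1))).
Proof.
move=> k0 m0 mr mr' X0 X0' Y0 Y0'.
have r0 := lt_le_trans m0 mr; have r0' := lt_le_trans m0 mr'.
have k10 : 0 < k + 1 by rewrite addr_gt0.
have i1 : mu.-integrable `]0, +oo[ (EFin \o laplace_pair_density k i j rho X Y).
  exact: integrable_laplace_pair0.
have i2 : mu.-integrable `]0, +oo[ (EFin \o laplace_pair_density k i j rho' X' Y').
  exact: integrable_laplace_pair0.
have ig := integrable_gamma_kernel k10 m0.
rewrite /laplace_pair -RintegralB//.
set K := B * _.
have -> : K * (Gamma_fun (k + 1) * m `^ (- (k + 1))) =
   \int[mu]_(t in `]0, +oo[) (K * gamma_kernel (k + 1) m t).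
  by rewrite RintegralZl// /Rintegral integral_gamma_kernel.
apply: le_RintegralW => //.
- by apply: measurable_funB; exact: measurable_laplace_pair_density.
- exact: integrableZ_fin.
- by move=> t /=; rewrite in_itv/= andbT => t0; exact: laplace_pair_density_lip.
Qed.

Lemma laplace_pair_cvg (T : Type) (F : set_system T) (FF : Filter F) k i j
    (rho X Y : T -> R) (rho0 X0 Y0 : R) :
  0 < k -> 0 < rho0 -> 0 <= X0 -> 0 <= Y0 ->
  rho @ F --> rho0 -> X @ F --> X0 -> Y @ F --> Y0 ->
  (\forall p \near F, 0 <= X p) -> (\forall p \near F, 0 <= Y p) ->
  laplace_pair k i j (rho p) (X p) (Y p) @[p --> F] --> laplace_pair k i j rho0 X0 Y0.
Proof.
move=> k0 r0 X00 Y00 cr cX cY pX pY; pose m := rho0 / 2.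
have m0 : 0 < m by rewrite divr_gt0.
have mr : m <= rho0 by rewrite /m; lra.
pose K := B * (Gamma_fun (k + 1) * m `^ (- (k + 1))).
have hlim : K * (`|rho p - rho0| + `|X p - X0| + `|Y p - Y0|) @[p --> F] --> (0 : R).
  rewrite -[X in _ --> X](mulr0 K); apply: cvgMr.
  rewrite -[X in _ --> X](addr0 (0 : R)) -{1}(addr0 (0 : R)).
  apply: cvgD; [apply: cvgD|]; rewrite -(@normr0 R R); apply: cvg_norm; exact/subr_cvg0.
apply/cvgrPdist_le => e e0.
move/cvgr0Pnorm_le: hlim => /(_ e e0) hlim.
have hr : \forall p \near F, m <= rho p.
  by apply: (cvgr_ge _ cr); rewrite /m; lra.
near=> p.
rewrite distrC; apply: (@le_trans _ _ (K * (`|rho p - rho0| + `|X p - X0| + `|Y p - Y0|))).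
  apply: le_trans (laplace_pair_lip (m := m) _ _ _ _ _ _ _ _ _ _) _ => //.
  - by near: p.
  - by near: p.
  - by near: p.
  - by rewrite /K mulrAC.
apply: le_trans (ler_norm _) _; near: p; exact: hlim.
Unshelve. all: end_near. Qed.

Lemma laplace_pair_scale k i j (c rho X Y : R) : 0 < c ->
  laplace_pair k i j (c * rho) (c * X) (c * Y) = c `^ (- k) * laplace_pair k i j rho X Y.
Proof.
move=> c0; have ic0 : 0 < c^-1 by rewrite invr_gt0.
rewrite /laplace_pair /Rintegral (ge0_integral_scale ic0)//; last 2 first.
- by apply/measurable_EFinP; exact: measurable_laplace_pair_density.
- by move=> x _; rewrite lee_fin laplace_pair_density_ge0.
rewrite (eq_integral_on (g := fun t => ((c `^ (1 - k))%:E * (laplace_pair_density k i j rho X Y t)%:E)%E)).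
  rewrite ge0_integralZl//; last 3 first.
  - by apply/measurable_EFinP; exact: measurable_laplace_pair_density.
  - by move=> x _; rewrite lee_fin laplace_pair_density_ge0.
  - by rewrite lee_fin powR_ge0.
  rewrite muleA -EFinM.
  have -> : c^-1 * c `^ (1 - k) = c `^ (- k).
    rewrite -powR_inv1 ?(ltW c0)// -powRD; last by rewrite (gt_eqF c0) implybT.
    by congr (_ `^ _); ring.
  have h0 : (0 <= \int[mu]_(t in `]0%R, +oo[) (laplace_pair_density k i j rho X Y t)%:E)%E.
    by apply: integral_ge0 => x _; rewrite lee_fin laplace_pair_density_ge0.
  move: (integral _ _ _) h0 => [r| |]//= _.
  by rewrite mulr0 muleC mulyr gtr0_sg ?powR_gt0// mul1e.
move=> t /=; rewrite in_itv/= andbT => t0; rewrite -EFinM; congr EFin.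
rewrite /laplace_pair_density /gamma_kernel.
have e Z : c^-1 * t * (c * Z) = t * Z by rewrite mulrACA mulVf ?mul1r// gt_eqF.
rewrite !e -[c * rho * _]mulrC e [t * rho]mulrC.
rewrite powRM ?(ltW ic0) ?(ltW t0)// -{1}powR_inv1 ?(ltW c0)// -powRrM mulN1r opprB.
ring.
Qed.

End laplace_pair.

(** * Derivatives and singularities of these integrals *)

Local Opaque Gamma_fun beta_laplace powR expR.

Section laplace_pair_calculus.
Variable R : realType.
Notation mu := (@lebesgue_measure R).
Variables b1 b2 : R.
Hypotheses (b10 : 0 < b1) (b11 : b1 < 1) (b20 : 0 < b2) (b21 : b2 < 1).
Notation LPd := (laplace_pair_density b1 b2).
Notation LP := (laplace_pair b1 b2).

Lemma is_derive_beta_laplace_comp (b t : R) i (X : R -> R) (u dX : R) : 0 < b ->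
  is_derive u 1 X dX ->
  is_derive u 1 (fun u => beta_laplace b i (t * X u)) (- (t * dX * beta_laplace b i.+1 (t * X u))).
Proof.
move=> b0 hX.
have h : is_derive u 1 (fun u => t * X u) (t * dX).
  rewrite [X in is_derive _ _ X _](_ : _ = t \*: X); last by apply/funext.
  by apply: is_derive_eq.
have := @is_derive1_comp R (beta_laplace b i) (fun u => t * X u) u _ _
  (is_derive_beta_laplace i _ b0) h.
by rewrite mulNr mulrC.
Qed.

Lemma is_derive_gamma_kernel_comp (k t : R) (rho : R -> R) (u drho : R) : 0 < t ->
  is_derive u 1 rho drho ->
  is_derive u 1 (fun u => gamma_kernel k (rho u) t) (- (drho * gamma_kernel (k + 1) (rho u) t)).
Proof.
move=> t0 hr.
have h : is_derive u 1 (fun u => - (rho u * t)) (- (drho * t)).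
  rewrite [X in is_derive _ _ X _](_ : _ = (- t) \*: rho); last first.
    by apply/funext => v /=; rewrite /GRing.scale/= mulNr mulrC.
  by apply: is_derive_eq; rewrite /GRing.scale/=; ring.
have he := @is_derive1_comp R expR (fun u => - (rho u * t)) u _ _ (is_derive_expR _) h.
rewrite [X in is_derive _ _ X _](_ : _ = t `^ (k - 1) \*: (fun u => expR (- (rho u * t)))); last first.
  by apply/funext => v.
apply: is_derive_eq; rewrite /GRing.scale/= /gamma_kernel.
have -> : t `^ (k + 1 - 1) = t * t `^ (k - 1).
  rewrite -{2}(powRr1 (ltW t0)) -powRD; last by rewrite (gt_eqF t0) implybT.
  by congr (_ `^ _); ring.
rewrite /comp; ring.
Qed.

Lemma is_derive_laplace_pair (k : R) i j (rho X Y drho dX dY : R -> R) (u0 p q m M : R) :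
  0 < k -> 0 < m -> u0 \in `]p, q[ ->
  (forall u, u \in `]p, q[ -> is_derive u 1 rho (drho u)) ->
  (forall u, u \in `]p, q[ -> is_derive u 1 X (dX u)) ->
  (forall u, u \in `]p, q[ -> is_derive u 1 Y (dY u)) ->
  (forall u, u \in `]p, q[ -> [/\ m <= rho u, 0 <= X u & 0 <= Y u]) ->
  (forall u, u \in `]p, q[ -> [/\ `|drho u| <= M, `|dX u| <= M & `|dY u| <= M]) ->
  is_derive u0 1 (fun u => LP k i j (rho u) (X u) (Y u))
    (- (drho u0 * LP (k + 1) i j (rho u0) (X u0) (Y u0)
      + dX u0 * LP (k + 1) i.+1 j (rho u0) (X u0) (Y u0)
      + dY u0 * LP (k + 1) i j.+1 (rho u0) (X u0) (Y u0))).
Proof.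
move=> k0 m0 u0I hr hX hY hpos hbd.
have k10 : 0 < k + 1 by rewrite addr_gt0.
have int k' i' j' u : 0 < k' -> u \in `]p, q[ ->
    mu.-integrable `]0, +oo[ (EFin \o LPd k' i' j' (rho u) (X u) (Y u)).
  move=> k'0 /hpos[mr X0 Y0]; apply: integrable_laplace_pair0 => //.
  exact: lt_le_trans mr.
have [df dfE] : exists df : R -> R -> R, forall u t,
    df u t = - (drho u * LPd (k + 1) i j (rho u) (X u) (Y u) t
      + dX u * LPd (k + 1) i.+1 j (rho u) (X u) (Y u) t
      + dY u * LPd (k + 1) i j.+1 (rho u) (X u) (Y u) t) by eexists; reflexivity.
have -> : - (drho u0 * LP (k + 1) i j (rho u0) (X u0) (Y u0)
      + dX u0 * LP (k + 1) i.+1 j (rho u0) (X u0) (Y u0)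
      + dY u0 * LP (k + 1) i j.+1 (rho u0) (X u0) (Y u0))
    = \int[mu]_(t in `]0, +oo[) df u0 t.
  have iz c k' i' j' : 0 < k' ->
      mu.-integrable `]0, +oo[ (EFin \o (fun t => c * LPd k' i' j' (rho u0) (X u0) (Y u0) t)).
    by move=> k'0; apply: integrableZ_fin => //; exact: int.
  have iD : mu.-integrable `]0, +oo[ (EFin \o (fun t =>
      drho u0 * LPd (k + 1) i j (rho u0) (X u0) (Y u0) t
      + dX u0 * LPd (k + 1) i.+1 j (rho u0) (X u0) (Y u0) t)).
    by apply: integrableD_fin => //; exact: iz.
  transitivity (\int[mu]_(t in `]0, +oo[) (-1 * (drho u0 * LPd (k + 1) i j (rho u0) (X u0) (Y u0) t
      + dX u0 * LPd (k + 1) i.+1 j (rho u0) (X u0) (Y u0) t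
      + dY u0 * LPd (k + 1) i j.+1 (rho u0) (X u0) (Y u0) t))); last first.
    by apply: eq_Rintegral_on => t _; rewrite dfE mulN1r.
  rewrite RintegralZl//; last by apply: integrableD_fin => //; exact: iz.
  rewrite mulN1r; congr (- _).
  rewrite RintegralD//; last exact: iz.
  rewrite RintegralD//; [|exact: iz|exact: iz].
  by rewrite !RintegralZl//; exact: int.
pose B := beta_laplace b1 0 0 * beta_laplace b2 0 0.
have [B0 hB] : 0 <= B /\ forall i' j' (r x y t : R), 0 < t -> 0 <= x -> 0 <= y -> m <= r ->
    LPd (k + 1) i' j' r x y t <= B * gamma_kernel (k + 1) m t.
  split; first exact: laplace_pair_const_ge0.
  move=> i' j' r x y t t0 x0 y0 mr; apply: (le_trans (laplace_pair_density_le b10 b20 _ _ _ _ _ _ t0)).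
  rewrite ler_wpM2l ?laplace_pair_const_ge0// !min_l// !addr0.
  by rewrite /gamma_kernel ler_wpM2l ?powR_ge0// ler_expR lerN2 ler_pM2r.
move: B B0 hB => B B0 hB.
rewrite /laplace_pair.
apply: (is_derive_Rintegral (G := fun t => (M * 3 * B) * gamma_kernel (k + 1) m t) _ u0I).
- exact: measurable_itv.
- by move=> u uI; exact: int.
- move=> u t uI; rewrite /= in_itv/= andbT => t0; rewrite /laplace_pair_density.
  have h1 := is_derive_gamma_kernel_comp k t0 (hr _ uI).
  have h2 := is_derive_beta_laplace_comp t i b10 (hX _ uI).
  have h3 := is_derive_beta_laplace_comp t j b20 (hY _ uI).
  have h23 := is_deriveM h2 h3.
  have h := is_deriveM h1 h23.
  apply: (is_derive_eq h); rewrite !fctE /GRing.scale/= dfE /laplace_pair_density /gamma_kernel.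
  have -> : t `^ (k + 1 - 1) = t * t `^ (k - 1).
    rewrite -{2}(powRr1 (ltW t0)) -powRD; last by rewrite (gt_eqF t0) implybT.
    by congr (_ `^ _); ring.
  move: (expR _) (t `^ _) => e1 e2; do 4 move: (beta_laplace _ _ _) => ?.
  ring.
- move=> u t uI; rewrite /= in_itv/= andbT => t0; rewrite dfE normrN.
  have [mr X0 Y0] := hpos _ uI; have [d1 d2 d3] := hbd _ uI.
  have M0 : 0 <= M by apply: le_trans d1.
  have bd i' j' : LPd (k + 1) i' j' (rho u) (X u) (Y u) t <= B * gamma_kernel (k + 1) m t.
    exact: hB.
  have bd' c i' j' : `|c| <= M ->
      `|c * LPd (k + 1) i' j' (rho u) (X u) (Y u) t| <= M * (B * gamma_kernel (k + 1) m t).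
    by move=> cM; rewrite normrM ler_pM// ger0_norm ?laplace_pair_density_ge0.
  apply: (le_trans (ler_normD _ _)).
  have -> : M * 3 * B * gamma_kernel (k + 1) m t = M * (B * gamma_kernel (k + 1) m t)
     + M * (B * gamma_kernel (k + 1) m t) + M * (B * gamma_kernel (k + 1) m t) by ring.
  apply: lerD; last exact: bd'.
  by apply: (le_trans (ler_normD _ _)); apply: lerD; exact: bd'.
- by apply: integrableZ_fin => //; exact: integrable_gamma_kernel.
Qed.

Lemma Gamma_fun1 : Gamma_fun (1 : R) = 1.
Proof.
have h := @integral_exponential_pdf R 1 ltr01.
apply: EFin_inj; rewrite -integral_gamma_kernel1// -h.
rewrite (_ : (fun x => (exponential_pdf 1 x)%:E) =
  (fun x : R => (gamma_kernel 1 1 x)%:E) \_ `[0, +oo[); last first.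
  apply/funext => x; rewrite /exponential_pdf !patchE; case: ifP => // _.
  by rewrite /gamma_kernel subrr powRr0 mulN1r !mul1r.
rewrite -integral_mkcond integral_itv_obnd_cbnd//.
by apply/measurable_EFinP; exact: measurable_gamma_kernel.
Qed.

(** The two last factors are bounded and tend to Gamma values, while the powers of
    t which they absorb leave a plain Gamma kernel. *)
Lemma laplace_pair_density_scaled (k X Y t rho : R) i j : 0 < X -> 0 < Y -> 0 < t ->
  LPd (b1 + b2 + i%:R + j%:R + k) i j rho X Y t =
  X `^ (- (b1 + i%:R)) * Y `^ (- (b2 + j%:R)) * gamma_kernel k rho t *
  (((t * X) `^ (b1 + i%:R) * beta_laplace b1 i (t * X))
   * ((t * Y) `^ (b2 + j%:R) * beta_laplace b2 j (t * Y))).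
Proof.
move=> X0 Y0 t0; rewrite /laplace_pair_density /gamma_kernel.
have -> : b1 + b2 + i%:R + j%:R + k - 1 = (b1 + i%:R) + (b2 + j%:R) + (k - 1) by ring.
have h : t != 0 by rewrite gt_eqF.
have hD r s : t `^ (r + s) = t `^ r * t `^ s by rewrite powRD// h implybT.
rewrite (hD (b1 + i%:R + (b2 + j%:R)) (k - 1)) (hD (b1 + i%:R) (b2 + j%:R)).
rewrite !powRM ?(ltW t0) ?(ltW X0) ?(ltW Y0)// !powRN.
have := powR_gt0 (b1 + i%:R) X0; have := powR_gt0 (b2 + j%:R) Y0.
move: (X `^ _) (Y `^ _) => x1 y1 y10 x10.
by field; rewrite (gt_eqF x10) (gt_eqF y10).
Qed.

(** This turns a relative error t^(- 1/2) into a change of exponent. *)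
Lemma gamma_kernel_half (rho t : R) : gamma_kernel 2^-1 rho t = gamma_kernel 1 rho t * t `^ (- 2^-1).
Proof.
rewrite /gamma_kernel mulrAC; congr (_ * _).
by rewrite subrr powRr0 mul1r; congr (_ `^ _); lra.
Qed.

(** Replacing both normalised transforms by their limits leaves the Gamma kernel of
    exponent 1, of integral 1 / rho.  The error is O(t^(- 1/2)) relative to that
    kernel, hence gains a factor rho^(1/2). *)
Lemma laplace_pair_leading : exists2 C, 0 < C & forall rho X Y, 0 < rho -> 0 < X -> 0 < Y ->
  `|rho * LP (b1 + b2 + 1) 0 0 rho X Y - Gamma_fun b1 * Gamma_fun b2 * (X `^ (- b1) * Y `^ (- b2))|
  <= C * (X `^ (- b1) * Y `^ (- b2)) * (X `^ (- 2^-1) + Y `^ (- 2^-1)) * rho `^ 2^-1.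
Proof.
have [A1 A10 h1] := beta_laplace_asymp b10 b11.
have [A2 A20 h2] := beta_laplace_asymp b20 b21.
have [K2 K20 hK2] := powR_beta_laplace_le 0 b20 b21.
have G1 := Gamma_fun_gt0 b10; have G2 := Gamma_fun_gt0 b20.
have G12 : 0 < Gamma_fun (2^-1 : R) by apply: Gamma_fun_gt0; rewrite invr_gt0.
have C0 : 0 < A1 * K2 + Gamma_fun b1 * A2.
  exact: (addr_gt0 (mulr_gt0 A10 K20) (mulr_gt0 G1 A20)).
have [C [{}C0 CE]] : exists C, 0 < C /\ C = A1 * K2 + Gamma_fun b1 * A2 by exists (A1 * K2 + Gamma_fun b1 * A2).
exists (C * Gamma_fun 2^-1); first exact: mulr_gt0.
move=> rho X Y r0 X0 Y0.
set P := X `^ (- b1) * Y `^ (- b2); have P0 : 0 <= P by rewrite mulr_ge0 ?powR_ge0.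
set S := X `^ (- 2^-1) + Y `^ (- 2^-1).
have i1 := integrable_gamma_kernel ltr01 r0.
have i12 : mu.-integrable `]0, +oo[ (EFin \o gamma_kernel (2^-1 : R) rho).
  by apply: integrable_gamma_kernel => //; rewrite invr_gt0.
have k0 : 0 < b1 + b2 + 1 by rewrite !addr_gt0.
have iLP : mu.-integrable `]0, +oo[ (EFin \o LPd (b1 + b2 + 1) 0 0 rho X Y).
  by apply: integrable_laplace_pair0 => //; exact: ltW.
have e1 : \int[mu]_(t in `]0, +oo[) gamma_kernel 1 rho t = rho^-1.
  by rewrite /Rintegral integral_gamma_kernel// Gamma_fun1 mul1r powR_inv1// ltW.
have e2 : \int[mu]_(t in `]0, +oo[) gamma_kernel 2^-1 rho t = Gamma_fun 2^-1 * rho `^ (- 2^-1).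
  by rewrite /Rintegral integral_gamma_kernel// invr_gt0.
have -> : rho * LP (b1 + b2 + 1) 0 0 rho X Y - Gamma_fun b1 * Gamma_fun b2 * P
  = rho * \int[mu]_(t in `]0, +oo[) (LPd (b1 + b2 + 1) 0 0 rho X Y t
      - Gamma_fun b1 * Gamma_fun b2 * P * gamma_kernel 1 rho t).
  rewrite RintegralB//; last exact: integrableZ_fin.
  rewrite RintegralZl// e1 mulrBr; congr (_ - _).
  by rewrite [RHS]mulrC divfK// gt_eqF.
have -> : C * Gamma_fun 2^-1 * P * S * rho `^ 2^-1 =
   rho * \int[mu]_(t in `]0, +oo[) (C * P * S * gamma_kernel 2^-1 rho t).
  rewrite RintegralZl// e2.
  have -> : rho * (C * P * S * (Gamma_fun 2^-1 * rho `^ (- 2^-1))) =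
    C * Gamma_fun 2^-1 * P * S * (rho * rho `^ (- 2^-1)) by ring.
  congr (_ * _); rewrite -{2}(powRr1 (ltW r0)) -powRD ?(gt_eqF r0) ?implybT//.
  by congr (_ `^ _); field.
rewrite normrM (gtr0_norm r0) ler_pM2l//.
apply: le_RintegralW => //.
- apply: measurable_funB; first exact: measurable_laplace_pair_density.
  by apply: measurable_funM => //; exact: measurable_gamma_kernel.
- exact: integrableZ_fin.
move=> t /=; rewrite in_itv/= andbT => t0.
have -> : b1 + b2 + 1 = b1 + b2 + 0%:R + 0%:R + 1 by ring.
rewrite laplace_pair_density_scaled// !addr0 -/P.
have tX : 0 < t * X by rewrite mulr_gt0.
have tY : 0 < t * Y by rewrite mulr_gt0.
have := h1 _ tX; have := h2 _ tY; have := hK2 _ tY; rewrite addr0.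
have : 0 <= (t * Y) `^ b2 * beta_laplace b2 0 (t * Y) by rewrite mulr_ge0 ?powR_ge0 ?beta_laplace_ge0.
move: (_ `^ b1 * _) (_ `^ b2 * _) => m1 m2 m20 m2K hm2 hm1.
have -> : P * gamma_kernel 1 rho t * (m1 * m2) - Gamma_fun b1 * Gamma_fun b2 * P * gamma_kernel 1 rho t
  = P * gamma_kernel 1 rho t * ((m1 - Gamma_fun b1) * m2 + Gamma_fun b1 * (m2 - Gamma_fun b2)) by ring.
have g12 := gamma_kernel_half rho t.
have Pg0 : 0 <= P * gamma_kernel 1 rho t by apply: mulr_ge0 => //; exact: gamma_kernel_ge0.
rewrite normrM (ger0_norm Pg0).
rewrite g12 (_ : C * P * S * _ = P * gamma_kernel 1 rho t * (C * S * t `^ (- 2^-1))); last by ring.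
apply: ler_wpM2l => //.
apply: (@le_trans _ _ (A1 * (t * X) `^ (- 2^-1) * K2 + Gamma_fun b1 * (A2 * (t * Y) `^ (- 2^-1)))).
  apply: (le_trans (ler_normD _ _)); rewrite !normrM (ger0_norm m20) (gtr0_norm G1).
  apply: lerD; last exact: (ler_wpM2l (ltW G1) hm2).
  by apply: ler_pM.
rewrite !powRM ?(ltW t0) ?(ltW X0) ?(ltW Y0)// CE /S.
have := powR_ge0 t (- 2^-1); have := powR_ge0 X (- 2^-1); have := powR_ge0 Y (- 2^-1).
move: (t `^ _) (X `^ _) (Y `^ _) => T x y y0 x0 T0.
have -> : A1 * (T * x) * K2 + Gamma_fun b1 * (A2 * (T * y)) = T * (A1 * K2 * x + Gamma_fun b1 * A2 * y) by ring.
rewrite mulrC; apply: ler_wpM2r => //.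
rewrite mulrDr !mulrDl; have a1 : 0 <= A1 * K2 by exact: ltW (mulr_gt0 A10 K20).
have a2 : 0 <= Gamma_fun b1 * A2 by exact: ltW (mulr_gt0 G1 A20).
by apply: lerD; [rewrite lerDl mulr_ge0|rewrite lerDr mulr_ge0].
Qed.

(** At this exponent the density decays like e^(- rho t) / t for large t, which
    would give log rho; bounding 1 / t by t^(- 3/4) gives a power that is still
    integrable along the arc. *)
Lemma laplace_pair_weak i j : 4^-1 <= b1 -> exists2 C, 0 < C & forall rho X Y, 0 < rho -> 0 < X -> 0 < Y ->
  LP (b1 + b2 + i%:R + j%:R) i j rho X Y
  <= C * (1 + X `^ (- (b1 + i%:R)) * Y `^ (- (b2 + j%:R))) * rho `^ (- 4^-1).
Proof.
move=> b14; have [K1 K10 hK1] := powR_beta_laplace_le i b10 b11.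
have [K2 K20 hK2] := powR_beta_laplace_le j b20 b21.
have [B [B0 BE]] : exists B, 0 <= B /\ B = beta_laplace b1 0 0 * beta_laplace b2 0 0.
  by eexists; split; last reflexivity; rewrite mulr_ge0 ?beta_laplace_ge0.
have q0 : 0 < 4^-1 :> R by rewrite invr_gt0.
have G := Gamma_fun_gt0 q0.
exists ((B + K1 * K2) * Gamma_fun 4^-1).
  by rewrite mulr_gt0// ltr_wpDl// mulr_gt0.
move=> rho X Y r0 X0 Y0.
have [P [P0 PE]] : exists P, 0 <= P /\ P = X `^ (- (b1 + i%:R)) * Y `^ (- (b2 + j%:R)).
  by eexists; split; last reflexivity; rewrite mulr_ge0 ?powR_ge0.
rewrite -PE.
set k := b1 + b2 + i%:R + j%:R.
have i0 : 0 <= i%:R :> R by []. have j0 : 0 <= j%:R :> R by [].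
have k4 : 4^-1 <= k by rewrite /k -!addrA ler_wpDr// !addr_ge0// ltW.
have k0 : 0 < k by exact: lt_le_trans k4.
have e2 : \int[mu]_(t in `]0, +oo[) gamma_kernel 4^-1 rho t = Gamma_fun 4^-1 * rho `^ (- 4^-1).
  by rewrite /Rintegral integral_gamma_kernel.
have ig := integrable_gamma_kernel q0 r0.
have -> : (B + K1 * K2) * Gamma_fun 4^-1 * (1 + P) * rho `^ (- 4^-1) =
  \int[mu]_(t in `]0, +oo[) ((B + K1 * K2) * (1 + P) * gamma_kernel 4^-1 rho t).
  by rewrite RintegralZl// e2; ring.
apply: le_Rintegral => //.
- by apply: integrable_laplace_pair0 => //; exact: ltW.
- exact: integrableZ_fin.
move=> t /=; rewrite in_itv/= andbT => t0.
have K120 : 0 <= K1 * K2 by rewrite mulr_ge0 ?ltW.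
have [t1|t1] := leP t 1.
  apply: (le_trans (laplace_pair_density_le b10 b20 _ _ _ _ _ _ t0)).
  rewrite !min_l ?(ltW X0) ?(ltW Y0)// !addr0 -BE.
  apply: (@le_trans _ _ (B * gamma_kernel 4^-1 rho t)).
    rewrite ler_wpM2l// /gamma_kernel ler_wpM2r ?expR_ge0//; apply: ger_powR; last by lra.
    by rewrite t0.
  rewrite ler_wpM2r ?gamma_kernel_ge0// mulrDr mulr1 -addrA lerDl addr_ge0// mulr_ge0//.
  by rewrite addr_ge0.
have -> : k = k + 0 by rewrite addr0.
rewrite laplace_pair_density_scaled// -PE.
have tX : 0 < t * X by rewrite mulr_gt0.
have tY : 0 < t * Y by rewrite mulr_gt0.
apply: (@le_trans _ _ (P * gamma_kernel 4^-1 rho t * (K1 * K2))).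
  apply: ler_pM.
  - by apply: mulr_ge0 => //; exact: gamma_kernel_ge0.
  - by apply: mulr_ge0; apply: mulr_ge0; rewrite ?powR_ge0 ?beta_laplace_ge0.
  - rewrite ler_wpM2l// /gamma_kernel ler_wpM2r ?expR_ge0//.
    by apply: ler_powR; [exact: ltW|lra].
  - by apply: ler_pM; [apply: mulr_ge0; rewrite ?powR_ge0 ?beta_laplace_ge0..|exact: hK1|exact: hK2].
rewrite [leRHS]mulrAC; have g0 := gamma_kernel_ge0 (4^-1) rho t.
rewrite (_ : P * _ * _ = K1 * K2 * gamma_kernel 4^-1 rho t * P); last by ring.
apply: ler_pM => //; first by rewrite mulr_ge0.
  by rewrite ler_wpM2r// lerDr.
by rewrite lerDr.
Qed.

End laplace_pair_calculus.

(** * Uniqueness of a real-analytic continuation *)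

Section double_series.
Variable R : realType.
Implicit Types (u a : nat -> nat -> R).

Definition square_sum u (N : nat) : R := \sum_(m < N) \sum_(n < N) u m n.

Lemma square_sum_fsbig u N :
  (square_sum u N)%:E = (\sum_(k \in `I_N `*` `I_N) (u k.1 k.2)%:E)%E.
Proof.
rewrite -(pair_fsbig _ (fun m n => (u m n)%:E) (finite_II N) (finite_II N)).
rewrite -(fsbig_ord _ N (fun m => (\sum_(n \in `I_N) (u m n)%:E)%E)) /square_sum -sumEFin.
by apply: eq_bigr => i _; rewrite -sumEFin (fsbig_ord _ N (fun n => (u i n)%:E)).
Qed.

Lemma summable_square u (M : R) :
  (forall N, square_sum (fun m n => `|u m n|) N <= M) ->
  summable [set: nat * nat] (fun k => (u k.1 k.2)%:E).
Proof.
move=> hM; rewrite /summable; apply: (@le_lt_trans _ _ M%:E); last exact: ltry.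
rewrite /esum; apply: ge_ereal_sup => _ [A [finA _] <-].
pose N := (\max_(k <- finmap.enum_fset (fset_set A)) maxn k.1 k.2).+1.
apply: (@le_trans _ _ (square_sum (fun m n => `|u m n|) N)%:E); last by rewrite lee_fin.
rewrite square_sum_fsbig; apply: lee_fsum_nneg_subset => //.
- exact: finite_setX.
- move=> k /[!inE] Ak.
  have h : (maxn k.1 k.2 <= \max_(k <- finmap.enum_fset (fset_set A)) maxn k.1 k.2)%N.
    apply: (@leq_bigmax_seq _ (finmap.enum_fset (fset_set A)) xpredT (fun k => maxn k.1 k.2)) => //.
    by rewrite in_fset_set// inE.
  by split; rewrite /= /N ltnS (leq_trans _ h)// ?leq_maxl ?leq_maxr.
Qed.

Lemma square_summable u : summable [set: nat * nat] (fun k => (u k.1 k.2)%:E) ->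
  exists M : R, forall N, square_sum (fun m n => `|u m n|) N <= M.
Proof.
move=> su; exists (fine (\esum_(k in [set: nat * nat]) `|(u k.1 k.2)%:E|)%E) => N.
rewrite -lee_fin fineK; last by rewrite -summableE.
rewrite square_sum_fsbig; apply: ereal_sup_ubound.
by exists (`I_N `*` `I_N) => //; split => //; exact: finite_setX.
Qed.

(** Monomials of total degree j already lie in the square of side j + 1. *)
Lemma square_sum_diag a (j N : nat) : (j < N)%N ->
  square_sum (fun m n => if (m + n == j)%N then a m n else 0) N
  = square_sum (fun m n => if (m + n == j)%N then a m n else 0) j.+1.
Proof.
elim: N => // N IH; rewrite ltnS leq_eqVlt => /predU1P[->//|jN].
rewrite -IH// /square_sum big_ord_recr/= [X in _ + X]big1 ?addr0; last first.
  move=> n _; rewrite ifF//; apply/negbTE; rewrite neq_ltn; apply/orP; right.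
  by rewrite (leq_trans jN)// leq_addr.
apply: eq_bigr => m _; rewrite big_ord_recr/= ifF ?addr0//.
by apply/negbTE; rewrite neq_ltn; apply/orP; right; rewrite (leq_trans jN)// leq_addl.
Qed.

(** Let E k be the sum of the coefficients of total degree k.  If E j = 0 for j < k,
    then g x = E k x^k + O(x^(k + 1)), and the zeros of g to the left of 0 force
    E k = 0.  So g x = O(x^k) for every k. *)
Lemma double_series_vanish a (M : R) (g : R -> R) :
  (forall N, square_sum (fun m n => `|a m n|) N <= M) ->
  (forall x, `|x| <= 1 -> square_sum (fun m n => a m n * x ^+ (m + n)) N @[N --> \oo] --> g x) ->
  (exists2 d, 0 < d & forall x, - d < x -> x < 0 -> g x = 0) ->
  forall x, `|x| < 1 -> g x = 0.
Proof.
move=> hM hg [d d0 gd].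
have M0 : 0 <= M by apply: le_trans (hM 0%N); rewrite /square_sum big_ord0.
pose E j := square_sum (fun m n => if (m + n == j)%N then a m n else 0) j.+1.
(* the partial sum up to total degree k *)
pose L k N x := square_sum (fun m n => if (m + n < k)%N then a m n * x ^+ (m + n) else 0) N.
have LS k N x : (k < N)%N -> L k.+1 N x = L k N x + E k * x ^+ k.
  move=> kN; rewrite /E -(square_sum_diag a kN) /L /square_sum mulr_suml -big_split/=.
  apply: eq_bigr => m _; rewrite mulr_suml -big_split/=; apply: eq_bigr => n _.
  rewrite ltnS; have [h|h|h] := ltngtP (m + n)%N k.
  - by rewrite mul0r addr0.
  - by rewrite mul0r addr0.
  - by rewrite h add0r.
have tail k x : `|x| <= 1 -> (forall j, (j < k)%N -> E j = 0) ->
    `|g x - E k * x ^+ k| <= M * `|x| ^+ k.+1.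
  move=> x1 Ek.
  have L0 k' N : (k' <= k)%N -> (k' <= N)%N -> L k' N x = 0.
    elim: k' => [|k' IH] k'k k'N.
      by rewrite /L /square_sum big1// => m _; rewrite big1.
    by rewrite LS// IH ?Ek ?mul0r ?addr0//; exact: ltnW.
  have lim : `|square_sum (fun m n => a m n * x ^+ (m + n)) N - E k * x ^+ k| @[N --> \oo]
     --> `|g x - E k * x ^+ k|.
    by apply: cvg_norm; apply: cvgB; [exact: hg|exact: cvg_cst].
  apply: (cvgr_to_le lim); exists k.+1 => // N /= kN.
  have -> : E k * x ^+ k = L k.+1 N x by rewrite LS// L0 ?add0r//; exact: ltnW.
  apply: (@le_trans _ _ (square_sum (fun m n => `|a m n|) N * `|x| ^+ k.+1)); last first.
    by rewrite ler_wpM2r ?exprn_ge0.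
  rewrite /L /square_sum -sumrB mulr_suml; apply: (le_trans (ler_norm_sum _ _ _)).
  apply: ler_sum => m _; rewrite -sumrB mulr_suml; apply: (le_trans (ler_norm_sum _ _ _)).
  apply: ler_sum => n _; case: ltnP => mn.
    by rewrite subrr normr0 mulr_ge0 ?exprn_ge0.
  by rewrite subr0 normrM normrX ler_wpM2l// ler_wiXn2l.
have E0 k : E k = 0.
  elim/ltn_ind: k => k IH; apply/eqP; rewrite -normr_le0; apply/ler_addgt0Pr => e e0.
  rewrite add0r; pose x := - Num.min (Num.min (d / 2) 1) (e / (M + 1)).
  have M10 : 0 < M + 1 by rewrite ltr_wpDl.
  have nx0 : 0 < - x by rewrite opprK !lt_min ltr01 !divr_gt0.
  have x0 : x < 0 by rewrite -oppr_gt0.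
  have xd : - x <= d / 2 by rewrite opprK !ge_min lexx.
  have x1 : - x <= 1 by rewrite opprK !ge_min lexx orbT.
  have xe : - x <= e / (M + 1) by rewrite opprK !ge_min lexx !orbT.
  have nx : `|x| = - x by rewrite ltr0_norm.
  have := tail k x; rewrite nx => /(_ x1 IH).
  rewrite gd//; last by lra.
  rewrite sub0r normrN normrM normrX nx exprS mulrA.
  rewrite ler_pM2r ?exprn_gt0// => h; apply: (le_trans h).
  rewrite -(ler_pM2l M10) in xe; apply: (@le_trans _ _ ((M + 1) * - x)).
    by rewrite ler_pM2r// lerDl.
  by apply: (le_trans xe); rewrite mulrC divfK// gt_eqF.
move=> x x1; apply/eqP; rewrite -normr_le0.
have lim : M * `|x| ^+ k @[k --> \oo] --> (0 : R).
  by rewrite -[X in _ --> X](mulr0 M); apply: cvgMr; apply: cvg_expr; rewrite normr_id.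
apply: (cvgr_to_ge lim); exists 1%N => // k /= k0.
case: k k0 => // k _; have := tail k x (ltW x1) (fun j _ => E0 j).
by rewrite E0 mul0r subr0.
Qed.

End double_series.

Section real_analytic_unique.
Variable R : realType.

Lemma cvg_pairR (T : Type) (F : set_system T) (FF : Filter F) (f g : T -> R) (a b : R) :
  f @ F --> a -> g @ F --> b -> (f x, g x) @[x --> F] --> ((a, b) : R * R).
Proof.
move=> fa gb; apply/cvg_ballP => e e0; near=> x; split => /=; near: x.
  by move/cvg_ballP: fa; exact.
by move/cvg_ballP: gb; exact.
Unshelve. all: end_near. Qed.

Lemma double_series_along (c : nat -> nat -> R) (d x v1 v2 : R) N :
  square_sum (fun m n => c m n * (d * x * v1) ^+ m * (d * x * v2) ^+ n) N
  = square_sum (fun m n => c m n * (d * v1) ^+ m * (d * v2) ^+ n * x ^+ (m + n)) N.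
Proof.
apply: eq_bigr => m _; apply: eq_bigr => n _.
by rewrite -![d * x * _]mulrAC !exprMn exprD; ring.
Qed.

(** The difference of the two expansions at P, restricted to a line through P, is
    a double series in powers of one variable. *)
Lemma real_analytic2_local (U : set (R * R)) (f1 f2 : R * R -> R) (P v : R * R) :
  real_analytic2 U f1 -> real_analytic2 U f2 -> U P ->
  (exists2 d, 0 < d & forall x, - d < x -> x < 0 ->
     f1 (P.1 + x * v.1, P.2 + x * v.2) = f2 (P.1 + x * v.1, P.2 + x * v.2)) ->
  exists2 d, 0 < d & forall x, `|x| < d ->
     f1 (P.1 + x * v.1, P.2 + x * v.2) = f2 (P.1 + x * v.1, P.2 + x * v.2).
Proof.
move=> /(_ P) h1 /(_ P) h2 UP [d d0 hd].
have [c1 {}h1] := h1 UP; have [c2 {}h2] := h2 UP.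
have line : (P.1 + x * v.1, P.2 + x * v.2) @[x --> (0 : R)] --> (P : R * R).
  rewrite [X in _ --> X](_ : _ = (P.1 + 0 * v.1, P.2 + 0 * v.2)); last first.
    by rewrite !mul0r !addr0; case: (P).
  by apply: cvg_pairR => /=; apply: cvgD; try exact: cvg_cst; apply: cvgMl; exact: cvg_id.
have /nbhs_ballP[r /= r0 hr] : \forall x \near (0 : R),
    let q := (P.1 + x * v.1, P.2 + x * v.2) in
    double_series_sum (fun m n => c1 m n * (q.1 - P.1) ^+ m * (q.2 - P.2) ^+ n) (f1 q) /\
    double_series_sum (fun m n => c2 m n * (q.1 - P.1) ^+ m * (q.2 - P.2) ^+ n) (f2 q).
  exact: (line _ (filterI h1 h2)).
pose e := r / 2; have e0 : 0 < e by rewrite divr_gt0.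
have er : e < r by rewrite /e; lra.
have ex x : `|x| <= 1 -> ball (0 : R) r (e * x).
  move=> x1; rewrite /ball/= sub0r normrN normrM (gtr0_norm e0).
  by apply: le_lt_trans er; rewrite ler_piMr// ltW.
pose a m n := (c1 m n - c2 m n) * (e * v.1) ^+ m * (e * v.2) ^+ n.
have dss x : `|x| <= 1 ->
  double_series_sum (fun m n => c1 m n * (e * x * v.1) ^+ m * (e * x * v.2) ^+ n)
     (f1 (P.1 + e * x * v.1, P.2 + e * x * v.2)) /\
  double_series_sum (fun m n => c2 m n * (e * x * v.1) ^+ m * (e * x * v.2) ^+ n)
     (f2 (P.1 + e * x * v.1, P.2 + e * x * v.2)).
  move=> /ex /hr /= []; rewrite /= ![P.1 + _ - _]addrAC ![P.2 + _ - _]addrAC !subrr !add0r.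
  by split.
have n1 : `|1 : R| <= 1 by rewrite normr1.
have [[s1 _] [s2 _]] := dss 1 n1.
have [M1 hM1] := @square_summable R
  (fun m n => c1 m n * (e * 1 * v.1) ^+ m * (e * 1 * v.2) ^+ n) s1.
have [M2 hM2] := @square_summable R
  (fun m n => c2 m n * (e * 1 * v.1) ^+ m * (e * 1 * v.2) ^+ n) s2.
have along c x N := double_series_along c e x v.1 v.2 N.
have vanish : forall x, `|x| < 1 ->
    f1 (P.1 + e * x * v.1, P.2 + e * x * v.2) - f2 (P.1 + e * x * v.1, P.2 + e * x * v.2) = 0.
  apply: (@double_series_vanish R a (M1 + M2)).
  - move=> N; apply: le_trans (lerD (hM1 N) (hM2 N)).
    rewrite /square_sum -big_split/=; apply: ler_sum => m _.
    rewrite -big_split/=; apply: ler_sum => n _.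
    by rewrite mulr1 /a mulrBl mulrBl; exact: ler_normB.
  - move=> x x1; have [[_ l1] [_ l2]] := dss x x1.
    rewrite -/(square_sum _ _) in l1 l2.
    rewrite (_ : (fun N => _) = (fun N =>
       square_sum (fun m n => c1 m n * (e * x * v.1) ^+ m * (e * x * v.2) ^+ n) N
     - square_sum (fun m n => c2 m n * (e * x * v.1) ^+ m * (e * x * v.2) ^+ n) N)).
      exact: cvgB.
    apply/funext => N; rewrite !along /square_sum -sumrB; apply: eq_bigr => m _.
    by rewrite -sumrB; apply: eq_bigr => n _; rewrite /a; ring.
  - exists (d / e); first by rewrite divr_gt0.
    move=> x x1 x2; apply/eqP; rewrite subr_eq0; apply/eqP; apply: hd.
      by rewrite mulrC -ltr_pdivrMr// mulNr.
    by rewrite pmulr_rlt0.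
exists e => // x xe; apply/eqP; rewrite -subr_eq0; apply/eqP.
have ne : e != 0 by rewrite gt_eqF.
have := vanish (x / e); rewrite [e * (x / e)]mulrC divfK//; apply.
by rewrite normrM normfV (gtr0_norm e0) ltr_pdivrMr// mul1r.
Qed.

(** On the segment from the origin to p, the supremum of the parameters up to which
    the functions agree can be moved to the right by real_analytic2_local. *)
Lemma real_analytic2_unique (U : set (R * R)) (f1 f2 : R * R -> R) (p : R * R) :
  real_analytic2 U f1 -> real_analytic2 U f2 ->
  (forall x, 0 <= x <= 1 -> U (x * p.1, x * p.2)) ->
  (exists2 d, 0 < d & forall x, 0 <= x -> x < d ->
     f1 (x * p.1, x * p.2) = f2 (x * p.1, x * p.2)) ->
  f1 p = f2 p.
Proof.
move=> h1 h2 star [d d0 hd].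
pose good x := forall y, 0 <= y -> y <= x -> f1 (y * p.1, y * p.2) = f2 (y * p.1, y * p.2).
pose S := [set x : R | 0 <= x <= 1 /\ good x].
have S0 : S 0.
  split; first by rewrite lexx ler01.
  by move=> y y0 y1; apply: hd => //; apply: le_lt_trans y1 _.
have hS : has_sup S.
  by split; [exists 0|exists 1 => x [/andP[_ ]]].
pose s := sup S.
have s1 : s <= 1 by apply: ge_sup; [exists 0|move=> x [/andP[_ ]]].
have sd : Num.min (d / 2) 1 <= s.
  apply: ub_le_sup; first by case: hS.
  split; first by rewrite le_min ge_min lexx ler01 orbT !andbT divr_ge0// ltW.
  move=> y y0; rewrite le_min => /andP[yd _]; apply: hd => //.
  by apply: le_lt_trans yd _; rewrite gtr_pMr// invf_lt1// ltr1n.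
have s0 : 0 < s by apply: lt_le_trans sd; rewrite lt_min ltr01 andbT divr_gt0.
have below y : 0 <= y -> y < s -> f1 (y * p.1, y * p.2) = f2 (y * p.1, y * p.2).
  move=> y0 ys; have [x [_ gx] /ltW yx] := sup_gt (ex_intro _ _ S0) ys.
  exact: gx.
have Us : U (s * p.1, s * p.2) by apply: star; rewrite ltW.
have [|e e0 he] := real_analytic2_local (v := p) h1 h2 Us.
  exists s => // x sx x0; rewrite /= -!mulrDl; apply: below; last by lra.
  by lra.
have near y : `|y - s| < e -> f1 (y * p.1, y * p.2) = f2 (y * p.1, y * p.2).
  by move=> /he; rewrite /= -!mulrDl subrKC.
have [s_lt1|] := ltP s 1; last first.
  move=> s_ge1; have -> : p = (1 * p.1, 1 * p.2) by rewrite !mul1r; case: (p).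
  by apply: near; rewrite (_ : s = 1) ?subrr ?normr0//; apply/eqP; rewrite eq_le s1.
pose x := s + Num.min (e / 2) (1 - s).
have x1 : x <= 1 by rewrite /x -lerBrDl ge_min lexx orbT.
have sx : s < x by rewrite /x ltrDl lt_min divr_gt0//= subr_gt0.
have xe : x < s + e.
  rewrite /x ltrD2l; apply: (@le_lt_trans _ _ (e / 2)); first by rewrite ge_min lexx.
  by rewrite gtr_pMr// invf_lt1// ltr1n.
suff : x <= s by rewrite leNgt sx.
apply: ub_le_sup; first by case: hS.
split; first by rewrite x1 andbT ltW// (lt_trans s0).
move=> y y0 yx; have [ys|sy] := ltP y s; first exact: below.
by apply: near; rewrite ger0_norm ?subr_ge0// ltrBlDl (le_lt_trans yx).
Qed.

Lemma double_series_sum_unique (u : nat -> nat -> R) (v1 v2 : R) :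
  double_series_sum u v1 -> double_series_sum u v2 -> v1 = v2.
Proof. by move=> [_ h1] [_ h2]; apply: cvg_unique h1 h2. Qed.

Lemma appellF2_unique (a b1 b2 c1 c2 : R) (F : R * R -> R) (xi eta : R) :
  appellF2_continuation a b1 b2 c1 c2 F -> @appellF2_domain R (xi, eta) ->
  appellF2 a b1 b2 c1 c2 xi eta = F (xi, eta).
Proof.
move=> cF D; rewrite /appellF2.
have : appellF2_continuation a b1 b2 c1 c2 (get (appellF2_continuation a b1 b2 c1 c2)).
  by apply: getPex; exists F.
move: (get _) => G [aG sG]; have [aF sF] := cF.
apply: (real_analytic2_unique aG aF).
  move=> x /andP[x0 x1]; case: D => /= D1 D2 D12; split => /=.
  - have [h|h] := leP xi 0; first by apply: le_lt_trans ltr01; rewrite mulr_ge0_le0.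
    by apply: le_lt_trans D1; rewrite ger_pMl.
  - have [h|h] := leP eta 0; first by apply: le_lt_trans ltr01; rewrite mulr_ge0_le0.
    by apply: le_lt_trans D2; rewrite ger_pMl.
  - rewrite -mulrDr; have [h|h] := leP (xi + eta) 0.
      by apply: le_lt_trans ltr01; rewrite mulr_ge0_le0.
    by apply: le_lt_trans D12; rewrite ger_pMl.
have q0 : 0 < `|xi| + `|eta| + 1 by rewrite ltr_wpDl// addr_ge0.
exists (`|xi| + `|eta| + 1)^-1; first by rewrite invr_gt0.
move=> x x0 xd /=; apply: double_series_sum_unique (sG _ _) (sF _ _);
  rewrite /= !normrM (ger0_norm x0) -mulrDr;
  rewrite -[ltRHS](mulVf (lt0r_neq0 q0));
  apply: (@le_lt_trans _ _ (x * (`|xi| + `|eta| + 1))); rewrite ?ltr_pM2r// ler_wpM2l// lerDl//.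
Qed.

End real_analytic_unique.

(** * Appell's function as a Laplace integral *)

Section appellF2_integral.
Variable R : realType.
Notation mu := (@lebesgue_measure R).

Lemma Rintegral_ord_sum (D : set R) (f : nat -> R -> R) (N : nat) : measurable D ->
  (forall i, mu.-integrable D (EFin \o f i)) ->
  mu.-integrable D (EFin \o (fun x => \sum_(i < N) f i x)) /\
  \int[mu]_(x in D) (\sum_(i < N) f i x) = \sum_(i < N) \int[mu]_(x in D) f i x.
Proof.
move=> mD hf; elim: N => [|N [IH1 IH2]].
  have e : (fun x => \sum_(i < 0) f i x) = cst 0 by apply/funext => x; rewrite big_ord0.
  rewrite big_ord0 e; split; first exact: integrable0.
  by rewrite Rintegral_cst// mul0r.
have e : (fun x => \sum_(i < N.+1) f i x) = (fun x => \sum_(i < N) f i x + f N x).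
  by apply/funext => x; rewrite big_ord_recr.
rewrite e; split; first exact: integrableD_fin.
by rewrite RintegralD// IH2 big_ord_recr.
Qed.

Lemma double_series_sumZ (u : nat -> nat -> R) (K v : R) :
  double_series_sum u v -> double_series_sum (fun m n => K * u m n) (K * v).
Proof.
move=> [/square_summable[M hM] cu]; split.
  apply: (@summable_square R (fun m n => K * u m n) (`|K| * M)) => N.
  apply: le_trans (ler_wpM2l (normr_ge0 K) (hM N)).
  rewrite /square_sum mulr_sumr; apply: ler_sum => m _; rewrite mulr_sumr.
  by apply: ler_sum => n _; rewrite normrM.
rewrite (_ : (fun N => _) = (fun N => K * \sum_(m < N) \sum_(n < N) u m n)).
  exact: cvgMr.
by apply/funext => N; rewrite mulr_sumr; apply: eq_bigr => m _; rewrite mulr_sumr.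
Qed.

Variables b1 b2 a : R.
Hypotheses (b10 : 0 < b1) (b20 : 0 < b2) (a0 : 0 < a).
Notation LPd := (laplace_pair_density b1 b2).
Notation LP := (laplace_pair b1 b2).

Lemma gamma_kernel_shift (k r t : R) n : 0 < t ->
  gamma_kernel (k + n%:R) r t = t ^+ n * gamma_kernel k r t.
Proof.
move=> t0; rewrite /gamma_kernel mulrA; congr (_ * _).
rewrite -powR_mulrn ?(ltW t0)// -powRD ?(gt_eqF t0) ?implybT//.
by congr (_ `^ _); ring.
Qed.

(** Square partial sums are integrals of products of Taylor polynomials of the two
    transforms. *)
Lemma laplace_pair_square_sum (X Y h k : R) N : 0 < 1 + Num.min 0 X + Num.min 0 Y ->
  mu.-integrable `]0, +oo[ (EFin \o (fun t => gamma_kernel a 1 t *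
    (beta_laplace_taylor b1 (t * X) (t * h) N * beta_laplace_taylor b2 (t * Y) (t * k) N))) /\
  square_sum (fun m n => h ^+ m / m`!%:R * (k ^+ n / n`!%:R) * LP (a + m%:R + n%:R) m n 1 X Y) N
  = \int[mu]_(t in `]0, +oo[) (gamma_kernel a 1 t *
    (beta_laplace_taylor b1 (t * X) (t * h) N * beta_laplace_taylor b2 (t * Y) (t * k) N)).
Proof.
move=> s0.
pose f m n t := h ^+ m / m`!%:R * (k ^+ n / n`!%:R) * LPd (a + m%:R + n%:R) m n 1 X Y t.
have int_d m n : mu.-integrable `]0, +oo[ (EFin \o LPd (a + m%:R + n%:R) m n 1 X Y).
  by apply: integrable_laplace_pair => //; rewrite -addrA ltr_wpDr.
have int_f m n : mu.-integrable `]0, +oo[ (EFin \o f m n) by exact: integrableZ_fin.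
have h1 m := @Rintegral_ord_sum `]0, +oo[%classic (f m) N (measurable_itv _) (int_f m).
have [h2 h3] := @Rintegral_ord_sum `]0, +oo[%classic (fun m t => \sum_(n < N) f m n t) N
  (measurable_itv _) (fun m => (h1 m).1).
have e t : 0 < t -> gamma_kernel a 1 t *
    (beta_laplace_taylor b1 (t * X) (t * h) N * beta_laplace_taylor b2 (t * Y) (t * k) N)
    = \sum_(m < N) \sum_(n < N) f m n t.
  move=> t0; rewrite /beta_laplace_taylor mulr_suml mulr_sumr; apply: eq_bigr => m _.
  rewrite !mulr_sumr; apply: eq_bigr => n _; rewrite /f /laplace_pair_density.
  by rewrite !gamma_kernel_shift// !exprMn; ring.
split.
  apply: (eq_integrable _ _ _ _ h2) => //.
  by move=> t; rewrite inE/= in_itv/= andbT => t0; rewrite e.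
rewrite [RHS](eq_Rintegral_on (g := fun t => \sum_(m < N) \sum_(n < N) f m n t)); last first.
  by move=> t; rewrite /= in_itv/= andbT => t0; rewrite e.
rewrite h3; apply: eq_bigr => m _; rewrite (h1 m).2; apply: eq_bigr => n _.
by rewrite RintegralZl.
Qed.

Lemma laplace_pair_taylor_le (X Y h k t : R) N : 0 < t ->
  `|gamma_kernel a 1 t *
    (beta_laplace_taylor b1 (t * X) (t * h) N * beta_laplace_taylor b2 (t * Y) (t * k) N)|
  <= LPd a 0 0 1 (X - `|h|) (Y - `|k|) t.
Proof.
move=> t0; rewrite normrM (ger0_norm (gamma_kernel_ge0 _ _ _)) normrM.
rewrite /laplace_pair_density ler_wpM2l ?gamma_kernel_ge0//.
have e Z z : t * (Z - `|z|) = t * Z - `|t * z| by rewrite normrM (gtr0_norm t0) mulrBr.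
by rewrite !e ler_pM// beta_laplace_taylor_le.
Qed.

(** The Taylor polynomials are dominated by the values of the transforms at X - |h|
    and Y - |k|; this gives absolute convergence and, by dominated convergence, the
    sum. *)
Lemma laplace_pair_double_series (X Y h k : R) :
  0 < 1 + Num.min 0 (X - `|h|) + Num.min 0 (Y - `|k|) ->
  double_series_sum
    (fun m n => h ^+ m / m`!%:R * (k ^+ n / n`!%:R) * LP (a + m%:R + n%:R) m n 1 X Y)
    (LP a 0 0 1 (X - h) (Y - k)).
Proof.
move=> s0.
have mono (Z z : R) : Num.min 0 (Z - `|z|) <= Num.min 0 Z.
  by rewrite le_min !ge_min lexx/= gerBl normr_ge0 orbT.
have s1 : 0 < 1 + Num.min 0 X + Num.min 0 Y.
  apply: lt_le_trans s0 _; apply: lerD => //; apply: lerD => //.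
have ig : mu.-integrable `]0, +oo[ (EFin \o LPd a 0 0 1 (X - `|h|) (Y - `|k|)).
  exact: integrable_laplace_pair.
split.
  apply: (@summable_square R (fun m n => h ^+ m / m`!%:R * (k ^+ n / n`!%:R) *
     LP (a + m%:R + n%:R) m n 1 X Y) (LP a 0 0 1 (X - `|h|) (Y - `|k|))) => N.
  have [i1 e1] := laplace_pair_square_sum `|h| `|k| N s1.
  rewrite (_ : square_sum _ N = square_sum (fun m n => `|h| ^+ m / m`!%:R * (`|k| ^+ n / n`!%:R) *
     LP (a + m%:R + n%:R) m n 1 X Y) N).
    rewrite e1; apply: le_Rintegral => // t /=; rewrite in_itv/= andbT => t0.
    apply: (le_trans (ler_norm _)); apply: (le_trans (laplace_pair_taylor_le _ _ _ _ _ t0)).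
    by rewrite !normr_id.
  apply: eq_bigr => m _; apply: eq_bigr => n _.
  rewrite !normrM !normrX !normfV !(ger0_norm (ler0n _ _)).
  by rewrite (ger0_norm (laplace_pair_ge0 _ _ _ _ _ _ _ _)).
rewrite (_ : (fun N => _) = fun N => \int[mu]_(t in `]0, +oo[) (gamma_kernel a 1 t *
    (beta_laplace_taylor b1 (t * X) (t * h) N * beta_laplace_taylor b2 (t * Y) (t * k) N))); last first.
  by apply/funext => N; have [_ <-] := laplace_pair_square_sum h k N s1.
apply: (Rintegral_dominated_cvg (g := LPd a 0 0 1 (X - `|h|) (Y - `|k|)) _ _ _ _ _).2 => //.
- by move=> N; have [/integrableP[/measurable_EFinP]] := laplace_pair_square_sum h k N s1.
- move=> t _; rewrite /laplace_pair_density; apply: cvgMr.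
  by rewrite !mulrBr; apply: cvgM; exact: beta_laplace_taylor_cvg.
- by move=> N t /=; rewrite in_itv/= andbT => t0; exact: laplace_pair_taylor_le.
Qed.

(** The inverse of the Laplace integral at xi = eta = 0. *)
Definition appellF2_norm : R := Gamma_fun (2 * b1) * Gamma_fun (2 * b2) /
  (Gamma_fun a * (Gamma_fun b1 * Gamma_fun b1) * (Gamma_fun b2 * Gamma_fun b2)).

Definition appellF2_integral (p : R * R) : R :=
  appellF2_norm * LP a 0 0 1 (- p.1) (- p.2).

Lemma real_analytic2_appellF2_integral :
  real_analytic2 (@appellF2_domain R) appellF2_integral.
Proof.
move=> p [p1 p2 p12].
exists (fun m n => appellF2_norm * ((m`!%:R)^-1 * (n`!%:R)^-1 * LP (a + m%:R + n%:R) m n 1 (- p.1) (- p.2))).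
pose s := 1 + Num.min 0 (- p.1) + Num.min 0 (- p.2).
have s0 : 0 < s.
  by rewrite /s; case: (leP 0 (- p.1)); case: (leP 0 (- p.2)) => ? ?; lra.
apply/nbhs_ballP; exists (s / 2); first by rewrite /= divr_gt0.
move=> q [/= q1 q2].
have mono (Z z : R) : `|z| < s / 2 -> Num.min 0 Z - s / 2 < Num.min 0 (Z - `|z|).
  move=> zs; rewrite lt_min ltrBlDr add0r; apply/andP; split.
    by apply: (@le_lt_trans _ _ 0); rewrite ?ge_min ?lexx// divr_gt0.
  have hZ : Num.min 0 Z <= Z by rewrite ge_min lexx orbT.
  by lra.
have h1 : `|q.1 - p.1| < s / 2 by rewrite distrC.
have h2 : `|q.2 - p.2| < s / 2 by rewrite distrC.
have := @laplace_pair_double_series (- p.1) (- p.2) (q.1 - p.1) (q.2 - p.2).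
have -> : - p.1 - (q.1 - p.1) = - q.1 by ring.
have -> : - p.2 - (q.2 - p.2) = - q.2 by ring.
move=> /(_ _)/wrap[].
  by have := mono (- p.1) _ h1; have := mono (- p.2) _ h2; rewrite /s => *; lra.
move=> /(double_series_sumZ appellF2_norm).
congr double_series_sum; apply/funext => m; apply/funext => n; ring.
Qed.

Lemma laplace_pair_moment m n : LP (a + m%:R + n%:R) m n 1 0 0 =
  Gamma_fun (a + (m + n)%:R) * (Gamma_fun (b1 + m%:R) * Gamma_fun b1 / Gamma_fun (2 * b1 + m%:R)
   * (Gamma_fun (b2 + n%:R) * Gamma_fun b2 / Gamma_fun (2 * b2 + n%:R))).
Proof.
rewrite -!beta_laplace_moment// natrD addrA /laplace_pair.
have k0 : 0 < a + m%:R + n%:R by rewrite -addrA ltr_wpDr.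
rewrite (eq_Rintegral_on (g := fun t => gamma_kernel (a + m%:R + n%:R) 1 t *
   (beta_laplace b1 m 0 * beta_laplace b2 n 0))); last first.
  by move=> t _; rewrite /laplace_pair_density !mulr0.
rewrite RintegralZr//; last exact: integrable_gamma_kernel.
by rewrite /Rintegral integral_gamma_kernel1.
Qed.

Lemma appellF2_continuation_integral :
  appellF2_continuation a b1 b2 (2 * b1) (2 * b2) appellF2_integral.
Proof.
split; first exact: real_analytic2_appellF2_integral.
move=> p hp.
have := @laplace_pair_double_series 0 0 p.1 p.2.
rewrite !sub0r => /(_ _)/wrap[].
  by rewrite !min_r ?oppr_le0//; lra.
move=> /(double_series_sumZ appellF2_norm).
congr double_series_sum; apply/funext => m; apply/funext => n.
rewrite laplace_pair_moment /appellF2_term /pochhammer /appellF2_norm.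
have g1 := Gamma_fun_gt0 a0; have g2 := Gamma_fun_gt0 b10; have g3 := Gamma_fun_gt0 b20.
have g4 : 0 < Gamma_fun (2 * b1) by apply: Gamma_fun_gt0; rewrite mulr_gt0.
have g5 : 0 < Gamma_fun (2 * b2) by apply: Gamma_fun_gt0; rewrite mulr_gt0.
have g6 : 0 < Gamma_fun (2 * b1 + m%:R) by apply: Gamma_fun_gt0; rewrite ltr_wpDr// mulr_gt0.
have g7 : 0 < Gamma_fun (2 * b2 + n%:R) by apply: Gamma_fun_gt0; rewrite ltr_wpDr// mulr_gt0.
have f1 : 0 < m`!%:R :> R by rewrite ltr0n fact_gt0.
have f2 : 0 < n`!%:R :> R by rewrite ltr0n fact_gt0.
move: (Gamma_fun (b1 + m%:R)) (Gamma_fun (b2 + n%:R)) (Gamma_fun (a + (m + n)%:R)) => u1 u2 u3.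
move: (Gamma_fun a) (Gamma_fun b1) (Gamma_fun b2) (Gamma_fun (2 * b1)) (Gamma_fun (2 * b2))
  (Gamma_fun (2 * b1 + m%:R)) (Gamma_fun (2 * b2 + n%:R)) (m`!%:R : R) (n`!%:R : R)
  g1 g2 g3 g4 g5 g6 g7 f1 f2 => ? ? ? ? ? ? ? ? ? *.
by field; do ?[apply/andP; split]; apply: lt0r_neq0.
Qed.

Lemma appellF2E (xi eta : R) : @appellF2_domain R (xi, eta) ->
  appellF2 a b1 b2 (2 * b1) (2 * b2) xi eta = appellF2_norm * LP a 0 0 1 (- xi) (- eta).
Proof. exact: (appellF2_unique appellF2_continuation_integral). Qed.

End appellF2_integral.

(** * The fundamental solution and its normal derivative *)

Local Opaque laplace_pair.

Section fundamental_solution.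
Variable R : realType.

(** Along a coordinate line the squared distance is a square plus a constant and
    the two other arguments are affine. *)
Lemma is_derive_laplace_pair_line (b1 b2 k c d e1 f1 e2 f2 u0 : R) i j :
  0 < b1 -> 0 < b2 -> 0 < k ->
  0 < (u0 - c) ^+ 2 + d -> 0 < e1 * u0 + f1 -> 0 < e2 * u0 + f2 ->
  let LP k i j := laplace_pair b1 b2 k i j ((u0 - c) ^+ 2 + d) (e1 * u0 + f1) (e2 * u0 + f2) in
  is_derive u0 1
    (fun u => laplace_pair b1 b2 k i j ((u - c) ^+ 2 + d) (e1 * u + f1) (e2 * u + f2))
    (- (2 * (u0 - c) * LP (k + 1) i j + e1 * LP (k + 1) i.+1 j + e2 * LP (k + 1) i j.+1)).
Proof.
move=> b10 b20 k0 r0 X0 Y0 LP.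
have affine (e f u : R) : is_derive u 1 (fun u => e * u + f) e.
  have h1 : is_derive u 1 (e \*: (id : R -> R)) (e *: 1) by apply: is_deriveZ.
  have h2 := is_deriveD h1 (is_derive_cst f u 1).
  by apply: (is_derive_eq h2); rewrite addr0 /GRing.scale/= mulr1.
have quad (u : R) : is_derive u 1 (fun u => (u - c) ^+ 2 + d) (2 * (u - c)).
  have h1 := affine 1 (- c) u.
  have h2 := is_deriveM h1 h1.
  have h3 := is_deriveD h2 (is_derive_cst d u 1).
  rewrite [X in is_derive _ _ X _](_ : _ =
    (fun u => 1 * u + - c) * (fun u => 1 * u + - c) + cst d); last first.
    by apply/funext => v; rewrite !fctE; ring.
  by apply: (is_derive_eq h3); rewrite /GRing.scale/=; ring.
have cont (f df : R -> R) : (forall u : R, is_derive u 1 f (df u)) -> {for u0, continuous f}.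
  move=> h; apply: differentiable_continuous; apply/derivable1_diffP.
  by have [] := h u0.
have c1 := cont _ _ quad; have c2 := cont _ _ (affine e1 f1); have c3 := cont _ _ (affine e2 f2).
pose m := ((u0 - c) ^+ 2 + d) / 2; have m0 : 0 < m by rewrite divr_gt0.
have : \forall u \near u0, [/\ m <= (u - c) ^+ 2 + d, 0 <= e1 * u + f1 & 0 <= e2 * u + f2].
  near=> u; split; near: u.
  - by apply: (cvgr_ge _ c1); rewrite /m; lra.
  - exact: (cvgr_ge _ c2).
  - exact: (cvgr_ge _ c3).
move=> /nbhs_ballP[r /= r0' hr].
pose r1 := Num.min r 1; have r10 : 0 < r1 by rewrite lt_min r0' ltr01.
pose M := 2 * (`|u0| + 1 + `|c|) + `|e1| + `|e2|.
apply: (@is_derive_laplace_pair R b1 b2 b10 b20 k i j _ _ _ (fun u => 2 * (u - c))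
  (fun=> e1) (fun=> e2) u0 (u0 - r1) (u0 + r1) m M k0 m0).
- by rewrite in_itv/= ltrBlDr !ltrDl r10.
- move=> u; rewrite in_itv/= => /andP[u1 u2]; apply: hr; rewrite /ball/=.
  have hh : r1 <= r by rewrite ge_min lexx.
  by rewrite ltr_norml; apply/andP; split; lra.
- move=> u; rewrite in_itv/= => /andP[u1 u2].
  have hh : r1 <= 1 by rewrite ge_min lexx orbT.
  have u0n := ler_norm u0; have u0n' := ler_norm (- u0); rewrite normrN in u0n'.
  have cn := ler_norm c; have cn' := ler_norm (- c); rewrite normrN in cn'.
  have n1 := normr_ge0 e1; have n2 := normr_ge0 e2.
  have n3 := normr_ge0 u0; have n4 := normr_ge0 c.
  split; rewrite /M; [|lra..].
  rewrite ler_norml; apply/andP; split; lra.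
Unshelve. all: end_near. Qed.

Variables alpha beta : R.
Hypotheses (alpha0 : 0 < alpha) (alpha1 : alpha < 1 / 2) (beta0 : 0 < beta).

Let b10 : 0 < 1 - alpha. Proof. by move: alpha0 alpha1 => ? ?; lra. Qed.

(** This is k2 times appellF2_norm. *)
Definition q2_const : R :=
  2 `^ (2 - 2 * alpha + 2 * beta) / (4 * pi) / (Gamma_fun (1 - alpha) * Gamma_fun beta).

(** The scaling by r^2 replaces the arguments - xi and - eta by 4 x x0 and 4 y y0. *)
Definition heat_pair (k : R) (i j : nat) (x y x0 y0 : R) : R :=
  laplace_pair (1 - alpha) beta (1 - alpha + beta + k) i j
    ((x - x0) ^+ 2 + (y - y0) ^+ 2) (4 * x0 * x) (4 * y0 * y).

Lemma q2E (x y x0 y0 : R) : 0 < x -> 0 < y -> 0 < x0 -> 0 < y0 ->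
  0 < (x - x0) ^+ 2 + (y - y0) ^+ 2 ->
  q2 alpha beta x y x0 y0
  = q2_const * x0 `^ (1 - 2 * alpha) * (x `^ (1 - 2 * alpha) * heat_pair 0 0 0 x y x0 y0).
Proof.
move=> xp yp x0p y0p; rewrite /q2 /heat_pair addr0.
set rr := (x - x0) ^+ 2 + (y - y0) ^+ 2 => r0.
have -> : (rr - ((x + x0) ^+ 2 + (y - y0) ^+ 2)) / rr = - (rr^-1 * (4 * x0 * x)).
  by rewrite /rr mulrC -mulrN; congr (_ * _); ring.
have -> : (rr - ((x - x0) ^+ 2 + (y + y0) ^+ 2)) / rr = - (rr^-1 * (4 * y0 * y)).
  by rewrite /rr mulrC -mulrN; congr (_ * _); ring.
have ir0 : 0 < rr^-1 by rewrite invr_gt0.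
have Xp : 0 < rr^-1 * (4 * x0 * x) by rewrite !mulr_gt0.
have Yp : 0 < rr^-1 * (4 * y0 * y) by rewrite !mulr_gt0.
have -> : 2 - 2 * alpha = 2 * (1 - alpha) by ring.
have a0 : 0 < 1 - alpha + beta by rewrite addr_gt0.
rewrite (appellF2E b10 beta0 a0); last by split => /=; lra.
rewrite !opprK (_ : laplace_pair (1 - alpha) beta _ 0 0 1 _ _ = rr^-1 `^ (- (1 - alpha + beta)) *
   laplace_pair (1 - alpha) beta (1 - alpha + beta) 0 0 rr (4 * x0 * x) (4 * y0 * y)); last first.
  by rewrite -laplace_pair_scale// mulVf// lt0r_neq0.
have -> : rr^-1 `^ (- (1 - alpha + beta)) = rr `^ (1 - alpha + beta).
  by rewrite -powR_inv1 ?(ltW r0)// -powRrM mulrN mulN1r opprK.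
have -> : alpha - beta - 1 = - (1 - alpha + beta) by ring.
rewrite powRN /k2 /appellF2_norm /q2_const.
have -> : 2 - 2 * alpha + 2 * beta = 2 * (1 - alpha) + 2 * beta by ring.
have -> : 2 - 2 * alpha = 2 * (1 - alpha) by ring.
have p0 := pi_gt0 R.
have g1 := Gamma_fun_gt0 a0; have g2 := Gamma_fun_gt0 b10; have g3 := Gamma_fun_gt0 beta0.
have g4 : 0 < Gamma_fun (2 * (1 - alpha)) by apply: Gamma_fun_gt0; rewrite mulr_gt0.
have g5 : 0 < Gamma_fun (2 * beta) by apply: Gamma_fun_gt0; rewrite mulr_gt0.
have g6 := powR_gt0 (1 - alpha + beta) r0.
move: (laplace_pair _ _ _ _ _ _ _ _) (2 `^ _) (x `^ _) (x0 `^ _) => L T u v.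
move: (Gamma_fun (1 - alpha + beta)) (Gamma_fun (1 - alpha)) (Gamma_fun beta)
  (Gamma_fun (2 * (1 - alpha))) (Gamma_fun (2 * beta)) (rr `^ _) (pi : R) g1 g2 g3 g4 g5 g6 p0.
by move=> ? ? ? ? ? ? ? *; field; do ?[apply/andP; split]; apply: lt0r_neq0.
Qed.

Lemma derive1_q2_fst (x y x0 y0 : R) : 0 < x -> 0 < y -> 0 < x0 -> 0 < y0 ->
  0 < (x - x0) ^+ 2 + (y - y0) ^+ 2 ->
  derive1 (fun u => q2 alpha beta u y x0 y0) x
  = q2_const * x0 `^ (1 - 2 * alpha) *
    ((1 - 2 * alpha) * x `^ (- (2 * alpha)) * heat_pair 0 0 0 x y x0 y0
     - x `^ (1 - 2 * alpha) * (2 * (x - x0) * heat_pair 1 0 0 x y x0 y0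
        + 4 * x0 * heat_pair 1 1 0 x y x0 y0)).
Proof.
move=> xp yp x0p y0p r0.
have a0 : 0 < 1 - alpha + beta by rewrite addr_gt0.
have hX : 0 < 4 * x0 * x + 0 by rewrite addr0 !mulr_gt0.
have hY : 0 < 0 * x + 4 * y0 * y by rewrite mul0r add0r !mulr_gt0.
have hL := is_derive_laplace_pair_line 0 0 b10 beta0 a0 r0 hX hY.
have hp := is_derive1_powR (1 - 2 * alpha) xp.
have hM := is_deriveM hp hL.
have hZ := is_deriveZ (q2_const * x0 `^ (1 - 2 * alpha)) hM.
have {hM}hZ : is_derive x 1 (fun u => q2_const * x0 `^ (1 - 2 * alpha) * (u `^ (1 - 2 * alpha) *
   laplace_pair (1 - alpha) beta (1 - alpha + beta) 0 0
     ((u - x0) ^+ 2 + (y - y0) ^+ 2) (4 * x0 * u + 0) (0 * u + 4 * y0 * y))) _ := hZ.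
have near_pos : \forall u \near x, 0 < u /\ 0 < (u - x0) ^+ 2 + (y - y0) ^+ 2.
  near=> u; split; near: u; first exact: lt_nbhsr.
  have : (u - x0) ^+ 2 + (y - y0) ^+ 2 @[u --> x] --> (x - x0) ^+ 2 + (y - y0) ^+ 2.
    apply: cvgD; last exact: cvg_cst.
    by rewrite !expr2; apply: cvgM; (apply: cvgB; [exact: cvg_id|exact: cvg_cst]).
  by move=> /cvgr_gt; apply.
rewrite derive1E.
have -> : 'D_1 (fun u => q2 alpha beta u y x0 y0) x =
   'D_1 (fun u => q2_const * x0 `^ (1 - 2 * alpha) * (u `^ (1 - 2 * alpha) *
   laplace_pair (1 - alpha) beta (1 - alpha + beta) 0 0
     ((u - x0) ^+ 2 + (y - y0) ^+ 2) (4 * x0 * u + 0) (0 * u + 4 * y0 * y))) x.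
  apply: near_eq_derive.
  near=> u; have [u0 ur0] : 0 < u /\ 0 < (u - x0) ^+ 2 + (y - y0) ^+ 2 by near: u.
  rewrite (q2E u0 yp x0p y0p ur0) /heat_pair !addr0 mul0r add0r; reflexivity.
rewrite derive_val /GRing.scale/= /heat_pair !addr0 !mul0r !add0r !addr0.
have -> : 1 - 2 * alpha - 1 = - (2 * alpha) by ring.
do 3 move: (laplace_pair _ _ _ _ _ _ _ _) => ?.
ring.
Unshelve. all: end_near. Qed.

Lemma derive1_q2_snd (x y x0 y0 : R) : 0 < x -> 0 < y -> 0 < x0 -> 0 < y0 ->
  0 < (x - x0) ^+ 2 + (y - y0) ^+ 2 ->
  derive1 (fun v => q2 alpha beta x v x0 y0) y
  = - (q2_const * x0 `^ (1 - 2 * alpha) * x `^ (1 - 2 * alpha) *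
     (2 * (y - y0) * heat_pair 1 0 0 x y x0 y0 + 4 * y0 * heat_pair 1 0 1 x y x0 y0)).
Proof.
move=> xp yp x0p y0p; rewrite [(x - x0) ^+ 2 + _]addrC => r0.
have a0 : 0 < 1 - alpha + beta by rewrite addr_gt0.
have hX : 0 < 0 * y + 4 * x0 * x by rewrite mul0r add0r !mulr_gt0.
have hY : 0 < 4 * y0 * y + 0 by rewrite addr0 !mulr_gt0.
have hL := is_derive_laplace_pair_line 0 0 b10 beta0 a0 r0 hX hY.
have hZ := is_deriveZ (q2_const * x0 `^ (1 - 2 * alpha) * x `^ (1 - 2 * alpha)) hL.
have {}hZ : is_derive y 1 (fun v => q2_const * x0 `^ (1 - 2 * alpha) * x `^ (1 - 2 * alpha) *
   laplace_pair (1 - alpha) beta (1 - alpha + beta) 0 0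
     ((v - y0) ^+ 2 + (x - x0) ^+ 2) (0 * v + 4 * x0 * x) (4 * y0 * v + 0)) _ := hZ.
have near_pos : \forall v \near y, 0 < v /\ 0 < (v - y0) ^+ 2 + (x - x0) ^+ 2.
  near=> u; split; near: u; first exact: lt_nbhsr.
  have : (u - y0) ^+ 2 + (x - x0) ^+ 2 @[u --> y] --> (y - y0) ^+ 2 + (x - x0) ^+ 2.
    apply: cvgD; last exact: cvg_cst.
    by rewrite !expr2; apply: cvgM; (apply: cvgB; [exact: cvg_id|exact: cvg_cst]).
  by move=> /cvgr_gt; apply.
rewrite derive1E.
have -> : 'D_1 (fun v => q2 alpha beta x v x0 y0) y =
   'D_1 (fun v => q2_const * x0 `^ (1 - 2 * alpha) * x `^ (1 - 2 * alpha) *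
   laplace_pair (1 - alpha) beta (1 - alpha + beta) 0 0
     ((v - y0) ^+ 2 + (x - x0) ^+ 2) (0 * v + 4 * x0 * x) (4 * y0 * v + 0)) y.
  apply: near_eq_derive.
  near=> v; have [v0] : 0 < v /\ 0 < (v - y0) ^+ 2 + (x - x0) ^+ 2 by near: v.
  rewrite addrC => vr0; rewrite (q2E xp v0 x0p y0p vr0) /heat_pair !addr0 mul0r add0r.
  rewrite [(x - x0) ^+ 2 + _]addrC mulrA; reflexivity.
rewrite derive_val /GRing.scale/= /heat_pair !addr0 !mul0r !add0r [(x - x0) ^+ 2 + _]addrC.
do 2 move: (laplace_pair _ _ _ _ _ _ _ _) => ?.
ring.
Unshelve. all: end_near. Qed.

Definition angle_form (x y dx dy x0 y0 : R) : R := (x - x0) * dy - (y - y0) * dx.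

(** The terms whose singularity is integrable along the arc. *)
Definition weak_part (x y dx dy x0 y0 : R) : R :=
  q2_const * x0 `^ (1 - 2 * alpha) * y `^ (2 * beta) *
  ((1 - 2 * alpha) * dy * heat_pair 0 0 0 x y x0 y0
   - 4 * x0 * x * dy * heat_pair 1 1 0 x y x0 y0
   + 4 * y0 * x * dx * heat_pair 1 0 1 x y x0 y0).

Definition dl_kernel (x y dx dy x0 y0 : R) : R :=
  weak_part x y dx dy x0 y0
  - 2 * (q2_const * x0 `^ (1 - 2 * alpha) * y `^ (2 * beta) * x)
    * heat_pair 1 0 0 x y x0 y0 * angle_form x y dx dy x0 y0.

Lemma normal_derivative_q2E (x y dx dy : R -> R) (s x0 y0 : R) :
  0 < x s -> 0 < y s -> 0 < x0 -> 0 < y0 ->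
  0 < (x s - x0) ^+ 2 + (y s - y0) ^+ 2 ->
  x s `^ (2 * alpha) * y s `^ (2 * beta) * normal_derivative_q2 alpha beta x y dx dy s x0 y0
  = dl_kernel (x s) (y s) (dx s) (dy s) x0 y0.
Proof.
move=> xp yp x0p y0p r0; rewrite /normal_derivative_q2.
rewrite derive1_q2_fst// derive1_q2_snd// /dl_kernel /weak_part /angle_form.
have xa := powR_gt0 (2 * alpha) xp.
have -> : x s `^ (1 - 2 * alpha) = x s / x s `^ (2 * alpha).
  by rewrite powRB ?(gt_eqF xp) ?implybT// powRr1// ltW.
rewrite powRN.
move: (heat_pair _ _ _ _ _ _ _) (heat_pair _ _ _ _ _ _ _) (heat_pair _ _ _ _ _ _ _) (heat_pair _ _ _ _ _ _ _) => h1 h2 h3 h4.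
move: (x s) (y s) (dx s) (dy s) (x s `^ _) (y s `^ _) (x0 `^ _) q2_const xa => ? ? ? ? ? ? ? ? xa.
by field; rewrite gt_eqF.
Qed.

End fundamental_solution.

(** * The inverse square root and the Poisson kernel *)

Section one_dimensional_integrals.
Variable R : realType.
Notation mu := (@lebesgue_measure R).

Lemma measurable_oppR : measurable_fun [set: measurableTypeR R] (-%R : measurableTypeR R -> measurableTypeR R).
Proof. by have := @measurable_funN _ _ R setT id (@measurable_id _ _ setT). Qed.

Lemma ge0_integral_reflect (D : set R) (f : R -> \bar R) :
  measurable D -> measurable_fun D f -> (forall x, D x -> (0 <= f x)%E) ->
  (\int[mu]_(x in D) f x = \int[mu]_(x in -%R @^-1` D) f (- x)%R)%E.
Proof.
move=> mD mf f0.
pose P0 : {measure set (measurableTypeR R) -> \bar R} :=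
  pushforward mu (-%R : measurableTypeR R -> measurableTypeR R).
pose P := P0 measurable_oppR.
rewrite (_ : (\int[mu]_(x in D) f x = \int[P]_(x in D) f x)%E); last first.
  apply: eq_measure_integral => A mA _.
  by apply/esym; exact: lebesgue_measureN.
by rewrite ge0_integral_pushforward//; move=> x /set_mem; exact: f0.
Qed.

Lemma measurable_inv_sqrt (s0 : R) D : measurable_fun D (fun s : R => `|s - s0| `^ (- 2^-1)).
Proof.
apply: measurable_funTS; apply: (measurableT_comp (measurable_powR _)).
by apply: measurableT_comp; [exact: normr_measurable|exact: measurable_funB].
Qed.

Lemma integral_inv_sqrt0 (c : R) : 0 < c ->
  (\int[mu]_(s in `[(- c)%R, c]) (`|s| `^ (- 2^-1))%:E = (4 * c `^ 2^-1)%:E)%E.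
Proof.
move=> c0.
have m D : measurable_fun D (fun s : R => (`|s| `^ (- 2^-1))%:E).
  apply/measurable_EFinP; have := @measurable_inv_sqrt 0 D.
  by congr measurable_fun; apply/funext => s; rewrite subr0.
have h0 : 0 < 2^-1 :> R by rewrite invr_gt0.
have e : (\int[mu]_(s in `]0%R, c]) (`|s| `^ (- 2^-1))%:E = (2 * c `^ 2^-1)%:E)%E.
  have -> : (2 * c `^ 2^-1) = c `^ 2^-1 / 2^-1 by rewrite invrK mulrC.
  rewrite -(integral_powR0 h0 c0); apply: eq_integral_on => s /=; rewrite in_itv/= => /andP[s0 _].
  rewrite gtr0_norm// (_ : 2^-1 - 1 = - 2^-1)//; lra.
have -> : `[- c, c]%classic = `[- c, 0[%classic `|` `[0, c]%classic :> set R.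
  by rewrite -itv_bndbnd_setU// bnd_simp ?oppr_le0 ltW.
rewrite ge0_integral_setU//=; last 2 first.
- exact: m.
- rewrite disj_set2E; apply/eqP/seteqP; split => // u [] /=; rewrite !in_itv/=.
  by move=> /andP[_ u1] /andP[]; rewrite leNgt u1.
rewrite -[X in (_ + X)%E]integral_itv_obnd_cbnd// e.
rewrite ge0_integral_reflect//.
have -> : -%R @^-1` `[- c, 0[%classic = `]0, c]%classic :> set R.
  by apply/seteqP; split => s; rewrite /= !in_itv/= oppr_lt0 lerN2 andbC.
under eq_integral do rewrite normrN.
by rewrite e -EFinD; congr EFin; lra.
Qed.

(** The interval is contained in the one of radius 2 d about s0. *)
Lemma integral_inv_sqrt_le (t d s0 : R) : 0 < d -> s0 \in `[t - d, t + d] ->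
  (\int[mu]_(s in `[(t - d)%R, (t + d)%R]) (`|s - s0| `^ (- 2^-1))%:E
   <= (4 * (2 * d) `^ 2^-1)%:E)%E.
Proof.
move=> d0; rewrite in_itv/= => /andP[h1 h2].
have d20 : 0 < 2 * d by rewrite mulr_gt0.
rewrite -integral_inv_sqrt0//.
rewrite (ge0_integral_affine (- s0) ltr01)//; last first.
  apply/measurable_EFinP; have := @measurable_inv_sqrt 0 `[(- (2 * d)), (2 * d)]%classic.
  by congr measurable_fun; apply/funext => s; rewrite subr0.
rewrite mul1e (eq_integral_on (g := fun s => (`|s - s0| `^ (- 2^-1))%:E)); last first.
  by move=> s _; rewrite mul1r.
apply: ge0_subset_integral => //.
- by rewrite -[X in measurable X]setTI; exact: measurable_affine.
- by apply/measurable_EFinP; exact: measurable_inv_sqrt.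
- by move=> s; rewrite /affine_map /= !in_itv/= => /andP[s1 s2]; apply/andP; split; lra.
Qed.

Lemma integrable_inv_sqrt (t d s0 : R) : 0 < d -> s0 \in `[t - d, t + d] ->
  mu.-integrable `[t - d, t + d] (EFin \o (fun s => `|s - s0| `^ (- 2^-1))).
Proof.
move=> d0 hs; apply/integrableP; split.
  by apply/measurable_EFinP; exact: measurable_inv_sqrt.
rewrite (eq_integral_on (g := fun s => (`|s - s0| `^ (- 2^-1))%:E)).
  by apply: le_lt_trans (integral_inv_sqrt_le d0 hs) _; exact: ltry.
by move=> s _; rewrite /= ger0_norm// powR_ge0.
Qed.

Lemma Rintegral_inv_sqrt_le (t d s0 : R) : 0 < d -> s0 \in `[t - d, t + d] ->
  \int[mu]_(s in `[t - d, t + d]) (`|s - s0| `^ (- 2^-1)) <= 4 * (2 * d) `^ 2^-1.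
Proof.
move=> d0 hs; rewrite -lee_fin /Rintegral fineK.
  exact: integral_inv_sqrt_le.
by apply: integrable_fin_num => //; exact: integrable_inv_sqrt.
Qed.

Lemma is_derive_poisson (v s0 s : R) : 0 < v ->
  is_derive s 1 (fun s => atan ((s - s0) / v)) (v / ((s - s0) ^+ 2 + v ^+ 2)).
Proof.
move=> v0.
have h : is_derive s 1 (fun s => (s - s0) / v) v^-1.
  rewrite [X in is_derive _ _ X _](_ : _ = v^-1 \*: (id : R -> R) + cst (- s0 / v)); last first.
    by apply/funext => z; rewrite !fctE /GRing.scale/= mulrBl mulNr mulrC.
  by apply: is_derive_eq; rewrite addr0 /GRing.scale/= mulr1.
have := @is_derive1_comp R atan (fun s => (s - s0) / v) s _ _ (is_derive1_atan _) h.
move=> {}h; apply: (is_derive_eq h).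
have q0 : 0 < (s - s0) ^+ 2 + v ^+ 2 by rewrite ltr_wpDl ?sqr_ge0// exprn_gt0.
have vn : v != 0 by rewrite gt_eqF.
have -> : 1 + ((s - s0) / v) ^+ 2 = ((s - s0) ^+ 2 + v ^+ 2) / v ^+ 2 by field.
by field; rewrite vn (gt_eqF q0).
Qed.

Lemma continuous_poisson (v s0 : R) : 0 < v ->
  continuous (fun s : R => v / ((s - s0) ^+ 2 + v ^+ 2)).
Proof.
move=> v0 s; apply: cvgMr; apply: cvgV.
  by rewrite gt_eqF// ltr_wpDl ?sqr_ge0// exprn_gt0.
apply: cvgD; last exact: cvg_cst.
by rewrite !expr2; apply: cvgM; (apply: cvgB; [exact: cvg_id|exact: cvg_cst]).
Qed.

Lemma Rintegral_poisson_le (v s0 a b : R) : 0 < v -> a < b ->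
  \int[mu]_(s in `[a, b]) (v / ((s - s0) ^+ 2 + v ^+ 2)) <= pi.
Proof.
move=> v0 ab.
have h := @integral_is_derive R (fun s => v / ((s - s0) ^+ 2 + v ^+ 2))
  (fun s => atan ((s - s0) / v)) a b ab.
have {}h : (\int[mu]_(s in `[a, b]) (v / ((s - s0) ^+ 2 + v ^+ 2))%:E =
    (atan ((b - s0) / v) - atan ((a - s0) / v))%:E)%E.
  apply: h; first by apply: continuous_subspaceT; exact: continuous_poisson.
  by move=> s _; exact: is_derive_poisson.
rewrite /Rintegral h/=.
by have := atan_ltpi2 ((b - s0) / v); have := atan_gtNpi2 ((a - s0) / v) => h1 h2; lra.
Qed.

End one_dimensional_integrals.

(** * A short arc in the frame of its tangent *)

Section local_geometry.
Variable R : realType.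
Notation mu := (@lebesgue_measure R).

Lemma MVT_points (f df : R -> R) (a b s s' : R) :
  (forall u, u \in `[a, b] -> is_derive u 1 f (df u)) ->
  s \in `[a, b] -> s' \in `[a, b] ->
  exists u, [/\ u \in `[a, b], `|u - s| <= `|s - s'|, `|u - s'| <= `|s - s'| &
    f s - f s' = df u * (s - s')].
Proof.
wlog ss : s s' / s' < s => [hw|] hd sI s'I.
  have [h|h|->] := ltgtP s s'; last 2 first.
  - exact: hw.
  - by exists s'; split => //; rewrite ?subrr ?mulr0 ?normr0.
  have [u [u1 u2 u3 u4]] := hw _ _ h hd s'I sI.
  exists u; split => //; rewrite 1?distrC//; first by rewrite distrC [X in _ <= X]distrC.
    by rewrite distrC [X in _ <= X]distrC.
  by rewrite -[LHS]opprB u4 -mulrN opprB.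
move: sI s'I; rewrite !in_itv/= => /andP[s1 s2] /andP[s'1 s'2].
have sub u : u \in `[s', s] -> u \in `[a, b].
  by rewrite !in_itv/= => /andP[u1 u2]; rewrite (le_trans s'1)// (le_trans u2).
have hd' (u : R) : u \in `]s', s[ -> is_derive u 1 f (df u).
  by move=> uI; apply: hd; apply: sub; exact: subset_itv_oo_cc uI.
have hc : {within `[s', s], continuous f}.
  by apply: derivable_within_continuous => u uI; have hu := hd _ (sub _ uI); exact: ex_derive.
have [u uI e] := MVT ss hd' hc.
have uI' : u \in `[s', s] by exact: subset_itv_oo_cc uI.
exists u; split => //; first exact: sub.
- move: uI'; rewrite in_itv/= => /andP[u1 u2].
  by rewrite distrC !ger0_norm; lra.
- move: uI'; rewrite in_itv/= => /andP[u1 u2].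
  by rewrite !ger0_norm; lra.
Qed.

(** If v <= h the first coordinate alone is large enough, otherwise the second. *)
Lemma quarter_cone_le (v h u w : R) : 0 <= v -> 0 <= h -> 0 <= u -> 0 <= w ->
  3 / 4 * h <= u -> v <= w + 1 / 4 * h -> (h ^+ 2 + v ^+ 2) / 8 <= u ^+ 2 + w ^+ 2.
Proof.
move=> v1 h0 u0 w0 hu hv.
have sq (m n : R) : 0 <= m -> m <= n -> m * m <= n * n
    by move=> m0 mn; exact: ler_pM.
rewrite !expr2; have [vh|hv'] := leP v h.
  have h43 : 3 / 4 * h * (3 / 4 * h) <= u * u by apply: sq => //; rewrite mulr_ge0.
  have hvh : v * v <= h * h by exact: sq.
  have w2 : 0 <= w * w by rewrite mulr_ge0.
  have hh : 0 <= h * h by rewrite mulr_ge0.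
  by lra.
have h43 : 3 / 4 * v * (3 / 4 * v) <= w * w by apply: sq; [rewrite mulr_ge0|lra].
have hvh : h * h <= v * v by apply: sq => //; exact: ltW.
have u2 : 0 <= u * u by rewrite mulr_ge0.
have hh : 0 <= v * v by rewrite mulr_ge0.
by lra.
Qed.

(** L bounds the rate at which the tangent turns, so that by la_small its direction
    changes little along the arc. *)
Record local_arc (x y dx dy : R -> R) (t d L : R) : Prop := LocalArc {
  la_d : 0 < d ;
  la_L : 0 < L ;
  la_small : L * d <= 8^-1 ;
  la_dx : forall s, s \in `[t - d, t + d] -> is_derive s 1 x (dx s) ;
  la_dy : forall s, s \in `[t - d, t + d] -> is_derive s 1 y (dy s) ;
  la_lipx : forall s s', s \in `[t - d, t + d] -> s' \in `[t - d, t + d] ->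
    `|dx s - dx s'| <= L * `|s - s'| ;
  la_lipy : forall s s', s \in `[t - d, t + d] -> s' \in `[t - d, t + d] ->
    `|dy s - dy s'| <= L * `|s - s'| ;
  la_unit : dx t ^+ 2 + dy t ^+ 2 = 1 ;
  la_cont : [/\ continuous x, continuous y, continuous dx & continuous dy] }.

Definition tan_coord (x y dx dy : R -> R) (t : R) (p : R * R) (s : R) : R :=
  dx t * (x s - p.1) + dy t * (y s - p.2).
Definition nor_coord (x y dx dy : R -> R) (t : R) (p : R * R) (s : R) : R :=
  dy t * (x s - p.1) - dx t * (y s - p.2).
Definition tan_speed (dx dy : R -> R) (t s : R) : R := dx t * dx s + dy t * dy s.
Definition nor_speed (dx dy : R -> R) (t s : R) : R := dy t * dx s - dx t * dy s.
Definition sqdist (x y : R -> R) (p : R * R) (s : R) : R :=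
  (x s - p.1) ^+ 2 + (y s - p.2) ^+ 2.
(** The derivative of the argument of the arc, seen from p. *)
Definition angle_density (x y dx dy : R -> R) (p : R * R) (s : R) : R :=
  ((x s - p.1) * dy s - (y s - p.2) * dx s) / sqdist x y p s.

Section with_arc.
Variables (x y dx dy : R -> R) (t d L : R).
Hypothesis arc : local_arc x y dx dy t d L.
Notation U := (tan_coord x y dx dy t).
Notation V := (nor_coord x y dx dy t).
Notation dU := (tan_speed dx dy t).
Notation dV := (nor_speed dx dy t).
Notation J := (`[t - d, t + d]).

Lemma is_derive_linear_comb (f g : R -> R) (df dg a b p q s : R) :
  is_derive s 1 f df -> is_derive s 1 g dg ->
  is_derive s 1 (fun s => a * (f s - p) + b * (g s - q)) (a * df + b * dg).
Proof.
move=> hf hg; have h := is_deriveD (is_deriveZ a (is_deriveB hf (is_derive_cst p s 1)))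
  (is_deriveZ b (is_deriveB hg (is_derive_cst q s 1))).
by apply: (is_derive_eq h); rewrite /GRing.scale/= !subr0.
Qed.

Lemma is_derive_tan_coord p s : s \in J -> is_derive s 1 (U p) (dU s).
Proof. by move=> sJ; exact: (is_derive_linear_comb _ _ _ _ (la_dx arc sJ) (la_dy arc sJ)). Qed.

Lemma is_derive_nor_coord p s : s \in J -> is_derive s 1 (V p) (dV s).
Proof.
move=> sJ; have h := is_derive_linear_comb (dy t) (- dx t) p.1 p.2 (la_dx arc sJ) (la_dy arc sJ).
rewrite /nor_coord /nor_speed -mulNr.
rewrite (_ : (fun s0 => _) = (fun s0 => dy t * (x s0 - p.1) + - dx t * (y s0 - p.2)))//.
by apply/funext => u; rewrite mulNr.
Qed.

Lemma center_in : t \in J.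
Proof. by have d0 := la_d arc; rewrite in_itv/=; apply/andP; split; lra. Qed.

Lemma unit_coord_le : `|dx t| <= 1 /\ `|dy t| <= 1.
Proof.
have h := la_unit arc; have h1 := sqr_ge0 (dx t); have h2 := sqr_ge0 (dy t).
suff le1 (a : R) : a ^+ 2 <= 1 -> `|a| <= 1 by split; apply: le1; lra.
by move=> a1; rewrite -(@ler_pXn2r _ 2)// ?nnegrE// real_normK ?num_real// expr1n.
Qed.

Lemma dist_center s : s \in J -> `|s - t| <= d.
Proof. by rewrite in_itv/= => /andP[h1 h2]; rewrite ler_norml; apply/andP; split; lra. Qed.

Lemma norm_comb_le (a b u v : R) : `|a| <= 1 -> `|b| <= 1 ->
  `|a * u + b * v| <= `|u| + `|v|.
Proof.
move=> a1 b1; apply: (le_trans (ler_normD _ _)); rewrite !normrM.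
by apply: lerD; rewrite ler_piMl.
Qed.

Lemma tan_speed_lip s s' : s \in J -> s' \in J -> `|dU s - dU s'| <= 2 * L * `|s - s'|.
Proof.
move=> sJ s'J; have [a1 b1] := unit_coord_le.
have -> : dU s - dU s' = dx t * (dx s - dx s') + dy t * (dy s - dy s') by rewrite /tan_speed; ring.
apply: (le_trans (norm_comb_le _ _ a1 b1)).
by have := la_lipx arc sJ s'J; have := la_lipy arc sJ s'J => h1 h2; lra.
Qed.

Lemma nor_speed_lip s s' : s \in J -> s' \in J -> `|dV s - dV s'| <= 2 * L * `|s - s'|.
Proof.
move=> sJ s'J; have [a1 b1] := unit_coord_le.
have -> : dV s - dV s' = dy t * (dx s - dx s') + - dx t * (dy s - dy s') by rewrite /nor_speed; ring.
have a1' : `|- dx t| <= 1 by rewrite normrN.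
apply: (le_trans (norm_comb_le _ _ b1 a1')).
by have := la_lipx arc sJ s'J; have := la_lipy arc sJ s'J => h1 h2; lra.
Qed.

Lemma tan_speed_center : dU t = 1.
Proof. by rewrite /tan_speed -!expr2 (la_unit arc). Qed.

Lemma nor_speed_center : dV t = 0.
Proof. by rewrite /nor_speed mulrC subrr. Qed.

Lemma speed_bounds s : s \in J -> [/\ 3 / 4 <= dU s, dU s <= 2 & `|dV s| <= 1 / 4].
Proof.
move=> sJ; have hd := dist_center sJ.
have h1 := tan_speed_lip sJ center_in; rewrite tan_speed_center in h1.
have h2 := nor_speed_lip sJ center_in; rewrite nor_speed_center subr0 in h2.
have L0 := la_L arc; have Ld := la_small arc.
have h3 : 2 * L * `|s - t| <= 1 / 4.
  apply: (@le_trans _ _ (2 * L * d)); first by rewrite ler_wpM2l// mulr_ge0// ltW.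
  by rewrite -mulrA; lra.
have h4 : `|dU s - 1| <= 1 / 4 by exact: le_trans h3.
have h5 : `|dV s| <= 1 / 4 by exact: le_trans h3.
by move: h4; rewrite ler_norml => /andP[h4 h4']; split => //; lra.
Qed.

Lemma tan_coord_lower p s s' : s \in J -> s' \in J -> 3 / 4 * `|s - s'| <= `|U p s - U p s'|.
Proof.
move=> sJ s'J; have [u [uJ _ _ ->]] := MVT_points (is_derive_tan_coord p) sJ s'J.
have [h1 _ _] := speed_bounds uJ; rewrite normrM ler_wpM2r//.
by apply: (le_trans h1); exact: ler_norm.
Qed.

Lemma tan_coord_mono p s s' : s \in J -> s' \in J -> s' <= s -> 3 / 4 * (s - s') <= U p s - U p s'.
Proof.
move=> sJ s'J ss; have [u [uJ _ _ ->]] := MVT_points (is_derive_tan_coord p) sJ s'J.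
by have [h1 _ _] := speed_bounds uJ; rewrite ler_wpM2r// subr_ge0.
Qed.

Lemma nor_coord_lip p s s' : s \in J -> s' \in J -> `|V p s - V p s'| <= 1 / 4 * `|s - s'|.
Proof.
move=> sJ s'J; have [u [uJ _ _ ->]] := MVT_points (is_derive_nor_coord p) sJ s'J.
by have [_ _ h1] := speed_bounds uJ; rewrite normrM ler_wpM2r.
Qed.

Lemma tan_coord_taylor p s s' : s \in J -> s' \in J ->
  `|U p s - U p s' - dU s * (s - s')| <= 2 * L * `|s - s'| ^+ 2.
Proof.
move=> sJ s'J; have [u [uJ us _ ->]] := MVT_points (is_derive_tan_coord p) sJ s'J.
rewrite -mulrBl normrM expr2 mulrA ler_wpM2r//.
apply: (le_trans (tan_speed_lip uJ sJ)); rewrite ler_wpM2l// mulr_ge0// ltW//; exact: la_L arc.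
Qed.

Lemma nor_coord_taylor p s s' : s \in J -> s' \in J ->
  `|V p s - V p s' - dV s * (s - s')| <= 2 * L * `|s - s'| ^+ 2.
Proof.
move=> sJ s'J; have [u [uJ us _ ->]] := MVT_points (is_derive_nor_coord p) sJ s'J.
rewrite -mulrBl normrM expr2 mulrA ler_wpM2r//.
apply: (le_trans (nor_speed_lip uJ sJ)); rewrite ler_wpM2l// mulr_ge0// ltW//; exact: la_L arc.
Qed.

Lemma sqdistE p s : sqdist x y p s = U p s ^+ 2 + V p s ^+ 2.
Proof.
rewrite /sqdist /tan_coord /nor_coord; set X := x s - _; set Y := y s - _.
transitivity ((dx t ^+ 2 + dy t ^+ 2) * (X ^+ 2 + Y ^+ 2)); first by rewrite (la_unit arc) mul1r.
ring.
Qed.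

Lemma angle_numE p s : (x s - p.1) * dy s - (y s - p.2) * dx s = V p s * dU s - U p s * dV s.
Proof.
rewrite /tan_coord /nor_coord /tan_speed /nor_speed; set X := x s - _; set Y := y s - _.
transitivity ((dx t ^+ 2 + dy t ^+ 2) * (X * dy s - Y * dx s)); first by rewrite (la_unit arc) mul1r.
ring.
Qed.

Section foot.
Variables (p : R * R) (s0 : R).
Hypotheses (s0J : s0 \in J) (foot : U p s0 = 0).
Let v0 := V p s0.

Lemma tan_coord_foot s : s \in J -> 3 / 4 * `|s - s0| <= `|U p s|.
Proof. by move=> sJ; have := tan_coord_lower p sJ s0J; rewrite foot subr0. Qed.

(** U grows at least like 3 / 4 |s - s0| and V changes at most by 1 / 4 |s - s0|. *)
Lemma sqdist_lower s : s \in J -> ((s - s0) ^+ 2 + v0 ^+ 2) / 8 <= sqdist x y p s.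
Proof.
move=> sJ; rewrite sqdistE.
have h1 := tan_coord_foot sJ; have h2 := nor_coord_lip p sJ s0J; rewrite -/v0 in h2.
rewrite -[(s - s0) ^+ 2]real_normK ?num_real// -[v0 ^+ 2]real_normK ?num_real//.
rewrite -[U p s ^+ 2]real_normK ?num_real// -[V p s ^+ 2]real_normK ?num_real//.
have h3 : `|v0| <= `|V p s| + 1 / 4 * `|s - s0|.
  have -> : v0 = V p s - (V p s - v0) by ring.
  by apply: (le_trans (ler_normB _ _)); rewrite lerD2l.
exact: quarter_cone_le h3.
Qed.

(** At the foot U vanishes and V is v0, so that to first order V dU - U dV is
    v0 dU; the rest is quadratic in s - s0 because the speeds are Lipschitz. *)
Lemma angle_num_le s : s \in J ->
  `|(x s - p.1) * dy s - (y s - p.2) * dx s| <= 2 * `|v0| + 6 * L * (s - s0) ^+ 2.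
Proof.
move=> sJ; rewrite angle_numE.
have h1 := tan_coord_taylor p sJ s0J; have h2 := nor_coord_taylor p sJ s0J.
rewrite foot subr0 in h1; rewrite -/v0 in h2.
have [b1 b2 b3] := speed_bounds sJ.
(* The two remainders in parentheses are those of Taylor's formula at the foot; the
   mixed terms in dU s * dV s cancel. *)
have -> : V p s * dU s - U p s * dV s = v0 * dU s
  + ((V p s - v0 - dV s * (s - s0)) * dU s - (U p s - dU s * (s - s0)) * dV s) by ring.
rewrite real_normK ?num_real// in h1 h2.
have b2' : `|dU s| <= 2 by rewrite ger0_norm//; lra.
have L0 := la_L arc; have q0 := sqr_ge0 (s - s0).
have Lq : 0 <= L * (s - s0) ^+ 2 by rewrite mulr_ge0// ltW.
apply: (le_trans (ler_normD _ _)); apply: lerD.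
  by rewrite normrM mulrC ler_wpM2r.
apply: (le_trans (ler_normB _ _)); rewrite !normrM.
apply: (@le_trans _ _ (2 * L * (s - s0) ^+ 2 * 2 + 2 * L * (s - s0) ^+ 2 * (1 / 4))).
  by apply: lerD; rewrite ler_pM.
by lra.
Qed.

(** This follows from angle_num_le and sqdist_lower, whose denominator 8 yields
    the factors 16 and 48. *)
Lemma angle_density_le s : s \in J ->
  `|angle_density x y dx dy p s| <= 16 * (`|v0| / ((s - s0) ^+ 2 + `|v0| ^+ 2)) + 48 * L.
Proof.
move=> sJ; rewrite real_normK ?num_real//.
set q := (s - s0) ^+ 2 + v0 ^+ 2; have q0 : 0 <= q by rewrite addr_ge0 ?sqr_ge0.
have L0 := la_L arc.
have r0 : 0 <= 16 * (`|v0| / q) + 48 * L.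
  by rewrite addr_ge0 ?mulr_ge0 ?invr_ge0// ltW.
have [h|h] := eqVneq q 0.
  have e : s = s0.
    move/eqP: h; rewrite /q paddr_eq0 ?sqr_ge0// => /andP[].
    by rewrite sqrf_eq0 subr_eq0 => /eqP.
  have v00 : v0 = 0.
    by move/eqP: h; rewrite /q paddr_eq0 ?sqr_ge0// => /andP[_]; rewrite sqrf_eq0 => /eqP.
  have num0 : (x s - p.1) * dy s - (y s - p.2) * dx s = 0.
    by rewrite angle_numE e foot -/v0 v00 !mul0r subrr.
  by rewrite /angle_density num0 mul0r normr0.
have qp : 0 < q by rewrite lt_def h.
have hs := sqdist_lower sJ; rewrite -/v0 -/q in hs.
have sp : 0 < sqdist x y p s by apply: lt_le_trans hs; rewrite divr_gt0.
rewrite /angle_density normrM normfV (gtr0_norm sp) ler_pdivrMr//.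
apply: (le_trans (angle_num_le sJ)).
apply: (@le_trans _ _ ((16 * (`|v0| / q) + 48 * L) * (q / 8))); last by rewrite ler_wpM2l.
have -> : (16 * (`|v0| / q) + 48 * L) * (q / 8) = 2 * `|v0| + 6 * L * q by field.
by rewrite lerD2l ler_wpM2l ?mulr_ge0 ?(ltW L0)// /q lerDl sqr_ge0.
Qed.

Lemma sqdist_inv_root s : s \in J -> s != s0 ->
  sqdist x y p s `^ (- 4^-1) <= 2 * `|s - s0| `^ (- 2^-1).
Proof.
move=> sJ ss; have hs := sqdist_lower sJ.
have n0 : 0 < `|s - s0| by rewrite normr_gt0 subr_eq0.
have q0 : 0 < (`|s - s0| / 4) ^+ 2 by rewrite exprn_gt0// divr_gt0.
have h : (`|s - s0| / 4) ^+ 2 <= sqdist x y p s.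
  apply: le_trans hs; rewrite exprMn real_normK ?num_real//.
  by have := sqr_ge0 (s - s0); have := sqr_ge0 v0; rewrite exprVn => *; lra.
have sp := lt_le_trans q0 h.
apply: (@le_trans _ _ (((`|s - s0| / 4) ^+ 2) `^ (- 4^-1))).
  rewrite !powRN lef_pV2 ?posrE ?powR_gt0//.
  by apply: ge0_ler_powR; rewrite ?nnegrE ?invr_ge0// ltW.
rewrite -powR_mulrn; last by rewrite divr_ge0.
rewrite -powRrM (_ : 2%:R * - 4^-1 = - 2^-1 :> R); last by lra.
rewrite powRM ?invr_ge0// mulrC ler_wpM2r ?powR_ge0//.
rewrite powRN -powRN -[4^-1](@powR_inv1 R)// -powRrM mulrNN mul1r.
by rewrite powR12_sqrt// -[4](_ : 2 ^+ 2 = _) ?sqrtr_sqr ?ger0_norm// -natrX.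
Qed.

End foot.
End with_arc.
End local_geometry.

(** * The angle swept by a curve *)

Section angle_integral.
Variable R : realType.
Notation mu := (@lebesgue_measure R).

Lemma sqrt_add_gt0 (u v : R) : u != 0 \/ 0 < v -> 0 < Num.sqrt (u ^+ 2 + v ^+ 2) + v.
Proof.
case=> [u0|v0]; last by rewrite ltr_wpDl ?sqrtr_ge0.
have u2 : 0 < u ^+ 2 by rewrite exprn_even_gt0.
have h : `|v| < Num.sqrt (u ^+ 2 + v ^+ 2).
  by rewrite -sqrtr_sqr ltr_sqrt ?ltrDr// ltr_pwDl ?sqr_ge0.
by have := ler_norm (- v); rewrite normrN => h'; lra.
Qed.

(** By the half-angle formula this primitive is the polar angle of (V, U).  In this
    form it is smooth except on the ray U = 0, V <= 0. *)
Lemma is_derive_half_angle (U V : R -> R) (dU dV s : R) :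
  is_derive s 1 U dU -> is_derive s 1 V dV ->
  0 < Num.sqrt (U s ^+ 2 + V s ^+ 2) + V s ->
  is_derive s 1 (fun s => 2 * atan (U s / (Num.sqrt (U s ^+ 2 + V s ^+ 2) + V s)))
    ((V s * dU - U s * dV) / (U s ^+ 2 + V s ^+ 2)).
Proof.
move=> hU hV pos.
have q0 : 0 < U s ^+ 2 + V s ^+ 2.
  rewrite lt_def addr_ge0 ?sqr_ge0// andbT; apply/eqP => q0.
  move: pos; rewrite q0 sqrtr0 add0r => v0.
  by move: q0 => /eqP; rewrite gt_eqF// ltr_wpDl ?sqr_ge0// exprn_gt0.
have hq : is_derive s 1 (fun s => U s ^+ 2 + V s ^+ 2) (2 * U s * dU + 2 * V s * dV).
  have h := is_deriveD (is_deriveM hU hU) (is_deriveM hV hV).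
  rewrite (_ : (fun s => _) = U * U + V * V); last by apply/funext => z; rewrite !fctE !expr2.
  by apply: (is_derive_eq h); rewrite /GRing.scale/=; ring.
have hr := @is_derive1_comp R _ (fun s => U s ^+ 2 + V s ^+ 2) s _ _ (is_derive1_sqrt q0) hq.
have hD := is_deriveD hr hV.
have hI := is_deriveV (lt0r_neq0 pos : (_ : R -> R) s != 0) hD.
have hQ := is_deriveM hU hI.
have hA := @is_derive1_comp R atan _ s _ _ (is_derive1_atan _) hQ.
have h2 := is_deriveZ 2 hA.
apply: (is_derive_eq h2).
rewrite /GRing.scale/= !fctE/=.
have r0 : 0 < Num.sqrt (U s ^+ 2 + V s ^+ 2) by rewrite sqrtr_gt0.
have rr : Num.sqrt (U s ^+ 2 + V s ^+ 2) ^+ 2 = U s ^+ 2 + V s ^+ 2 by rewrite sqr_sqrtr// ltW.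
move: rr r0 pos; move: (Num.sqrt _) => r rr r0 pos.
have rV : r + V s != 0 by rewrite gt_eqF.
have rn : r != 0 by rewrite gt_eqF.
have U2 : U s * U s = r ^+ 2 - V s ^+ 2 by rewrite rr; ring.
have e : 1 + (U s * (r + V s)^-1) ^+ 2 = 2 * r / (r + V s).
  have -> : 1 + (U s * (r + V s)^-1) ^+ 2 = ((r + V s) ^+ 2 + U s * U s) / (r + V s) ^+ 2 by field.
  by rewrite U2; field.
rewrite e -rr.
transitivity ((r * ((r + V s) * dU - U s * dV) - (U s * U s * dU + U s * V s * dV))
    / (r ^+ 2 * (r + V s))); first by field; rewrite rV rn.
by rewrite U2; field; rewrite rV rn.
Qed.

(** At v = 0 the value is 2 atan 1. *)
Lemma half_angle_near (eps : R) : 0 < eps -> exists2 eta : R, 0 < eta &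
  forall u v : R, 0 < u -> `|v| <= eta * u ->
    `|2 * atan (u / (Num.sqrt (u ^+ 2 + v ^+ 2) + v)) - pi / 2| <= eps.
Proof.
move=> eps0.
pose g (q : R) := 2 * atan ((Num.sqrt (1 + q ^+ 2) + q)^-1).
have g0 : g 0 = pi / 2.
  by rewrite /g expr0n/= !addr0 sqrtr1 invr1 atan1; lra.
have gc : {for 0, continuous g}.
  apply: cvgM; first exact: cvg_cst.
  apply: (cvg_comp _ atan); last exact: continuous_atan.
  apply: cvgV; first by rewrite expr0n/= !addr0 sqrtr1.
  apply: cvgD; last exact: cvg_id.
  apply: (cvg_comp _ Num.sqrt); last exact: sqrt_continuous.
  apply: cvgD; first exact: cvg_cst.
  by rewrite !expr2; apply: cvgM; exact: cvg_id.
move/cvgr_dist_le : gc => /(_ _ eps0) /nbhs_ballP[eta /= eta0 h].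
exists (eta / 2); first by rewrite divr_gt0.
move=> u v u0 vu.
have : `|g 0 - g (v / u)| <= eps.
  apply: h; rewrite /ball/= sub0r normrN normrM normfV (gtr0_norm u0).
  rewrite ltr_pdivrMr//; apply: (le_lt_trans vu); rewrite ltr_pM2r// ltr_pdivrMr//; lra.
rewrite distrC g0 /g.
suff -> : (Num.sqrt (1 + (v / u) ^+ 2) + v / u)^-1 = u / (Num.sqrt (u ^+ 2 + v ^+ 2) + v) by [].
have un : u != 0 by rewrite gt_eqF.
have -> : u ^+ 2 + v ^+ 2 = u ^+ 2 * (1 + (v / u) ^+ 2) by field.
rewrite sqrtrM ?sqr_ge0// sqrtr_sqr gtr0_norm//.
have -> : u * Num.sqrt (1 + (v / u) ^+ 2) + v = u * (Num.sqrt (1 + (v / u) ^+ 2) + v / u) by field.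
by rewrite invfM mulrA divff// mul1r.
Qed.

(** The curve leaves near the polar angle - pi / 2, arrives near pi / 2, and avoids
    the ray on which the angle jumps. *)
Lemma Rintegral_angle_near (eps : R) : 0 < eps -> exists2 eta : R, 0 < eta &
  forall (U V dU dV : R -> R) (a b : R), a < b ->
  (forall s, s \in `[a, b] -> is_derive s 1 U (dU s)) ->
  (forall s, s \in `[a, b] -> is_derive s 1 V (dV s)) ->
  continuous U -> continuous V -> continuous dU -> continuous dV ->
  (forall s, s \in `[a, b] -> U s = 0 -> 0 < V s) ->
  U a < 0 -> 0 < U b -> `|V a| <= eta * `|U a| -> `|V b| <= eta * `|U b| ->
  `|\int[mu]_(s in `[a, b]) ((V s * dU s - U s * dV s) / (U s ^+ 2 + V s ^+ 2)) - pi| <= 2 * eps.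
Proof.
move=> eps0; have [eta eta0 h] := half_angle_near eps0.
exists eta => // U V dU dV a b ab hU hV cU cV cdU cdV pos Ua Ub va vb.
have pos' (s : R) : s \in `[a, b] -> 0 < Num.sqrt (U s ^+ 2 + V s ^+ 2) + V s.
  move=> sI; apply: sqrt_add_gt0; have [u0|] := eqVneq (U s) 0; last by left.
  by right; exact: pos.
have qpos (s : R) : s \in `[a, b] -> U s ^+ 2 + V s ^+ 2 != 0.
  move=> sI; apply/eqP => q0; have := pos' s sI; rewrite q0 sqrtr0 add0r => v0.
  by move: q0 => /eqP; rewrite gt_eqF// ltr_wpDl ?sqr_ge0// exprn_gt0.
have ce : {within `[a, b], continuous (fun s => (V s * dU s - U s * dV s) / (U s ^+ 2 + V s ^+ 2))}.
  apply: continuous_in_subspaceT => s /set_mem sI.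
  apply: cvgM; first by apply: cvgB; apply: cvgM; [exact: cV|exact: cdU|exact: cU|exact: cdV].
  apply: cvgV; first exact: qpos.
  by rewrite !expr2; apply: cvgD; apply: cvgM; [exact: cU|exact: cU|exact: cV|exact: cV].
have dT (s : R) : s \in `[a, b] ->
    is_derive s 1 (fun s => 2 * atan (U s / (Num.sqrt (U s ^+ 2 + V s ^+ 2) + V s)))
      ((V s * dU s - U s * dV s) / (U s ^+ 2 + V s ^+ 2)).
  by move=> sI; exact: is_derive_half_angle (hU _ sI) (hV _ sI) (pos' _ sI).
have hint := integral_is_derive ab ce dT.
rewrite /Rintegral hint/=.
have h1 := h _ _ Ub; rewrite (gtr0_norm Ub) in vb; have {}h1 := h1 _ vb.
have Ua' : 0 < - U a by rewrite oppr_gt0.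
rewrite (ltr0_norm Ua) in va; have := h _ _ Ua' va.
rewrite sqrrN mulNr atanN mulrN.
move: h1; set A := 2 * atan _; set B := 2 * atan _.
rewrite !ler_norml => /andP[h1 h2] /andP[h3 h4]; apply/andP; split; lra.
Qed.

Lemma Rintegral_cst_itv (c a b : R) : a <= b -> \int[mu]_(s in `[a, b]) (cst c s) = c * (b - a).
Proof.
move=> ab; rewrite /Rintegral.
have -> : (\int[mu]_(s in `[a, b]) (cst c s)%:E = c%:E * mu `[a, b])%E.
  by rewrite (eq_integral_on (g := cst c%:E))// integral_cst//; exact: measurable_itv.
move: ab; rewrite le_eqVlt => /predU1P[->|ab].
  by rewrite lebesgue_measure_itv/= lte_fin ltxx mule0/= subrr mulr0.
by rewrite lebesgue_measure_itv/= lte_fin ab.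
Qed.

(** The point s0 is excluded because the power with a negative exponent takes the
    value 0 there. *)
Lemma singular_bound_integrable (t d s0 v c1 c2 c3 : R) (f : R -> R) :
  0 < d -> s0 \in `[t - d, t + d] -> 0 <= v -> 0 <= c1 -> 0 <= c2 -> 0 <= c3 ->
  measurable_fun `[t - d, t + d] f ->
  (forall s, s \in `[t - d, t + d] -> s != s0 ->
    `|f s| <= c1 * `|s - s0| `^ (- 2^-1) + c2 * (v / ((s - s0) ^+ 2 + v ^+ 2)) + c3) ->
  mu.-integrable `[t - d, t + d] (EFin \o f) /\
  `|\int[mu]_(s in `[t - d, t + d]) f s|
    <= c1 * (4 * (2 * d) `^ 2^-1) + c2 * pi + c3 * (2 * d).
Proof.
move=> d0 s0J v0 c10 c20 c30 mf hf.
pose J := `[t - d, t + d]%classic : set R.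
have ab : t - d < t + d by lra.
pose P (s : R) := v / ((s - s0) ^+ 2 + v ^+ 2).
have P0 s : 0 <= P s by rewrite divr_ge0// addr_ge0 ?sqr_ge0.
have [iP leP] : mu.-integrable J (EFin \o P) /\ \int[mu]_(s in J) P s <= pi.
  have [v00|vn] := eqVneq v 0.
    have -> : P = cst 0 by apply/funext => s; rewrite /P v00 mul0r.
    by split; [exact: (@integrable0 _ (measurableTypeR R) R mu J)|rewrite /Rintegral (eq_integral_on (g := cst 0%E))// integral0 pi_ge0].
  have vp : 0 < v by rewrite lt_def vn.
  split; last exact: Rintegral_poisson_le.
  apply: continuous_compact_integrable; first exact: segment_compact.
  by apply: continuous_subspaceT; exact: continuous_poisson.
have mJ : measurable J by exact: measurable_itv.
pose g (s : R) := c1 * `|s - s0| `^ (- 2^-1) + c2 * P s + c3.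
have i1 := integrableZ_fin c1 mJ (integrable_inv_sqrt d0 s0J).
have i2 := integrableZ_fin c2 mJ iP.
have i3 : mu.-integrable J (EFin \o cst c3).
  apply: continuous_compact_integrable; first exact: segment_compact.
  by apply: continuous_subspaceT => s; exact: cvg_cst.
have i12 := integrableD_fin mJ i1 i2.
have ig := integrableD_fin mJ i12 i3.
have mD : measurable (J `\ s0) by exact: measurableD.
have fg s : (J `\ s0) s -> `|f s| <= g s.
  by move=> [sJ /= /eqP sn]; exact: hf.
have mfD : measurable_fun (J `\ s0) f by apply: measurable_funS mf => // s [].
have igD : mu.-integrable (J `\ s0) (EFin \o g).
  by apply: integrableS_fin ig => // s [].
have ifD := le_integrable_fin mD mfD fg igD.
have ifJ : mu.-integrable J (EFin \o f).
  apply/(@negligible_integrable _ (measurableTypeR R) R mu J [set s0]) => //.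
  - exact/measurable_EFinP.
  - exact: lebesgue_measure_set1.
split => //.
have -> : \int[mu]_(s in J) f s = \int[mu]_(s in J `\ s0) f s.
  by rewrite /Rintegral -(@integral_setD1 R (EFin \o f) s0 J)//; exact/measurable_EFinP.
apply: (le_trans (@le_normr_Rintegral _ (measurableTypeR R) R mu _ _ mD ifD)).
have infD : mu.-integrable (J `\ s0) (EFin \o (fun s => `|f s|)).
  exact: (@integrable_abse _ (measurableTypeR R) R mu _ _ ifD).
apply: (le_trans (@le_Rintegral _ (measurableTypeR R) R mu _ _ g mD infD igD fg)).
have -> : \int[mu]_(s in J `\ s0) g s = \int[mu]_(s in J) g s.
  rewrite /Rintegral -(@integral_setD1 R (EFin \o g) s0 J)//.
  by apply/measurable_EFinP; case/integrableP : igD => /measurable_EFinP.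
rewrite /g (@RintegralD _ (measurableTypeR R) R mu J _ _ mJ i12 i3).
rewrite (@RintegralD _ (measurableTypeR R) R mu J _ _ mJ i1 i2).
rewrite (@RintegralZl _ (measurableTypeR R) R mu J _ _ mJ (integrable_inv_sqrt d0 s0J)).
rewrite (@RintegralZl _ (measurableTypeR R) R mu J _ _ mJ iP).
apply: lerD; last by rewrite Rintegral_cst_itv// ; lra.
by apply: lerD; rewrite ler_wpM2l//; exact: Rintegral_inv_sqrt_le.
Qed.
End angle_integral.

(** * The integral of the angle density over a short arc *)

Section jump_geometry.
Variable R : realType.
Notation mu := (@lebesgue_measure R).

Lemma RintegralZ_fin (D : set R) (k : R) (f : R -> R) : measurable D ->
  mu.-integrable D (EFin \o f) -> \int[mu]_(s in D) (k * f s) = k * \int[mu]_(s in D) f s.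
Proof. by move=> mD hf; exact: (@RintegralZl _ (measurableTypeR R) R mu D f k mD hf). Qed.

Lemma RintegralD_fin (D : set R) (f g : R -> R) : measurable D ->
  mu.-integrable D (EFin \o f) -> mu.-integrable D (EFin \o g) ->
  \int[mu]_(s in D) (f s + g s) = \int[mu]_(s in D) f s + \int[mu]_(s in D) g s.
Proof. by move=> mD hf hg; exact: (@RintegralD _ (measurableTypeR R) R mu D f g mD hf hg). Qed.

Lemma RintegralB_fin (D : set R) (f g : R -> R) : measurable D ->
  mu.-integrable D (EFin \o f) -> mu.-integrable D (EFin \o g) ->
  \int[mu]_(s in D) (f s - g s) = \int[mu]_(s in D) f s - \int[mu]_(s in D) g s.
Proof. by move=> mD hf hg; exact: (@RintegralB _ (measurableTypeR R) R mu D f g mD hf hg). Qed.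

Lemma Rintegral_split (D E : set R) (f : R -> R) : measurable D -> measurable E ->
  E `<=` D -> mu.-integrable D (EFin \o f) ->
  \int[mu]_(s in D) f s = \int[mu]_(s in E) f s + \int[mu]_(s in D `\` E) f s.
Proof.
move=> mD mE ED iD; have e : E `|` (D `\` E) = D by exact: setDUK.
have dis : [disjoint E & D `\` E].
  by apply/disj_setPS => s [Es [_ nE]].
have := @Rintegral_setU _ (measurableTypeR R) R mu E (D `\` E) f mE (measurableD mD mE).
by rewrite e => /(_ iD dis).
Qed.

Lemma norm_Rintegral_subset_le (l c : R) (D : set R) (f : R -> R) : measurable D -> D `<=` `[0, l] ->
  0 <= l -> 0 <= c -> measurable_fun D f -> (forall s, D s -> `|f s| <= c) ->
  mu.-integrable D (EFin \o f) /\ `|\int[mu]_(s in D) f s| <= c * l.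
Proof.
move=> mD Dl l0 c0 mf fc.
have iE : mu.-integrable `[0, l] (EFin \o cst c).
  apply: continuous_compact_integrable; first exact: segment_compact.
  by apply: continuous_subspaceT => s; exact: cvg_cst.
have mE : measurable (`[0, l]%classic : set R) by exact: measurable_itv.
have mED : measurable (`[0, l] `\` D) by exact: measurableD.
have iD := integrableS_fin mD mE Dl iE.
have iC : mu.-integrable (`[0, l] `\` D) (EFin \o cst c) by apply: integrableS_fin iE => // s [].
have ifD := le_integrable_fin mD mf fc iD; split => //.
have infD : mu.-integrable D (EFin \o (fun s => `|f s|)).
  exact: (@integrable_abse _ (measurableTypeR R) R mu _ _ ifD).
apply: (le_trans (@le_normr_Rintegral _ (measurableTypeR R) R mu _ _ mD ifD)).
apply: (le_trans (@le_Rintegral _ (measurableTypeR R) R mu _ _ (cst c) mD infD iD fc)).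
have := Rintegral_cst_itv c l0; rewrite subr0 => <-.
rewrite (Rintegral_split mE mD Dl iE) lerDl.
by apply: Rintegral_ge0 => s _.
Qed.

Section with_arc.
Variables (x y dx dy : R -> R) (t d L : R).
Hypothesis arc : local_arc x y dx dy t d L.
Variable p : R * R.
Hypothesis near1 : `|x t - p.1| <= L * d ^+ 2.
Hypothesis near2 : `|y t - p.2| <= L * d ^+ 2.
Notation U := (tan_coord x y dx dy t p).
Notation V := (nor_coord x y dx dy t p).
Notation dU := (tan_speed dx dy t).
Notation dV := (nor_speed dx dy t).
Notation J := (`[t - d, t + d]).

Lemma endpoint_in : t - d \in J /\ t + d \in J.
Proof. by have d0 := la_d arc; rewrite !in_itv/= !lexx/= andbT; lra. Qed.

(** At the ends of the arc U dominates while V is quadratic in d, so that from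
    there p is seen almost along the tangent. *)
Lemma tan_coord_endpoints : U (t - d) <= - (d / 2) /\ d / 2 <= U (t + d).
Proof.
have d0 := la_d arc; have L0 := la_L arc; have Ld := la_small arc.
have [e1 e2] := endpoint_in; have ct := center_in arc.
have h1 : `|U t| <= d / 4.
  rewrite /tan_coord; have [a1 b1] := unit_coord_le arc.
  apply: (le_trans (norm_comb_le _ _ a1 b1)).
  apply: (le_trans (lerD near1 near2)).
  have : L * d * d <= 8^-1 * d by rewrite ler_wpM2r// ltW.
  by rewrite expr2 mulrA => h; lra.
have h2 := tan_coord_mono arc p ct e1; have h3 := tan_coord_mono arc p e2 ct.
move: h1; rewrite ler_norml => /andP[h1 h1'].
have h2' : 3 / 4 * (t - (t - d)) <= U t - U (t - d) by apply: h2; lra.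
have h3' : 3 / 4 * (t + d - t) <= U (t + d) - U t by apply: h3; lra.
by split; lra.
Qed.

Lemma nor_coord_endpoint s : s \in J -> `|V s| <= 4 * L * d ^+ 2.
Proof.
move=> sJ; have d0 := la_d arc; have L0 := la_L arc; have ct := center_in arc.
have h1 : `|V t| <= 2 * L * d ^+ 2.
  rewrite /nor_coord -mulNr; have [a1 b1] := unit_coord_le arc.
  have a1' : `|- dx t| <= 1 by rewrite normrN.
  apply: (le_trans (norm_comb_le _ _ b1 a1')).
  by apply: (le_trans (lerD near1 near2)); lra.
have h2 := nor_coord_taylor arc p ct sJ; rewrite nor_speed_center mul0r subr0 in h2.
have h3 : 2 * L * `|t - s| ^+ 2 <= 2 * L * d ^+ 2.
  rewrite ler_wpM2l//; first by rewrite mulr_ge0// ltW.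
  by rewrite lerXn2r// ?nnegrE ?(ltW d0)// distrC; exact: (dist_center sJ).
have -> : V s = V t - (V t - V s) by ring.
by apply: (le_trans (ler_normB _ _)); lra.
Qed.

Lemma foot_exists : exists2 s0, s0 \in J & U s0 = 0.
Proof.
have d0 := la_d arc; have [h1 h2] := tan_coord_endpoints.
have ab : t - d <= t + d by lra.
have cU : {within `[t - d, t + d], continuous U}.
  by apply: derivable_within_continuous => s sJ; have hd := is_derive_tan_coord arc p sJ; exact: ex_derive.
apply: (IVT ab cU); rewrite ge_min le_max; apply/andP; split; apply/orP; [left|right]; lra.
Qed.

Lemma foot_unique s0 s : s0 \in J -> U s0 = 0 -> s \in J -> U s = 0 -> s = s0.
Proof.
move=> s0J U0 sJ Us; have := tan_coord_foot arc s0J U0 sJ; rewrite Us normr0 => h.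
have : `|s - s0| <= 0 by lra.
by rewrite normr_le0 subr_eq0 => /eqP.
Qed.

Lemma angle_densityE s : angle_density x y dx dy p s = (V s * dU s - U s * dV s) / (U s ^+ 2 + V s ^+ 2).
Proof. by rewrite /angle_density (angle_numE arc) (sqdistE arc). Qed.

Lemma continuous_tan_nor : [/\ continuous U, continuous V, continuous dU & continuous dV].
Proof.
have [cx cy cdx cdy] := la_cont arc.
split=> s.
- apply: cvgD; (apply: cvgM; first exact: cvg_cst); apply: cvgB; [exact: cx|exact: cvg_cst|exact: cy|exact: cvg_cst].
- apply: cvgB; (apply: cvgM; first exact: cvg_cst); apply: cvgB; [exact: cx|exact: cvg_cst|exact: cy|exact: cvg_cst].
- by apply: cvgD; (apply: cvgM; first exact: cvg_cst); [exact: cdx|exact: cdy].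
- by apply: cvgB; (apply: cvgM; first exact: cvg_cst); [exact: cdx|exact: cdy].
Qed.

Lemma integrable_angle_density : (forall s, s \in J -> 0 < sqdist x y p s) ->
  mu.-integrable `[t - d, t + d] (EFin \o angle_density x y dx dy p).
Proof.
move=> pos; apply: continuous_compact_integrable; first exact: segment_compact.
apply: continuous_in_subspaceT => s /set_mem sJ.
have [cx cy cdx cdy] := la_cont arc.
have cX : {for s, continuous (fun s => x s - p.1)} by apply: cvgB; [exact: cx|exact: cvg_cst].
have cY : {for s, continuous (fun s => y s - p.2)} by apply: cvgB; [exact: cy|exact: cvg_cst].
apply: cvgM; first by apply: cvgB; apply: cvgM; [exact: cX|exact: cdy|exact: cY|exact: cdx].
apply: cvgV; first by rewrite gt_eqF//; exact: pos.
by rewrite /sqdist !expr2; apply: cvgD; apply: cvgM; [exact: cX|exact: cX|exact: cY|exact: cY].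
Qed.

Lemma sqdist_gt0 s0 : s0 \in J -> U s0 = 0 -> V s0 != 0 ->
  forall s, s \in J -> 0 < sqdist x y p s.
Proof.
move=> s0J foot v0 s sJ; apply: lt_le_trans (sqdist_lower arc s0J foot sJ).
by rewrite divr_gt0// ltr_wpDl ?sqr_ge0// exprn_even_gt0.
Qed.

End with_arc.

(** For negative v0 the arc is reflected by V -> - V, which changes the sign of the
    angle. *)
Lemma Rintegral_angle_density (eps : R) : 0 < eps -> exists2 eta : R, 0 < eta &
  forall (x y dx dy : R -> R) (t d L s0 : R) (p : R * R), local_arc x y dx dy t d L ->
    8 * L * d <= eta ->
    `|x t - p.1| <= L * d ^+ 2 -> `|y t - p.2| <= L * d ^+ 2 ->
    s0 \in `[t - d, t + d] -> tan_coord x y dx dy t p s0 = 0 ->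
    nor_coord x y dx dy t p s0 != 0 ->
    `|\int[mu]_(s in `[t - d, t + d]) angle_density x y dx dy p s
      - Num.sg (nor_coord x y dx dy t p s0) * pi| <= 2 * eps.
Proof.
move=> eps0; have [eta eta0 h] := Rintegral_angle_near eps0.
exists eta => // x y dx dy t d L s0 p arc Ld n1 n2 s0J foot v0.
have d0 := la_d arc; have L0 := la_L arc.
have ab : t - d < t + d by lra.
have [cU cV cdU cdV] := continuous_tan_nor arc p.
have [hUa hUb] := tan_coord_endpoints arc n1 n2.
have [aJ bJ] := endpoint_in arc.
have hVa := nor_coord_endpoint arc n1 n2 aJ.
have hVb := nor_coord_endpoint arc n1 n2 bJ.
have dU s := is_derive_tan_coord arc p (s := s).
have dV s := is_derive_nor_coord arc p (s := s).
have uniq := foot_unique arc s0J foot.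
have Ua : tan_coord x y dx dy t p (t - d) < 0 by lra.
have Ub : 0 < tan_coord x y dx dy t p (t + d) by lra.
have small (u v : R) : d / 2 <= `|u| -> `|v| <= 4 * L * d ^+ 2 -> `|v| <= eta * `|u|.
  move=> hu hv; apply: (le_trans hv); apply: (@le_trans _ _ (8 * L * d * (d / 2))).
    by rewrite expr2; lra.
  by apply: ler_pM => //; rewrite ?mulr_ge0// ?ltW.
have na : d / 2 <= `|tan_coord x y dx dy t p (t - d)| by rewrite ltr0_norm//; lra.
have nb : d / 2 <= `|tan_coord x y dx dy t p (t + d)| by rewrite gtr0_norm//; lra.
have iA := integrable_angle_density arc (sqdist_gt0 arc s0J foot v0).
have [v0'|v0'|v0'] := ltgtP 0 (nor_coord x y dx dy t p s0); last by rewrite -v0' eqxx in v0.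
  rewrite (gtr0_sg v0') mul1r.
  rewrite (eq_Rintegral_on (g := fun s => (nor_coord x y dx dy t p s * tan_speed dx dy t s
     - tan_coord x y dx dy t p s * nor_speed dx dy t s) /
     (tan_coord x y dx dy t p s ^+ 2 + nor_coord x y dx dy t p s ^+ 2))); last first.
    by move=> s _; exact: (angle_densityE arc).
  apply: (h _ _ _ _ _ _ ab dU dV cU cV cdU cdV _ Ua Ub (small _ _ na hVa) (small _ _ nb hVb)).
  by move=> s sJ Us; rewrite (uniq s).
rewrite (ltr0_sg v0') mulN1r opprK.
have hN : (forall s, s \in `[t - d, t + d] ->
    is_derive s 1 (fun s => - nor_coord x y dx dy t p s) (- nor_speed dx dy t s)).
  by move=> s sJ; exact: is_deriveN (dV _ sJ).
have cN (f : R -> R) : continuous f -> continuous (fun s => - f s).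
  by move=> cf s; apply: cvgN; exact: cf.
have := h _ (fun s => - nor_coord x y dx dy t p s) _ (fun s => - nor_speed dx dy t s) _ _ ab dU hN cU (cN _ cV) cdU (cN _ cdV).
have pos s : s \in `[t - d, t + d] -> tan_coord x y dx dy t p s = 0 -> 0 < - nor_coord x y dx dy t p s.
  by move=> sJ Us; rewrite (uniq s)// oppr_gt0.
have sa : `|- nor_coord x y dx dy t p (t - d)| <= eta * `|tan_coord x y dx dy t p (t - d)|.
  by rewrite normrN; exact: small.
have sb : `|- nor_coord x y dx dy t p (t + d)| <= eta * `|tan_coord x y dx dy t p (t + d)|.
  by rewrite normrN; exact: small.
move=> /(_ pos Ua Ub sa sb).
have -> : \int[mu]_(s in `[t - d, t + d]) ((- nor_coord x y dx dy t p s * tan_speed dx dy t s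
     - tan_coord x y dx dy t p s * - nor_speed dx dy t s) /
     (tan_coord x y dx dy t p s ^+ 2 + (- nor_coord x y dx dy t p s) ^+ 2))
   = - \int[mu]_(s in `[t - d, t + d]) angle_density x y dx dy p s.
  transitivity (-1 * \int[mu]_(s in `[t - d, t + d]) angle_density x y dx dy p s); last by rewrite mulN1r.
  rewrite -(RintegralZ_fin _ (measurable_itv _) iA).
  apply: eq_Rintegral_on => s _; rewrite (angle_densityE arc) sqrrN mulrA; congr (_ / _); ring.
by rewrite -opprB opprK normrN addrC.
Qed.
End jump_geometry.

(** * The jump of a potential whose kernel resembles the angle density *)

Section abstract_jump.
Variable R : realType.
Notation mu := (@lebesgue_measure R).
Variables (x y dx dy m : R -> R) (N : R -> R * R -> R) (l t L D : R).
Notation kap := (angle_density x y dx dy).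
Notation P := (x t, y t).
Hypothesis l0 : 0 <= l.
Hypothesis tD : forall s, s \in `[t - D, t + D] -> s \in `[0, l].
Hypothesis D0 : 0 < D.
Hypothesis arcs : forall d, 0 < d -> d <= D -> local_arc x y dx dy t d L.
Hypothesis cm : continuous m.
Hypothesis P_in : quadrant P.
Hypothesis simple : forall s, s \in `[0, l] -> s != t -> 0 < sqdist x y P s.
Hypothesis Ncont : forall (T : Type) (F : set_system T) (u : T -> R) (q : T -> R * R) (s : R) (p : R * R),
  Filter F -> quadrant p -> 0 < sqdist x y p s -> u z @[z --> F] --> s ->
  (q z).1 @[z --> F] --> p.1 -> (q z).2 @[z --> F] --> p.2 ->
  N (u z) (q z) @[z --> F] --> N s p.
Hypothesis Nest : forall eps, 0 < eps -> exists C delta : R, [/\ 0 <= C, 0 < delta &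
  forall s p, `|s - t| <= delta -> `|x t - p.1| <= delta -> `|y t - p.2| <= delta ->
    0 < sqdist x y p s ->
    `|N s p + kap p s / (2 * pi)| <= C * sqdist x y p s `^ (- 4^-1) + eps * `|kap p s|].

Lemma kernel_continuous s p : quadrant p -> 0 < sqdist x y p s -> {for s, continuous (N ^~ p)}.
Proof.
move=> hp hs; apply: (Ncont (u := id) (q := fun=> p)) => //; exact: cvg_cst.
Qed.

Lemma integrable_off_curve (A : set R) p : compact A -> quadrant p ->
  (forall s, A s -> 0 < sqdist x y p s) ->
  mu.-integrable A (EFin \o (fun s => m s * N s p)).
Proof.
move=> cA hp pos; apply: continuous_compact_integrable => //.
apply: continuous_in_subspaceT => s /set_mem sA.
by apply: cvgM; [exact: cm|exact: kernel_continuous (pos _ sA)].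
Qed.

Definition far_part (d : R) : set R := `[0, t - d] `|` `[t + d, l].

Lemma compact_far_part d : compact (far_part d).
Proof. by apply: compactU; exact: segment_compact. Qed.

Lemma far_partP d s : 0 < d -> d <= D -> far_part d s -> s \in `[0, l] /\ s != t.
Proof.
move=> d0 dD.
have [h1 h2] : 0 <= t - d /\ t + d <= l.
  have a1 : t - d \in `[t - D, t + D] by rewrite in_itv/=; apply/andP; split; lra.
  have a2 : t + d \in `[t - D, t + D] by rewrite in_itv/=; apply/andP; split; lra.
  by move: (tD a1) (tD a2); rewrite !in_itv/= => /andP[? _] /andP[].
case=> /=; rewrite !in_itv/= => /andP[h3 h4]; split; try (apply/andP; split; lra).
  by rewrite lt_eqF//; lra.
by rewrite gt_eqF//; lra.
Qed.

Lemma far_diff d : 0 < d -> `[0, l] `\` `[t - d, t + d] `<=` far_part d.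
Proof.
move=> d0 s [] /=; rewrite !in_itv/= => /andP[h1 h2] /negP; rewrite negb_and -!ltNge.
by case/orP => h; [left|right]; rewrite /= in_itv/=; apply/andP; split; lra.
Qed.

(** Away from t the kernel is jointly continuous, and a compactness argument makes
    its convergence uniform in the integration variable. *)
Lemma kernel_far_near d eps : 0 < d -> d <= D -> 0 < eps ->
  \forall p \near P, forall s, far_part d s -> `|N s p - N s P| <= eps.
Proof.
move=> d0 dD eps0.
have /compact_near_coveringP h := @compact_far_part d.
apply: (h _ (nbhs P) (fun p s => `|N s p - N s P| <= eps)) => s sF.
have [sl st] := far_partP d0 dD sF.
have pos := simple sl st.
have c1 : (fun z : R * (R * R) => z.2.1) @ filter_prod (nbhs s) (nbhs P) --> P.1.
  exact: (@cvg_comp _ _ _ (@snd R (R * R)) (@fst R R) _ (nbhs P) _ cvg_snd cvg_fst).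
have c2 : (fun z : R * (R * R) => z.2.2) @ filter_prod (nbhs s) (nbhs P) --> P.2.
  exact: (@cvg_comp _ _ _ (@snd R (R * R)) (@snd R R) _ (nbhs P) _ cvg_snd cvg_snd).
have FF : Filter (filter_prod (nbhs s) (nbhs P)) by exact: filter_prod_filter.
have h1 : N z.1 z.2 @[z --> filter_prod (nbhs s) (nbhs P)] --> N s P.
  by apply: (Ncont (u := fst) (q := snd)) => //; exact: cvg_fst.
have h2 : N z.1 P @[z --> filter_prod (nbhs s) (nbhs P)] --> N s P.
  by apply: (Ncont (u := fst) (q := fun z => P)) => //; [exact: cvg_fst|exact: cvg_cst|exact: cvg_cst].
have := @cvgB _ _ _ _ FF _ _ _ _ h1 h2; rewrite subrr => /cvgr_dist_le /(_ _ eps0).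
by apply: filterS => -[q p] /=; rewrite sub0r normrN.
Qed.

Lemma integrable_direct_value d : 0 < d -> d <= D ->
  mu.-integrable (far_part d) (EFin \o (fun s => m s * N s P)).
Proof.
move=> d0 dD; apply: integrable_off_curve => //; first exact: compact_far_part.
by move=> s sF; have [sl st] := far_partP d0 dD sF; exact: simple.
Qed.

Lemma density_bounded : exists2 B, 1 <= B & forall s, s \in `[0, l] -> `|m s| <= B.
Proof.
have cm' : {within `[0, l], continuous (fun s => `|m s|)}.
  by apply: continuous_subspaceT => s; apply: cvg_norm; exact: cm.
have [c _ hc] := EVT_max l0 cm'.
exists (1 + `|m c|); first by rewrite lerDl.
by move=> s sI; apply: (le_trans (hc _ sI)); rewrite lerDr.
Qed.

Lemma square_root_small e : 0 < e -> exists2 d1 : R, 0 < d1 &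
  forall d, 0 < d -> d <= d1 -> (2 * d) `^ 2^-1 <= e.
Proof.
move=> e0; exists (e ^+ 2 / 2); first by rewrite divr_gt0// exprn_gt0.
move=> d d0 hd.
have -> : e = (e ^+ 2) `^ 2^-1 by rewrite -powR_mulrn ?(ltW e0)// -powRrM mulfV// powRr1// ltW.
apply: ge0_ler_powR; rewrite ?nnegrE ?invr_ge0 ?sqr_ge0//; lra.
Qed.

(** The five integrals are those of m N p, of the angle density and of m N P over
    the short arc, and those of m N p and m N P over the rest. *)
Lemma jump_sum_le (A I1 I2 I3 I4 I5 sg q B e a1 a2 a4 : R) : 2 <= q -> `|A| <= B ->
  `|I1 + A / (2 * q) * I2| <= a1 -> `|I3| <= a2 -> `|I2 - sg * q| <= 2 * e ->
  `|I4 - I5| <= a4 -> `|I1 + I4 - (I3 + I5) + sg / 2 * A| <= a1 + a2 + a4 + B * e.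
Proof.
move=> q2 AB b1 b2 b3 b4; have q0 : 0 < q by exact: lt_le_trans q2.
have e0 : 0 <= e by have := normr_ge0 (I2 - sg * q) => h; lra.
have -> : I1 + I4 - (I3 + I5) + sg / 2 * A =
   (I1 + A / (2 * q) * I2) - I3 + (I4 - I5) - A * ((I2 - sg * q) / (2 * q)).
  by field; rewrite gt_eqF.
apply: (le_trans (ler_normB _ _)); apply: lerD.
  apply: (le_trans (ler_normD _ _)); apply: lerD => //.
  by apply: (le_trans (ler_normB _ _)); exact: lerD.
rewrite normrM; apply: ler_pM => //; rewrite normrM normfV (@gtr0_norm _ (2 * q)) ?mulr_gt0//.
rewrite ler_pdivrMr ?mulr_gt0//; apply: (le_trans b3).
have : 0 <= e * (q - 1) by apply: mulr_ge0 => //; lra.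
by move=> h; lra.
Qed.

Lemma error_budget (B C r q e d M len eps : R) :
  16 * B * C * r <= eps / 3 -> 192 * B * M * d <= eps / 3 ->
  B * e * (32 * q + 25 + len) <= eps / 3 ->
  B * e * (M * d) <= B * e * 8^-1 -> B * M * d * e <= B * M * d * 1 ->
  2 * B * C * (4 * r) + 32 * B * e * q + 96 * B * e * M * (2 * d)
    + (2 * B * C * (4 * r) + 48 * B * (1 + e) * M * (2 * d))
    + B * e * len + B * e <= eps.
Proof. by move=> *; lra. Qed.

Section near_part.
Variables (d B C e1 : R).
Hypotheses (d0 : 0 < d) (dD : d <= D) (B1 : 1 <= B) (C0 : 0 <= C) (e10 : 0 < e1).
Hypothesis mB : forall s, s \in `[0, l] -> `|m s| <= B.
Hypothesis mosc : forall s, s \in `[t - d, t + d] -> `|m s - m t| <= e1.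
Let J := `[t - d, t + d]%classic : set R.

Lemma near_in s : s \in `[t - d, t + d] -> s \in `[0, l].
Proof.
move: d0 dD => ? ?; rewrite !in_itv/= => /andP[h1 h2]; have : s \in `[0, l].
  by apply: tD; rewrite in_itv/=; apply/andP; split; lra.
by rewrite in_itv.
Qed.

(** Near t the kernel is the angle density up to the factor - 1 / (2 pi), an
    integrable singularity and a small multiple of the density itself; replacing
    m s by m t costs another small multiple. *)
Lemma near_part_le p s0 :
  (forall s, s \in `[t - d, t + d] -> 0 < sqdist x y p s ->
    `|N s p + kap p s / (2 * pi)| <= C * sqdist x y p s `^ (- 4^-1) + e1 * `|kap p s|) ->
  s0 \in `[t - d, t + d] -> tan_coord x y dx dy t p s0 = 0 ->
  nor_coord x y dx dy t p s0 != 0 -> quadrant p ->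
  `|\int[mu]_(s in J) (m s * N s p) + m t / (2 * pi) * \int[mu]_(s in J) kap p s|
   <= 2 * B * C * (4 * (2 * d) `^ 2^-1) + 32 * B * e1 * pi + 96 * B * e1 * L * (2 * d).
Proof.
move=> hN s0J foot v0 hp.
have arc := arcs d0 dD; have L0 := la_L arc.
have pos := sqdist_gt0 arc s0J foot v0.
have mJ : measurable J by exact: measurable_itv.
have iK := integrable_angle_density arc pos.
have iN : mu.-integrable J (EFin \o (fun s => m s * N s p)).
  by apply: integrable_off_curve => //; exact: segment_compact.
have iK' := integrableZ_fin (m t / (2 * pi)) mJ iK.
rewrite -(RintegralZ_fin _ mJ iK) -(RintegralD_fin mJ iN iK').
have iS := integrableD_fin mJ iN iK'.
have mf := measurable_int _ iS; move/measurable_EFinP in mf.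
have B0 : 0 <= B by exact: le_trans ler01 B1.
have Be : 0 <= B * e1 by rewrite mulr_ge0// ltW.
have pi0 := @pi_gt0 R.
have := @singular_bound_integrable R t d s0 `|nor_coord x y dx dy t p s0| (2 * B * C) (32 * B * e1)
  (96 * B * e1 * L) _ d0 s0J (normr_ge0 _) _ _ _ mf.
case=> [||||_ h].
- by rewrite mulr_ge0// mulr_ge0.
- by rewrite -mulrA mulr_ge0.
- by rewrite mulr_ge0 ?(ltW L0)// -mulrA mulr_ge0.
- move=> s sJ ss.
  have k := angle_density_le arc s0J foot sJ.
  have r := sqdist_inv_root arc s0J foot sJ ss.
  have n := hN s sJ (pos s sJ).
  have mt : `|m s| <= B by apply: mB; exact: near_in.
  have o := mosc sJ.
  have -> : m s * N s p + m t / (2 * pi) * kap p s =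
     m s * (N s p + kap p s / (2 * pi)) - (m s - m t) * (kap p s / (2 * pi)) by ring.
  apply: (le_trans (ler_normB _ _)).
  rewrite (normrM (m s)) (normrM (m s - m t)) (normrM (kap p s)).
  have k2 : `|kap p s| * `|(2 * pi)^-1| <= `|kap p s|.
    rewrite ler_piMr// normfV gtr0_norm ?mulr_gt0// invf_le1 ?mulr_gt0//.
    by have := @pi_ge2 R; lra.
  have a1 : `|m s| * `|N s p + kap p s / (2 * pi)| <= B * (C * (2 * `|s - s0| `^ (- 2^-1)) + e1 * `|kap p s|).
    apply: ler_pM => //; apply: (le_trans n); rewrite lerD2r; exact: ler_wpM2l.
  have a2 : `|m s - m t| * (`|kap p s| * `|(2 * pi)^-1|) <= B * (e1 * `|kap p s|).
    apply: (@le_trans _ _ (e1 * `|kap p s|)); first by apply: ler_pM => //; rewrite mulr_ge0.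
    by rewrite ler_peMl// mulr_ge0// ltW.
  apply: (le_trans (lerD a1 a2)).
  have a3 : B * e1 * `|kap p s| <= B * e1 *
     (16 * (`|nor_coord x y dx dy t p s0| / ((s - s0) ^+ 2 + `|nor_coord x y dx dy t p s0| ^+ 2)) + 48 * L).
    exact: ler_wpM2l.
  by move: a3; set W := _ / (_ + _); move=> a3; lra.
exact: h.
Qed.

(** Seen from a point of the arc itself, the angle density is bounded. *)
Lemma near_part_direct_le :
  (forall s, s \in `[t - d, t + d] -> 0 < sqdist x y P s ->
    `|N s P + kap P s / (2 * pi)| <= C * sqdist x y P s `^ (- 4^-1) + e1 * `|kap P s|) ->
  mu.-integrable J (EFin \o (fun s => m s * N s P)) /\
  `|\int[mu]_(s in J) (m s * N s P)|
   <= 2 * B * C * (4 * (2 * d) `^ 2^-1) + 48 * B * (1 + e1) * L * (2 * d).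
Proof.
move=> hN.
have arc := arcs d0 dD; have L0 := la_L arc; have ct := center_in arc.
have foot : tan_coord x y dx dy t P t = 0 by rewrite /tan_coord/= !subrr !mulr0 addr0.
have v0 : nor_coord x y dx dy t P t = 0 by rewrite /nor_coord/= !subrr !mulr0 subr0.
have mJ : measurable J by exact: measurable_itv.
have B0 : 0 <= B by exact: le_trans ler01 B1.
have e11 : 0 <= 1 + e1 by rewrite addr_ge0// ltW.
have Be : 0 <= B * (1 + e1) by rewrite mulr_ge0.
have pi0 := @pi_gt0 R.
have mf : measurable_fun J (fun s => m s * N s P).
  rewrite (_ : J = [set t] `|` (J `\ t)); last by rewrite setD1K//; exact: mem_set.
  apply/measurable_funU => //; first exact: measurableD.
  split; first exact: measurable_fun_set1.
  apply: subspace_continuous_measurable_fun; first exact: measurableD.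
  apply: continuous_in_subspaceT => s /set_mem [sJ /eqP st].
  by apply: cvgM; [exact: cm|exact: kernel_continuous (simple (near_in sJ) st)].
have := @singular_bound_integrable R t d t 0 (2 * B * C) 0
  (48 * B * (1 + e1) * L) _ d0 ct (lexx _) _ (lexx _) _ mf.
rewrite mul0r addr0; apply.
- by rewrite mulr_ge0// mulr_ge0.
- by rewrite mulr_ge0 ?(ltW L0)// -mulrA mulr_ge0.
- move=> s sJ ss.
  have k := angle_density_le arc ct foot sJ; rewrite v0 normr0 mul0r mulr0 add0r in k.
  have r := sqdist_inv_root arc ct foot sJ ss.
  have n := hN s sJ (simple (near_in sJ) ss).
  have mt : `|m s| <= B by apply: mB; exact: near_in.
  rewrite mul0r addr0 normrM.
  have k2 : `|kap P s / (2 * pi)| <= `|kap P s|.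
    rewrite normrM ler_piMr// normfV gtr0_norm ?mulr_gt0// invf_le1 ?mulr_gt0//.
    by have := @pi_ge2 R; lra.
  have n2 : `|N s P| <= C * (2 * `|s - t| `^ (- 2^-1)) + (1 + e1) * (48 * L).
    have -> : N s P = (N s P + kap P s / (2 * pi)) - kap P s / (2 * pi) by ring.
    apply: (le_trans (ler_normB _ _)); apply: (le_trans (lerD n k2)).
    have a1 : C * sqdist x y P s `^ (- 4^-1) <= C * (2 * `|s - t| `^ (- 2^-1)) by exact: ler_wpM2l.
    have a2 : (1 + e1) * `|kap P s| <= (1 + e1) * (48 * L) by exact: ler_wpM2l.
    by lra.
  have : `|m s| * `|N s P| <= B * (C * (2 * `|s - t| `^ (- 2^-1)) + (1 + e1) * (48 * L)).
    exact: ler_pM.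
  by move=> h; lra.
Qed.
End near_part.

Lemma density_osc e : 0 < e -> exists2 d2, 0 < d2 &
  forall d s, d <= d2 -> s \in `[t - d, t + d] -> `|m s - m t| <= e.
Proof.
move=> e0; have cmt : m s @[s --> t] --> m t by exact: cm.
move/cvgr_dist_le : cmt => /(_ _ e0) /nbhs_ballP[d2 /= d20 h].
exists (d2 / 2); first by rewrite divr_gt0.
move=> d s hd; rewrite in_itv/= => /andP[s1 s2]; rewrite distrC; apply: h.
by rewrite /ball/= ltr_norml; apply/andP; split; lra.
Qed.

Lemma near_subset d : 0 < d -> d <= D -> `[t - d, t + d] `<=` `[0, l].
Proof. by move=> d0 dD s; exact: near_in. Qed.

Lemma measurable_far_diff d : measurable (`[0, l] `\` `[t - d, t + d] : set R).
Proof. by apply: measurableD; exact: measurable_itv. Qed.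

Lemma measurable_far_part d : measurable (far_part d).
Proof. by apply: measurableU; exact: measurable_itv. Qed.

Lemma direct_value_integrable : mu.-integrable `[0, l] (EFin \o (fun s => m s * N s P)).
Proof.
have [B B1 mB] := density_bounded.
have [C [delta [C0 delta0 est]]] := Nest ltr01.
have [d2 d20 osc] := density_osc ltr01.
pose d := Num.min D (Num.min delta d2).
have d0 : 0 < d by rewrite !lt_min D0 delta0 d20.
have dD : d <= D by rewrite ge_min lexx.
have ddelta : d <= delta by rewrite !ge_min lexx orbT.
have dd2 : d <= d2 by rewrite !ge_min lexx !orbT.
have hN s : s \in `[t - d, t + d] -> 0 < sqdist x y P s ->
    `|N s P + kap P s / (2 * pi)| <= C * sqdist x y P s `^ (- 4^-1) + 1 * `|kap P s|.
  move=> sJ pos; apply: est => //; rewrite ?subrr ?normr0 ?(ltW delta0)//.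
  by apply: le_trans ddelta; exact: (dist_center sJ).
have [iJ _] := near_part_direct_le d0 dD B1 C0 ltr01 mB hN.
have iF := integrable_direct_value d0 dD.
have iF' := integrableS_fin (measurable_far_diff d) (measurable_far_part d) (@far_diff d d0) iF.
rewrite -(setDUK (near_subset d0 dD)); apply: integrable_setU => //.
exact: measurable_far_diff.
Qed.

(** The value of the potential near P is the direct value up to half the density,
    with the sign opposite to that of the normal coordinate at the foot point. *)
Lemma jump_near eps d0 : 0 < eps -> 0 < d0 -> exists d : R, [/\ 0 < d, d <= d0, d <= D &
  \forall p \near P, quadrant p -> (forall s, s \in `[0, l] -> 0 < sqdist x y p s) ->
    exists s0 : R, [/\ s0 \in `[t - d, t + d], tan_coord x y dx dy t p s0 = 0,
      nor_coord x y dx dy t p s0 != 0 &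
      `|\int[mu]_(s in `[0, l]) (m s * N s p) - \int[mu]_(s in `[0, l]) (m s * N s P)
        + Num.sg (nor_coord x y dx dy t p s0) / 2 * m t| <= eps]].
Proof.
move=> eps0 d00.
have [B B1 mB] := density_bounded.
have B0 : 0 < B by exact: lt_le_trans ltr01 B1.
have L0 : 0 < L by have := la_L (arcs D0 (lexx D)).
have pi0 := @pi_gt0 R; have pi2 := @pi_ge2 R.
(* The errors add up to at most B e1 K + 16 B C (2 d)^(1/2) + 192 B L d, and each
   of these three terms is made smaller than eps / 3. *)
pose K : R := 32 * pi + 25 + l.
have K0 : 0 < K by have := l0; rewrite /K => ?; lra.
pose e1 := Num.min 1 (eps / (3 * B * K)).
have BK0 : 0 < 3 * B * K by rewrite !mulr_gt0.
have e10 : 0 < e1 by rewrite lt_min ltr01 divr_gt0.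
have e11 : e1 <= 1 by rewrite ge_min lexx.
have e1K : B * e1 * K <= eps / 3.
  have : e1 <= eps / (3 * B * K) by rewrite ge_min lexx orbT.
  by rewrite ler_pdivlMr// => h; lra.
have [C [delta [C0 delta0 est]]] := Nest e10.
have [eta eta0 angle] := @Rintegral_angle_density R e1 e10.
have [d2 d20 osc] := density_osc e10.
have BC0 : 0 < 3 * (16 * B * C + 1).
  by rewrite mulr_gt0// ltr_wpDl// mulr_ge0// mulr_ge0// ltW.
have BL0 : 0 < 3 * (192 * B * L + 1).
  have h : 0 <= 192 * B * L by apply: mulr_ge0; [apply: mulr_ge0 => //; exact: ltW|exact: ltW].
  by apply: mulr_gt0 => //; exact: ltr_wpDl.
have [d1 d10 root] := square_root_small (divr_gt0 eps0 BC0).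
pose d := Num.min (Num.min D d0) (Num.min (Num.min delta d2)
  (Num.min (Num.min d1 (eps / (3 * (192 * B * L + 1)))) (eta / (8 * L)))).
have d0' : 0 < d.
  by rewrite !lt_min D0 d00 delta0 d20 d10 /= !divr_gt0// mulr_gt0.
have dD : d <= D by rewrite !ge_min lexx.
have dd0 : d <= d0 by rewrite !ge_min lexx !orbT.
have ddelta : d <= delta by rewrite !ge_min lexx !orbT.
have dd2 : d <= d2 by rewrite !ge_min lexx !orbT.
have dd1 : d <= d1 by rewrite !ge_min lexx !orbT.
have dL : 192 * B * L * d <= eps / 3.
  have : d <= eps / (3 * (192 * B * L + 1)) by rewrite !ge_min lexx !orbT.
  by rewrite ler_pdivlMr// => h; lra.
have deta : 8 * L * d <= eta.
  have : d <= eta / (8 * L) by rewrite !ge_min lexx !orbT.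
  by rewrite ler_pdivlMr ?mulr_gt0// => h; lra.
have rootd := root d d0' dd1.
have arc := arcs d0' dD; have Ld8 := la_small arc.
have crit : 16 * B * C * (2 * d) `^ 2^-1 <= eps / 3.
  have r0 : 0 <= (2 * d) `^ 2^-1 by exact: powR_ge0.
  by move: rootd; rewrite ler_pdivlMr// => h; lra.
clearbody d.
have oscd s : s \in `[t - d, t + d] -> `|m s - m t| <= e1 by exact: osc.
exists d; split => //.
pose w := Num.min (L * d ^+ 2) delta.
have w0 : 0 < w by rewrite lt_min delta0 andbT mulr_gt0// exprn_gt0.
near=> p => hp pos.
have [n1 n2] : `|x t - p.1| <= w /\ `|y t - p.2| <= w.
  by near: p; exists (ball (x t) w, ball (y t) w) => /=;
    [split; exact: nbhsx_ballx|move=> q [/= q1 q2]; split; exact: ltW].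
have n1' : `|x t - p.1| <= L * d ^+ 2 by apply: (le_trans n1); rewrite ge_min lexx.
have n2' : `|y t - p.2| <= L * d ^+ 2 by apply: (le_trans n2); rewrite ge_min lexx.
have n1'' : `|x t - p.1| <= delta by apply: (le_trans n1); rewrite ge_min lexx orbT.
have n2'' : `|y t - p.2| <= delta by apply: (le_trans n2); rewrite ge_min lexx orbT.
have far : forall s, far_part d s -> `|N s p - N s P| <= e1.
  by near: p; exact: kernel_far_near.
have [s0 s0J foot] := foot_exists arc n1' n2'.
have v0 : nor_coord x y dx dy t p s0 != 0.
  apply/eqP => v0; have := pos s0 (near_in d0' dD s0J).
  by rewrite (sqdistE arc) foot v0 expr0n/= addr0 ltxx.
exists s0; split => //.
have sJd s : s \in `[t - d, t + d] -> `|s - t| <= delta.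
  by move=> sJ; apply: le_trans ddelta; exact: (dist_center sJ).
have hNp s : s \in `[t - d, t + d] -> 0 < sqdist x y p s ->
    `|N s p + kap p s / (2 * pi)| <= C * sqdist x y p s `^ (- 4^-1) + e1 * `|kap p s|.
  by move=> sJ ps; apply: est => //; exact: sJd.
have hNP s : s \in `[t - d, t + d] -> 0 < sqdist x y P s ->
    `|N s P + kap P s / (2 * pi)| <= C * sqdist x y P s `^ (- 4^-1) + e1 * `|kap P s|.
  by move=> sJ ps; apply: est => //; rewrite ?subrr ?normr0 ?(ltW delta0)//; exact: sJd.
have b1 := near_part_le d0' dD B1 C0 e10 mB oscd hNp s0J foot v0 hp.
have [_ b2] := near_part_direct_le d0' dD B1 C0 e10 mB hNP.
have b3 := angle _ _ _ _ _ _ _ _ _ arc deta n1' n2' s0J foot v0.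
have mE : measurable (`[0, l]%classic : set R) by exact: measurable_itv.
have mJ : measurable (`[t - d, t + d]%classic : set R) by exact: measurable_itv.
have mF := measurable_far_diff d.
have iP := direct_value_integrable.
have ip : mu.-integrable `[0, l] (EFin \o (fun s => m s * N s p)).
  by apply: integrable_off_curve => //; exact: segment_compact.
have iPF : mu.-integrable (`[0, l] `\` `[t - d, t + d]) (EFin \o (fun s => m s * N s P)).
  by apply: integrableS_fin iP => // s [].
have ipF : mu.-integrable (`[0, l] `\` `[t - d, t + d]) (EFin \o (fun s => m s * N s p)).
  by apply: integrableS_fin ip => // s [].
have iB := integrableB_fin mF ipF iPF.
have mB' := measurable_int _ iB; move/measurable_EFinP in mB'.
have Be0 : 0 <= B * e1 by rewrite mulr_ge0// ltW.
have [|_ b4] := norm_Rintegral_subset_le mF (@subDsetl _ _ _) l0 Be0 mB'.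
  move=> s [sE sJ]; rewrite -mulrBr normrM; apply: ler_pM => //; first exact: mB.
  by apply: far; exact: far_diff.
rewrite (RintegralB_fin mF ipF iPF) in b4.
rewrite (Rintegral_split mE mJ (near_subset d0' dD) ip) (Rintegral_split mE mJ (near_subset d0' dD) iP).
have mt : `|m t| <= B by apply: mB; apply: (near_in d0' dD); exact: center_in arc.
move: b1 b2 b3 b4 mt; set I1 := \int[mu]_(s in _) _; set I2 := \int[mu]_(s in _) kap p s.
set I3 := \int[mu]_(s in _) _; set I4 := \int[mu]_(s in _) _; set I5 := \int[mu]_(s in _) _.
set sg := Num.sg _ => b1 b2 b3 b4 mt.
apply: (le_trans (jump_sum_le pi2 mt b1 b2 b3 b4)).
have c1 : B * e1 * (L * d) <= B * e1 * 8^-1 by exact: ler_wpM2l.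
have c2 : B * L * d * e1 <= B * L * d * 1 by rewrite ler_wpM2l// !mulr_ge0// ltW.
exact: (error_budget crit dL e1K c1 c2).
Unshelve. all: end_near. Qed.
End abstract_jump.

(** * The singularity of the double-layer kernel *)

Section kernel_estimates.
Variable R : realType.
Variables alpha beta : R.
Hypotheses (alpha0 : 0 < alpha) (alpha1 : alpha < 1 / 2) (beta0 : 0 < beta) (beta1 : beta < 1 / 2).

Let b10 : 0 < 1 - alpha. Proof. by move: alpha0 alpha1 => ? ?; lra. Qed.
Let b11 : 1 - alpha < 1. Proof. by move: alpha0 alpha1 => ? ?; lra. Qed.
Let b21 : beta < 1. Proof. by move: beta0 beta1 => ? ?; lra. Qed.
Let b14 : 4^-1 <= 1 - alpha. Proof. by move: alpha0 alpha1 => ? ?; lra. Qed.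

Let a0 : 0 <= 1 - 2 * alpha. Proof. by move: alpha0 alpha1 => ? ?; lra. Qed.
Let a1 : 1 - 2 * alpha <= 1. Proof. by move: alpha0 alpha1 => ? ?; lra. Qed.

Lemma q2_const_gt0 : 0 < q2_const alpha beta.
Proof.
have p0 := @pi_gt0 R.
have g1 := Gamma_fun_gt0 b10; have g2 := Gamma_fun_gt0 beta0.
by rewrite /q2_const; apply: divr_gt0; [apply: divr_gt0; [exact: powR_gt0|exact: mulr_gt0]|exact: mulr_gt0].
Qed.

(** The case c = 0 occurs at the first end point of the arc, where y s vanishes. *)
Lemma powR_cvg_ge0 (T : Type) (F : set_system T) (FF : Filter F) (f : T -> R) (k c : R) :
  0 < k -> 0 <= c -> f @ F --> c -> (\forall z \near F, 0 <= f z) ->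
  f z `^ k @[z --> F] --> c `^ k.
Proof.
move=> k0; rewrite le_eqVlt => /predU1P[<-|c0] fc f0; last first.
  by apply: (@cvg_comp _ _ _ f (fun u : R => u `^ k) F (nbhs c)) => //; exact: continuous_powR_gt0.
rewrite powR0 ?gt_eqF//; apply/cvgrPdist_le => e e0.
have d0 : 0 < e `^ k^-1 by exact: powR_gt0.
move/cvgr_dist_le : fc => /(_ _ d0) fc; near=> z.
have h1 : 0 <= f z by near: z.
have h2 : `|0 - f z| <= e `^ k^-1 by near: z.
rewrite sub0r normrN ger0_norm ?powR_ge0//; move: h2; rewrite sub0r normrN ger0_norm// => h2.
have -> : e = (e `^ k^-1) `^ k by rewrite -powRrM mulVf ?gt_eqF// powRr1// ltW.
by apply: ge0_ler_powR; rewrite ?nnegrE ?powR_ge0// ltW.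
Unshelve. all: end_near. Qed.

Lemma powR_cvg_gt0 (T : Type) (F : set_system T) (FF : Filter F) (f : T -> R) (k c : R) :
  0 < c -> f @ F --> c -> f z `^ k @[z --> F] --> c `^ k.
Proof.
move=> c0 fc.
by apply: (@cvg_comp _ _ _ f (fun u : R => u `^ k) F (nbhs c)) => //; exact: continuous_powR_gt0.
Qed.

Lemma kernel_combination_cvg (T : Type) (F : set_system T) (FF : Filter F) (c k : R)
    (x y dx dy x0 y0 a b h0 h1 h2 h3 : T -> R) (x' y' dx' dy' x0' y0' a' b' h0' h1' h2' h3' : R) :
  x @ F --> x' -> y @ F --> y' -> dx @ F --> dx' -> dy @ F --> dy' -> x0 @ F --> x0' -> y0 @ F --> y0' ->
  a @ F --> a' -> b @ F --> b' -> h0 @ F --> h0' -> h1 @ F --> h1' -> h2 @ F --> h2' -> h3 @ F --> h3' ->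
  c * a z * b z * (k * dy z * h0 z - 4 * x0 z * x z * dy z * h2 z + 4 * y0 z * x z * dx z * h3 z)
    - 2 * (c * a z * b z * x z) * h1 z * ((x z - x0 z) * dy z - (y z - y0 z) * dx z) @[z --> F] -->
  c * a' * b' * (k * dy' * h0' - 4 * x0' * x' * dy' * h2' + 4 * y0' * x' * dx' * h3')
    - 2 * (c * a' * b' * x') * h1' * ((x' - x0') * dy' - (y' - y0') * dx').
Proof.
move=> cx cy cdx cdy cx0 cy0 ca cb ch0 ch1 ch2 ch3.
have cc (u : R) : (fun z : T => u) @ F --> u by exact: cvg_cst.
have cM (f g : T -> R) (u v : R) : f @ F --> u -> g @ F --> v -> f z * g z @[z --> F] --> u * v.
  by move=> fu gv; exact: cvgM.
have cB (f g : T -> R) (u v : R) : f @ F --> u -> g @ F --> v -> f z - g z @[z --> F] --> u - v.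
  by move=> fu gv; exact: cvgB.
have cD (f g : T -> R) (u v : R) : f @ F --> u -> g @ F --> v -> f z + g z @[z --> F] --> u + v.
  by move=> fu gv; exact: cvgD.
apply: (cB _ _ _ _ (cM _ _ _ _ (cM _ _ _ _ (cM _ _ _ _ (cc _) ca) cb) _) _).
  apply: (cD _ _ _ _ (cB _ _ _ _ (cM _ _ _ _ (cM _ _ _ _ (cc _) cdy) ch0) _) _).
    exact: (cM _ _ _ _ (cM _ _ _ _ (cM _ _ _ _ (cM _ _ _ _ (cc _) cx0) cx) cdy) ch2).
  exact: (cM _ _ _ _ (cM _ _ _ _ (cM _ _ _ _ (cM _ _ _ _ (cc _) cy0) cx) cdx) ch3).
apply: (cM _ _ _ _ (cM _ _ _ _ (cM _ _ _ _ (cc _) _) ch1) _).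
  exact: (cM _ _ _ _ (cM _ _ _ _ (cM _ _ _ _ (cc _) ca) cb) cx).
exact: (cB _ _ _ _ (cM _ _ _ _ (cB _ _ _ _ cx cx0) cdy) (cM _ _ _ _ (cB _ _ _ _ cy cy0) cdx)).
Qed.

Section cvg_kernel.
Variables (T : Type) (F : set_system T).
Hypothesis FF : Filter F.
Variables (x y dx dy x0 y0 : T -> R) (x' y' dx' dy' x0' y0' : R).
Hypotheses (cx : x @ F --> x') (cy : y @ F --> y') (cdx : dx @ F --> dx') (cdy : dy @ F --> dy').
Hypotheses (cx0 : x0 @ F --> x0') (cy0 : y0 @ F --> y0').
Hypotheses (x'0 : 0 <= x') (y'0 : 0 <= y') (x0'0 : 0 < x0') (y0'0 : 0 < y0').
Hypotheses (px : \forall z \near F, 0 <= x z) (py : \forall z \near F, 0 <= y z).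
Hypothesis r0 : 0 < (x' - x0') ^+ 2 + (y' - y0') ^+ 2.

Lemma heat_pair_cvg k i j : 0 < 1 - alpha + beta + k ->
  heat_pair alpha beta k i j (x z) (y z) (x0 z) (y0 z) @[z --> F]
    --> heat_pair alpha beta k i j x' y' x0' y0'.
Proof.
move=> k0; rewrite /heat_pair.
have px0 : \forall z \near F, 0 <= x0 z by exact: (cvgr_ge _ cx0).
have py0 : \forall z \near F, 0 <= y0 z by exact: (cvgr_ge _ cy0).
apply: (laplace_pair_cvg b10 beta0) => //.
- by rewrite !mulr_ge0// ltW.
- by rewrite !mulr_ge0// ltW.
- by rewrite !expr2; apply: cvgD; apply: cvgM; apply: cvgB.
- by apply: cvgM => //; apply: cvgM => //; exact: cvg_cst.
- by apply: cvgM => //; apply: cvgM => //; exact: cvg_cst.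
- by near=> z; rewrite !mulr_ge0//; near: z.
- by near=> z; rewrite !mulr_ge0//; near: z.
Unshelve. all: end_near. Qed.

(** The limits x' and y' may vanish, so that the kernel extends continuously to
    the end points of the arc. *)
Lemma dl_kernel_cvg :
  dl_kernel alpha beta (x z) (y z) (dx z) (dy z) (x0 z) (y0 z) @[z --> F]
    --> dl_kernel alpha beta x' y' dx' dy' x0' y0'.
Proof.
have k0 : 0 < 1 - alpha + beta + 0 by move: alpha1 beta0 => ? ?; lra.
have k1 : 0 < 1 - alpha + beta + 1 by move: alpha1 beta0 => ? ?; lra.
have h0 := @heat_pair_cvg 0 0 0 k0; have h1 := @heat_pair_cvg 1 0 0 k1.
have h2 := @heat_pair_cvg 1 1 0 k1; have h3 := @heat_pair_cvg 1 0 1 k1.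
have p1 : x0 z `^ (1 - 2 * alpha) @[z --> F] --> x0' `^ (1 - 2 * alpha) by exact: powR_cvg_gt0.
have b20 : 0 < 2 * beta by rewrite mulr_gt0.
have p2 : y z `^ (2 * beta) @[z --> F] --> y' `^ (2 * beta) by exact: powR_cvg_ge0.
exact: (@kernel_combination_cvg T F FF (q2_const alpha beta) (1 - 2 * alpha)
  _ _ _ _ _ _ _ _ _ _ _ _ _ _ _ _ _ _ _ _ _ _ _ _ cx cy cdx cdy cx0 cy0 p1 p2 h0 h1 h2 h3).
Qed.
End cvg_kernel.

(** Minus the coefficient of the angle density in the strongly singular term, with
    the Laplace integral replaced by its leading asymptotics. *)
Definition leading_coef_q2 (x y x0 y0 : R) : R :=
  2 * (q2_const alpha beta * x0 `^ (1 - 2 * alpha) * y `^ (2 * beta) * x) *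
  (Gamma_fun (1 - alpha) * Gamma_fun beta
   * ((4 * x0 * x) `^ (- (1 - alpha)) * (4 * y0 * y) `^ (- beta))).

(** All powers of x and y cancel; this is where the normalisation of k2 enters. *)
Lemma leading_coef_q2_diag x y : 0 < x -> 0 < y -> leading_coef_q2 x y x y = (2 * pi)^-1.
Proof.
move=> x0 y0; rewrite /leading_coef_q2 /q2_const.
have p0 := @pi_gt0 R.
have g1 := Gamma_fun_gt0 b10; have g2 := Gamma_fun_gt0 beta0.
have xn : x != 0 by rewrite gt_eqF.
have yn : y != 0 by rewrite gt_eqF.
have pD (u a b : R) : 0 < u -> u `^ (a + b) = u `^ a * u `^ b.
  by move=> u0; rewrite powRD// (gt_eqF u0) implybT.
have xa := powR_gt0 alpha x0; have yb := powR_gt0 beta y0.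
have -> : x `^ (1 - 2 * alpha) = x / (x `^ alpha * x `^ alpha).
  rewrite (_ : 1 - 2 * alpha = 1 + (- alpha - alpha)); last by ring.
  by rewrite !pD// powRN powRr1 ?(ltW x0)// invfM.
have -> : y `^ (2 * beta) = y `^ beta * y `^ beta.
  by rewrite (_ : 2 * beta = beta + beta) ?pD//; ring.
have p4 : (0 : R) < 4 by [].
have p2 : (0 : R) < 2 by [].
rewrite !powRM ?mulr_ge0 ?(ltW x0) ?(ltW y0)//.
have -> : x `^ (- (1 - alpha)) = x `^ alpha / x.
  by rewrite (_ : - (1 - alpha) = alpha + - 1) ?pD ?powR_inv1 ?(ltW x0)//; ring.
rewrite (powRN y).
have -> : 2 `^ (2 - 2 * alpha + 2 * beta) = (4 `^ (- (1 - alpha)) * 4 `^ (- beta))^-1 :> R.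
  rewrite -pD// -powRN (_ : 4 = 2 `^ 2 :> R); last by rewrite powR_mulrn//; ring.
  by rewrite -powRrM; congr powR; ring.
have q1 := powR_gt0 (- (1 - alpha)) p4; have q2 := powR_gt0 (- beta) p4.
move: (4 `^ _) (4 `^ _) (x `^ _) (y `^ _) (Gamma_fun _) (Gamma_fun _) q1 q2 xa yb g1 g2 pi p0 =>
  u1 u2 u3 u4 u5 u6 h1 h2 h3 h4 h5 h6 pi' p0.
by field; rewrite !gt_eqF.
Qed.

Definition weak_factor (i j : nat) (x y x0 y0 : R) : R :=
  1 + (4 * x0 * x) `^ (- (1 - alpha + i%:R)) * (4 * y0 * y) `^ (- (beta + j%:R)).

Lemma heat_pair_weak k i j : k = i%:R + j%:R -> exists2 C, 0 < C & forall x y x0 y0,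
  0 < x -> 0 < y -> 0 < x0 -> 0 < y0 -> 0 < (x - x0) ^+ 2 + (y - y0) ^+ 2 ->
  heat_pair alpha beta k i j x y x0 y0
  <= C * weak_factor i j x y x0 y0 * ((x - x0) ^+ 2 + (y - y0) ^+ 2) `^ (- 4^-1).
Proof.
move=> ->; have [C C0 h] := laplace_pair_weak b10 b11 beta0 b21 i j b14.
exists C => // x y x0 y0 x_gt0 y_gt0 x0_gt0 y0_gt0 r0.
by rewrite /heat_pair addrA; apply: h => //; rewrite !mulr_gt0.
Qed.

Lemma heat_pair_ge0 k i j x y x0 y0 : 0 <= heat_pair alpha beta k i j x y x0 y0.
Proof. exact: laplace_pair_ge0. Qed.

Definition leading_factor (x y x0 y0 : R) : R :=
  (4 * x0 * x) `^ (- (1 - alpha)) * (4 * y0 * y) `^ (- beta).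

Lemma heat_pair_leading : exists2 C, 0 < C & forall x y x0 y0,
  0 < x -> 0 < y -> 0 < x0 -> 0 < y0 -> 0 < (x - x0) ^+ 2 + (y - y0) ^+ 2 ->
  `|((x - x0) ^+ 2 + (y - y0) ^+ 2) * heat_pair alpha beta 1 0 0 x y x0 y0
    - Gamma_fun (1 - alpha) * Gamma_fun beta * leading_factor x y x0 y0|
  <= C * (leading_factor x y x0 y0 * ((4 * x0 * x) `^ (- 2^-1) + (4 * y0 * y) `^ (- 2^-1)))
     * ((x - x0) ^+ 2 + (y - y0) ^+ 2) `^ 2^-1.
Proof.
have [C C0 h] := laplace_pair_leading b10 b11 beta0 b21.
exists C => // x y x0 y0 x_gt0 y_gt0 x0_gt0 y0_gt0 r0.
by rewrite (mulrA C); apply: h => //; rewrite !mulr_gt0.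
Qed.

Definition kernel_majorant (C0 C1 C2 C3 x y x0 y0 : R) : R :=
  q2_const alpha beta * x0 `^ (1 - 2 * alpha) * y `^ (2 * beta) *
    (C0 * weak_factor 0 0 x y x0 y0 + 4 * x0 * x * (C1 * weak_factor 1 0 x y x0 y0)
     + 4 * y0 * x * (C2 * weak_factor 0 1 x y x0 y0)
     + 4 * x * (C3 * (leading_factor x y x0 y0
                      * ((4 * x0 * x) `^ (- 2^-1) + (4 * y0 * y) `^ (- 2^-1))))).

Lemma norm_angle_form_le (x y dx dy x0 y0 : R) : `|dx| <= 1 -> `|dy| <= 1 ->
  `|angle_form x y dx dy x0 y0| <= 2 * ((x - x0) ^+ 2 + (y - y0) ^+ 2) `^ 2^-1.
Proof.
move=> dx1 dy1; rewrite /angle_form; pose r := (x - x0) ^+ 2 + (y - y0) ^+ 2.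
have r0 : 0 <= r by rewrite addr_ge0 ?sqr_ge0.
have root (u : R) : u ^+ 2 <= r -> `|u| <= r `^ 2^-1.
  move=> ur; have -> : `|u| = (`|u| ^+ 2) `^ 2^-1.
    by rewrite -powR_mulrn// -powRrM mulfV// powRr1.
  by apply: ge0_ler_powR; rewrite ?nnegrE ?invr_ge0 ?sqr_ge0// real_normK ?num_real.
have h1 : `|x - x0| <= r `^ 2^-1 by apply: root; rewrite lerDl sqr_ge0.
have h2 : `|y - y0| <= r `^ 2^-1 by apply: root; rewrite lerDr sqr_ge0.
apply: (le_trans (ler_normB _ _)); rewrite !normrM mulr_natl mulr2n.
by apply: lerD; [apply: le_trans h1|apply: le_trans h2]; exact: ler_piMr.
Qed.

Lemma powR_half_sq (r : R) : 0 < r -> r `^ 2^-1 * r `^ 2^-1 = r.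
Proof.
move=> r0; rewrite -powRD ?(gt_eqF r0) ?implybT// (_ : 2^-1 + 2^-1 = 1); last by lra.
by rewrite powRr1// ltW.
Qed.

Lemma powR_quarter_ge1 (r : R) : 0 < r -> r <= 1 -> 1 <= r `^ (- 4^-1).
Proof.
move=> r0 r1; have h : r `^ 4^-1 <= 1 `^ 4^-1.
  by apply: ge0_ler_powR; rewrite ?nnegrE ?invr_ge0 ?(ltW r0).
by rewrite powRN invf_ge1 ?powR_gt0//; apply: (le_trans h); rewrite powR1.
Qed.

(** With E / r the angle density, |E / r| <= 2 / q cancels the factor q of the
    error in the leading asymptotics. *)
Lemma kernel_split_le (A a dx dy x x0 y0 h0 h1 h2 hl G E r s q W0 W1 W2 W3 ip : R) :
  0 <= A -> 0 <= a -> a <= 1 -> `|dx| <= 1 -> `|dy| <= 1 -> 0 <= x -> 0 <= x0 -> 0 <= y0 ->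
  0 <= h0 -> 0 <= h1 -> 0 <= h2 -> h0 <= W0 * s -> h1 <= W1 * s -> h2 <= W2 * s ->
  `|r * hl - G| <= W3 * q -> q * q = r -> 0 < q -> 1 <= s -> 0 <= W3 -> `|E| <= 2 * q ->
  `|A * (a * dy * h0 - 4 * x0 * x * dy * h1 + 4 * y0 * x * dx * h2) - 2 * (A * x) * hl * E + E / r * ip|
  <= A * (W0 + 4 * x0 * x * W1 + 4 * y0 * x * W2 + 4 * x * W3) * s
     + `|2 * (A * x) * G - ip| * `|E / r|.
Proof.
move=> A0 a0' a1' dx1 dy1 xp x0p y0p h00 h10 h20 w0 w1 w2 w3 qr q0 s1 W30 hE.
have r0 : 0 < r by rewrite -qr mulr_gt0.
have -> : A * (a * dy * h0 - 4 * x0 * x * dy * h1 + 4 * y0 * x * dx * h2) - 2 * (A * x) * hl * E + E / r * ip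
  = A * (a * dy * h0 - 4 * x0 * x * dy * h1 + 4 * y0 * x * dx * h2)
    - 2 * (A * x) * ((r * hl - G) * (E / r)) - (2 * (A * x) * G - ip) * (E / r).
  by field; rewrite gt_eqF.
apply: (le_trans (ler_normB _ _)); rewrite (normrM (2 * (A * x) * G - ip)); apply: lerD => //.
have E2 : `|(r * hl - G) * (E / r)| <= 2 * W3.
  rewrite normrM (normrM E) normfV (gtr0_norm r0).
  have e1 : `|E| / r <= 2 / q.
    by rewrite ler_pdivrMr// -qr (_ : 2 / q * (q * q) = 2 * q)//; field; rewrite gt_eqF.
  have : `|r * hl - G| * (`|E| / r) <= W3 * q * (2 / q).
    by apply: ler_pM => //; rewrite divr_ge0// ltW.
  by rewrite (_ : W3 * q * (2 / q) = 2 * W3)//; field; rewrite gt_eqF.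
have b0 : `|a * dy * h0| <= W0 * s.
  rewrite !normrM (ger0_norm a0') (ger0_norm h00); apply: le_trans w0.
  by rewrite ler_piMl// mulr_ile1.
have c1 : 0 <= 4 * x0 * x by rewrite !mulr_ge0.
have b1 : `|4 * x0 * x * dy * h1| <= 4 * x0 * x * (W1 * s).
  rewrite normrM (normrM (4 * x0 * x)) (ger0_norm c1) (ger0_norm h10) -mulrA; apply: ler_wpM2l => //.
  by apply: le_trans w1; rewrite ler_piMl.
have c2 : 0 <= 4 * y0 * x by rewrite !mulr_ge0.
have b2 : `|4 * y0 * x * dx * h2| <= 4 * y0 * x * (W2 * s).
  rewrite normrM (normrM (4 * y0 * x)) (ger0_norm c2) (ger0_norm h20) -mulrA; apply: ler_wpM2l => //.
  by apply: le_trans w2; rewrite ler_piMl.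
have Ax : 0 <= A * x by rewrite mulr_ge0.
have b3 : `|2 * (A * x) * ((r * hl - G) * (E / r))| <= 4 * (A * x) * W3.
  rewrite normrM ger0_norm ?mulr_ge0//.
  have : 2 * (A * x) * `|(r * hl - G) * (E / r)| <= 2 * (A * x) * (2 * W3) by apply: ler_wpM2l; rewrite ?mulr_ge0.
  by move=> h; lra.
have b4 : 4 * (A * x) * W3 <= 4 * (A * x) * W3 * s by rewrite ler_peMr// !mulr_ge0.
have b5 : `|A * (a * dy * h0 - 4 * x0 * x * dy * h1 + 4 * y0 * x * dx * h2)|
    <= A * (W0 * s + 4 * x0 * x * (W1 * s) + 4 * y0 * x * (W2 * s)).
  rewrite normrM ger0_norm//; apply: ler_wpM2l => //.
  apply: (le_trans (ler_normD _ _)); apply: lerD => //.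
  by apply: (le_trans (ler_normB _ _)); exact: lerD.
apply: (le_trans (ler_normB _ _)); apply: (le_trans (lerD b5 (le_trans b3 b4))).
by rewrite le_eqVlt; apply/orP; left; apply/eqP; ring.
Qed.

(** The kernel is a multiple of the angle density, up to weakly singular terms. *)
Lemma dl_kernel_angle : exists C0 C1 C2 C3 : R, [/\ 0 <= C0, 0 <= C1, 0 <= C2, 0 <= C3 &
  forall x y dx dy x0 y0 : R, 0 < x -> 0 < y -> 0 < x0 -> 0 < y0 -> `|dx| <= 1 -> `|dy| <= 1 ->
    let r := (x - x0) ^+ 2 + (y - y0) ^+ 2 in let k := angle_form x y dx dy x0 y0 / r in
    0 < r -> r <= 1 ->
    `|dl_kernel alpha beta x y dx dy x0 y0 + k / (2 * pi)|
      <= kernel_majorant C0 C1 C2 C3 x y x0 y0 * r `^ (- 4^-1)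
         + `|leading_coef_q2 x y x0 y0 - (2 * pi)^-1| * `|k|].
Proof.
have [C0 C00 w0] := @heat_pair_weak 0 0 0 (esym (addr0 _)).
have [C1 C10 w1] := @heat_pair_weak 1 1 0 (esym (addr0 _)).
have [C2 C20 w2] := @heat_pair_weak 1 0 1 (esym (add0r _)).
have [C3 C30 w3] := heat_pair_leading.
exists C0, C1, C2, C3; split; try exact: ltW.
move=> x y dx dy x0 y0 xp yp x0p y0p dx1 dy1 r k r0 r1.
have hE := norm_angle_form_le x y x0 y0 dx1 dy1; rewrite -/r in hE.
have {}w0 := w0 _ _ _ _ xp yp x0p y0p r0; have {}w1 := w1 _ _ _ _ xp yp x0p y0p r0.
have {}w2 := w2 _ _ _ _ xp yp x0p y0p r0; have {}w3 := w3 _ _ _ _ xp yp x0p y0p r0.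
have g0 := heat_pair_ge0 0 0 0 x y x0 y0; have g1 := heat_pair_ge0 1 1 0 x y x0 y0.
have g2 := heat_pair_ge0 1 0 1 x y x0 y0.
rewrite -/r in w0 w1 w2 w3.
have A0 : 0 <= q2_const alpha beta * x0 `^ (1 - 2 * alpha) * y `^ (2 * beta).
  by rewrite mulr_ge0 ?powR_ge0// mulr_ge0 ?powR_ge0// ltW// q2_const_gt0.
have r2 := powR_half_sq r0.
have r4 := powR_quarter_ge1 r0 r1.
have W30 : 0 <= C3 * (leading_factor x y x0 y0 * ((4 * x0 * x) `^ (- 2^-1) + (4 * y0 * y) `^ (- 2^-1))).
  rewrite mulr_ge0 ?(ltW C30)// mulr_ge0 ?addr_ge0 ?powR_ge0//.
  by rewrite /leading_factor mulr_ge0 ?powR_ge0.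
have q0 : 0 < r `^ 2^-1 by exact: powR_gt0.
exact: (@kernel_split_le _ _ dx dy x x0 y0 _ _ _ _ _ _ r _ _ _ _ _ _ (2 * pi)^-1 A0 a0 a1 dx1 dy1
  (ltW xp) (ltW x0p) (ltW y0p) g0 g1 g2 w0 w1 w2 w3 r2 q0 r4 W30 hE).
Qed.

Section near_diagonal.
Variables (T : Type) (F : set_system T).
Hypothesis FF : Filter F.
Variables (x y x0 y0 : T -> R) (X Y : R).
Hypotheses (cx : x @ F --> X) (cy : y @ F --> Y) (cx0 : x0 @ F --> X) (cy0 : y0 @ F --> Y).
Hypotheses (X0 : 0 < X) (Y0 : 0 < Y).

Let cM (f g : T -> R) (u v : R) : f @ F --> u -> g @ F --> v -> f z * g z @[z --> F] --> u * v.
Proof. by move=> fu gv; exact: cvgM. Qed.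

Let cD (f g : T -> R) (u v : R) : f @ F --> u -> g @ F --> v -> f z + g z @[z --> F] --> u + v.
Proof. by move=> fu gv; exact: cvgD. Qed.

Let cc (u : R) : (fun z : T => u) @ F --> u.
Proof. exact: cvg_cst. Qed.

Let cX (k : R) : (4 * x0 z * x z) `^ k @[z --> F] --> (4 * X * X) `^ k.
Proof.
apply: (powR_cvg_gt0 FF); first by rewrite !mulr_gt0.
exact: (@cM _ _ _ _ (@cM _ _ _ _ (@cc _) cx0) cx).
Qed.

Let cY (k : R) : (4 * y0 z * y z) `^ k @[z --> F] --> (4 * Y * Y) `^ k.
Proof.
apply: (powR_cvg_gt0 FF); first by rewrite !mulr_gt0.
exact: (@cM _ _ _ _ (@cM _ _ _ _ (@cc _) cy0) cy).
Qed.

Let cA : q2_const alpha beta * x0 z `^ (1 - 2 * alpha) * y z `^ (2 * beta) @[z --> F]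
  --> q2_const alpha beta * X `^ (1 - 2 * alpha) * Y `^ (2 * beta).
Proof.
exact: (@cM _ _ _ _ (@cM _ _ _ _ (@cc _) (@powR_cvg_gt0 T F FF _ _ _ X0 cx0)) (@powR_cvg_gt0 T F FF _ _ _ Y0 cy)).
Qed.

Lemma leading_coef_q2_cvg : leading_coef_q2 (x z) (y z) (x0 z) (y0 z) @[z --> F] --> (2 * pi)^-1.
Proof.
rewrite -(leading_coef_q2_diag X0 Y0).
exact: (@cM _ _ _ _ (@cM _ _ _ _ (@cc _) (@cM _ _ _ _ cA cx)) (@cM _ _ _ _ (@cc _) (@cM _ _ _ _ (@cX _) (@cY _)))).
Qed.

Lemma kernel_majorant_cvg C0 C1 C2 C3 :
  kernel_majorant C0 C1 C2 C3 (x z) (y z) (x0 z) (y0 z) @[z --> F] --> kernel_majorant C0 C1 C2 C3 X Y X Y.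
Proof.
have cw i j : weak_factor i j (x z) (y z) (x0 z) (y0 z) @[z --> F] --> weak_factor i j X Y X Y.
  exact: (@cD _ _ _ _ (@cc _) (@cM _ _ _ _ (@cX _) (@cY _))).
apply: (@cM _ _ _ _ cA _); apply: cD; first apply: cD; first apply: cD.
- exact: (@cM _ _ _ _ (@cc _) (@cw _ _)).
- exact: (@cM _ _ _ _ (@cM _ _ _ _ (@cM _ _ _ _ (@cc _) cx0) cx) (@cM _ _ _ _ (@cc _) (@cw _ _))).
- exact: (@cM _ _ _ _ (@cM _ _ _ _ (@cM _ _ _ _ (@cc _) cy0) cx) (@cM _ _ _ _ (@cc _) (@cw _ _))).
- exact: (@cM _ _ _ _ (@cM _ _ _ _ (@cc _) cx) (@cM _ _ _ _ (@cc _) (@cM _ _ _ _ (@cM _ _ _ _ (@cX _) (@cY _)) (@cD _ _ _ _ (@cX _) (@cY _))))).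
Qed.

End near_diagonal.

(** Close to the diagonal the majorant is bounded, and the coefficient of the angle
    density is close to its diagonal value. *)
Lemma dl_kernel_near_angle (x y dx dy : R -> R) (t eps : R) :
  continuous x -> continuous y -> 0 < x t -> 0 < y t ->
  (forall s, `|dx s| <= 1) -> (forall s, `|dy s| <= 1) -> 0 < eps ->
  exists C delta : R, [/\ 0 <= C, 0 < delta &
    forall s p, `|s - t| <= delta -> `|x t - p.1| <= delta -> `|y t - p.2| <= delta ->
      0 < sqdist x y p s ->
      `|dl_kernel alpha beta (x s) (y s) (dx s) (dy s) p.1 p.2 + angle_density x y dx dy p s / (2 * pi)|
      <= C * sqdist x y p s `^ (- 4^-1) + eps * `|angle_density x y dx dy p s|].
Proof.
move=> cx cy xt yt dx1 dy1 eps0.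
have [C0 [C1 [C2 [C3 [C00 C10 C20 C30 h]]]]] := dl_kernel_angle.
pose P := (x t, y t).
pose F := filter_prod (nbhs t) (nbhs P).
have FF : Filter F by exact: filter_prod_filter.
have cs : fst @ F --> t by exact: cvg_fst.
have c1 : x z.1 @[z --> F] --> x t by exact: (@cvg_comp _ _ _ (@fst R (R * R)) x F (nbhs t) _ cs (cx t)).
have c2 : y z.1 @[z --> F] --> y t by exact: (@cvg_comp _ _ _ (@fst R (R * R)) y F (nbhs t) _ cs (cy t)).
have c3 : z.2.1 @[z --> F] --> x t.
  exact: (@cvg_comp _ _ _ (@snd R (R * R)) (@fst R R) _ (nbhs P) _ cvg_snd cvg_fst).
have c4 : z.2.2 @[z --> F] --> y t.
  exact: (@cvg_comp _ _ _ (@snd R (R * R)) (@snd R R) _ (nbhs P) _ cvg_snd cvg_snd).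
have hm := @kernel_majorant_cvg _ F FF _ _ _ _ _ _ c1 c2 c3 c4 xt yt C0 C1 C2 C3.
have hl := leading_coef_q2_cvg FF c1 c2 c3 c4 xt yt.
pose C := kernel_majorant C0 C1 C2 C3 (x t) (y t) (x t) (y t) + 1.
have c5 : (x z.1 - z.2.1) ^+ 2 + (y z.1 - z.2.2) ^+ 2 @[z --> F] --> (x t - x t) ^+ 2 + (y t - y t) ^+ 2.
  by rewrite !expr2; apply: cvgD; apply: cvgM; apply: cvgB.
rewrite !subrr expr0n/= addr0 in c5.
have near_all : \forall z \near F, [/\ 0 < x z.1, 0 < y z.1, 0 < z.2.1, 0 < z.2.2 &
   [/\ kernel_majorant C0 C1 C2 C3 (x z.1) (y z.1) z.2.1 z.2.2 <= C,
    (x z.1 - z.2.1) ^+ 2 + (y z.1 - z.2.2) ^+ 2 <= 1 &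
    `|leading_coef_q2 (x z.1) (y z.1) z.2.1 z.2.2 - (2 * pi)^-1| <= eps]].
  have e1 : \forall z \near F, 0 < x z.1 by exact: (cvgr_gt _ c1).
  have e2 : \forall z \near F, 0 < y z.1 by exact: (cvgr_gt _ c2).
  have e3 : \forall z \near F, 0 < z.2.1 by exact: (cvgr_gt _ c3).
  have e4 : \forall z \near F, 0 < z.2.2 by exact: (cvgr_gt _ c4).
  have e5 : \forall z \near F, kernel_majorant C0 C1 C2 C3 (x z.1) (y z.1) z.2.1 z.2.2 <= C.
    by apply: (cvgr_le _ hm); rewrite /C ltrDl.
  have e6 : \forall z \near F, (x z.1 - z.2.1) ^+ 2 + (y z.1 - z.2.2) ^+ 2 <= 1.
    by apply: (cvgr_le _ c5).
  have e7 : \forall z \near F, `|leading_coef_q2 (x z.1) (y z.1) z.2.1 z.2.2 - (2 * pi)^-1| <= eps.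
    by move/cvgrPdist_le : hl => /(_ _ eps0); apply: filterS => z; rewrite distrC.
  by near=> z; split; [near: z..|split; near: z].
have C0' : 0 <= C.
  have q0 := q2_const_gt0.
  have X2 : 0 <= 4 * x t * x t by rewrite !mulr_ge0// ltW.
  have X3 : 0 <= 4 * y t * x t by rewrite !mulr_ge0// ltW.
  have X4 : 0 <= 4 * x t by rewrite mulr_ge0// ltW.
  have wf i j : 0 <= weak_factor i j (x t) (y t) (x t) (y t).
    by rewrite addr_ge0// mulr_ge0 ?powR_ge0.
  have lf : 0 <= leading_factor (x t) (y t) (x t) (y t) by rewrite mulr_ge0 ?powR_ge0.
  apply: addr_ge0 => //; apply: mulr_ge0.
    by apply: mulr_ge0; [apply: mulr_ge0; [exact: ltW|exact: powR_ge0]|exact: powR_ge0].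
  apply: addr_ge0; [apply: addr_ge0; [apply: addr_ge0|]|].
  - exact: mulr_ge0.
  - by apply: mulr_ge0 => //; exact: mulr_ge0.
  - by apply: mulr_ge0 => //; exact: mulr_ge0.
  - by do 3 (apply: mulr_ge0 => //); apply: addr_ge0; exact: powR_ge0.
case: near_all => -[A B] [/= /nbhs_ballP[e1 /= e10 A1] /nbhs_ballP[e2 /= e20 B2]] AB.
pose delta := Num.min e1 e2 / 2.
have d0 : 0 < delta by rewrite divr_gt0// lt_min e10.
have d1 : delta < e1.
  by rewrite ltr_pdivrMr// (le_lt_trans (_ : _ <= e1)) ?ge_min ?lexx// ltr_pMr// ltr1n.
have d2 : delta < e2.
  by rewrite ltr_pdivrMr// (le_lt_trans (_ : _ <= e2)) ?ge_min ?lexx ?orbT// ltr_pMr// ltr1n.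
exists C, delta; split => // s p st p1 p2 r0.
have hA : A s by apply: A1; rewrite /ball/= distrC; exact: le_lt_trans d1.
have hB : B p by apply: B2; split; rewrite /ball/=; exact: le_lt_trans d2.
have [/= xs ys q1 q2 [km r1 lc]] := AB (s, p) (conj hA hB).
have := h (x s) (y s) (dx s) (dy s) p.1 p.2 xs ys q1 q2 (dx1 s) (dy1 s) r0 r1.
move/le_trans; apply; apply: lerD; first by apply: ler_wpM2r => //; exact: powR_ge0.
by apply: ler_wpM2r.
Unshelve. all: end_near. Qed.
End kernel_estimates.

(** * The two sides of an arc *)

Section sides_of_the_arc.
Variable R : realType.

(** On a path that misses the boundary, Om and its closure have the same preimage,
    which is therefore open and closed in the segment. *)
Lemma path_stays_in (Om : set (R * R)) (g : R -> R * R) :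
  open Om -> continuous g ->
  (forall u, u \in `[0, 1] -> ~ (closure Om (g u) /\ ~ Om (g u))) ->
  Om (g 0) -> Om (g 1).
Proof.
move=> oOm cg avoid g0.
have conn : connected (`[0, 1]%classic : set R) by exact: segment_connected.
have e : `[0, 1]%classic `&` (g @^-1` Om) = `[0, 1]%classic.
  apply: conn.
  - by exists 0; split => //=; rewrite in_itv/= lexx ler01.
  - by exists (g @^-1` Om) => //; apply: open_comp => // u _; exact: cg.
  - exists (g @^-1` closure Om).
      by apply: closed_comp; [move=> u _; exact: cg|exact: closed_closure].
    apply/seteqP; split => u [u01 h]; split => //; first exact: subset_closure.
    by apply: contrapT => h'; exact: (avoid u).
have : (`[0, 1]%classic `&` (g @^-1` Om)) 1 by rewrite e /= in_itv/= lexx ler01.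
by case.
Qed.

Variables (x y dx dy : R -> R) (l t L D : R) (Om : set (R * R)).
Notation P := (x t, y t).
Hypothesis tD : forall s, s \in `[t - D, t + D] -> s \in `[0, l].
Hypothesis D0 : 0 < D.
Hypothesis arcs : forall d, 0 < d -> d <= D -> local_arc x y dx dy t d L.
Hypothesis P_in : quadrant P.
Hypothesis simple : forall s, s \in `[0, l] -> s != t -> 0 < sqdist x y P s.
Hypothesis oOm : open Om.
Hypothesis boundary_on_arc : forall p, closure Om p -> ~ Om p -> quadrant p ->
  exists2 s, s \in `[0, l] & p = (x s, y s).
Hypothesis arc_on_boundary : forall s, s \in `[0, l] ->
  closure Om (x s, y s) /\ ~ Om (x s, y s).
Hypothesis exterior : \forall h \near 0^'+, ~ Om (x t + h * dy t, y t - h * dx t).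

Let arcD := arcs D0 (lexx D).
Notation U := (tan_coord x y dx dy t).
Notation V := (nor_coord x y dx dy t).

Lemma t_in : t \in `[0, l].
Proof. by apply: tD; exact: center_in arcD. Qed.

(** The points near P, in the coordinates given by the foot s and the distance h
    along the normal at t; the direction of the shift does not depend on s. *)
Definition shifted (s h : R) : R * R := (x s + h * dy t, y s - h * dx t).

Lemma shifted_tan s h : U (shifted s h) s = 0.
Proof. by rewrite /tan_coord /shifted/=; ring. Qed.

Lemma shifted_nor s h : V (shifted s h) s = - h.
Proof.
rewrite /nor_coord /shifted/=.
transitivity (- h * (dx t ^+ 2 + dy t ^+ 2)); first by ring.
by rewrite (la_unit arcD) mulr1.
Qed.

Lemma foot_shifted p s : U p s = 0 -> p = shifted s (- V p s).
Proof.
move=> foot; rewrite [LHS]surjective_pairing /shifted; congr pair.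
  transitivity (x s - (dx t ^+ 2 + dy t ^+ 2) * (x s - p.1)); first by rewrite (la_unit arcD); ring.
  transitivity (x s - dx t * U p s - dy t * V p s); first by rewrite /tan_coord /nor_coord; ring.
  by rewrite foot; ring.
transitivity (y s - (dx t ^+ 2 + dy t ^+ 2) * (y s - p.2)); first by rewrite (la_unit arcD); ring.
transitivity (y s - dy t * U p s + dx t * V p s); first by rewrite /tan_coord /nor_coord; ring.
by rewrite foot; ring.
Qed.

(** The arc is simple, so that outside a neighbourhood of t its distance to P has
    a positive minimum. *)
Lemma far_separation : exists2 r : R, 0 < r & forall s, s \in `[0, l] -> s \notin `[t - D, t + D] ->
  ~ (`|x s - x t| < r /\ `|y s - y t| < r).
Proof.
have [cx cy _ _] := la_cont arcD.
have cq : continuous (sqdist x y P).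
  move=> s; have cX : {for s, continuous (fun s => x s - x t)} by apply: cvgB; [exact: cx|exact: cvg_cst].
  have cY : {for s, continuous (fun s => y s - y t)} by apply: cvgB; [exact: cy|exact: cvg_cst].
  by apply: cvgD; apply: cvgM; [exact: cX|exact: cX|exact: cY|exact: cY].
have [h1 h2] : 0 <= t - D /\ t + D <= l.
  have d0 := D0.
  have a1 : t - D \in `[t - D, t + D] by rewrite in_itv/=; apply/andP; split; lra.
  have a2 : t + D \in `[t - D, t + D] by rewrite in_itv/=; apply/andP; split; lra.
  by move: (tD a1) (tD a2); rewrite !in_itv/= => /andP[? _] /andP[].
have [c1 c1I m1] := EVT_min h1 (continuous_subspaceT cq).
have [c2 c2I m2] := EVT_min h2 (continuous_subspaceT cq).
have p1 : 0 < sqdist x y P c1.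
  move: c1I D0 h2; rewrite in_itv/= => /andP[? ?] ? ?; apply: simple; first by rewrite in_itv/=; apply/andP; split; lra.
  by rewrite lt_eqF//; lra.
have p2 : 0 < sqdist x y P c2.
  move: c2I D0 h1; rewrite in_itv/= => /andP[? ?] ? ?; apply: simple; first by rewrite in_itv/=; apply/andP; split; lra.
  by rewrite gt_eqF//; lra.
pose m := Num.min (sqdist x y P c1) (sqdist x y P c2).
have m0 : 0 < m by rewrite lt_min p1.
exists (Num.min 1 (m / 2)); first by rewrite lt_min ltr01 divr_gt0.
move=> s sl sJ [hx hy].
have ms : m <= sqdist x y P s.
  move: sJ; rewrite in_itv/= negb_and -!ltNge => /orP[sJ|sJ].
    apply: (@le_trans _ _ (sqdist x y P c1)); first by rewrite ge_min lexx.
    by apply: m1; move: sl; rewrite !in_itv/= => /andP[-> _]/=; exact: ltW.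
  apply: (@le_trans _ _ (sqdist x y P c2)); first by rewrite ge_min lexx orbT.
  by apply: m2; move: sl; rewrite !in_itv/= => /andP[_ ->]; rewrite andbT; exact: ltW.
have sq (u : R) : `|u| < Num.min 1 (m / 2) -> u ^+ 2 < m / 2.
  rewrite lt_min => /andP[u1 u2]; rewrite -real_normK ?num_real// expr2.
  by apply: le_lt_trans u2; rewrite ler_piMr// ltW.
have := sq _ hx; have := sq _ hy; rewrite /sqdist/= in ms => a1 a2; lra.
Qed.

(** In the coordinates (s, h), a small rectangle around (t, 0) meets the boundary
    of the domain only on the line h = 0. *)
Lemma box_exists : exists d1 h0 : R, [/\ 0 < d1, d1 <= D, 0 < h0 &
  (forall s, s \in `[t - d1, t + d1] -> `|x s - x t| <= h0 / 4 /\ `|y s - y t| <= h0 / 4) /\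
  (forall s h, s \in `[t - d1, t + d1] -> h != 0 -> `|h| <= h0 ->
    ~ (closure Om (shifted s h) /\ ~ Om (shifted s h)))].
Proof.
have [cx cy _ _] := la_cont arcD; have [a1 b1] := unit_coord_le arcD.
have [r1 r10 sep] := far_separation.
have [xt yt] := P_in.
pose r := Num.min r1 (Num.min (x t) (y t)).
have r0 : 0 < r by rewrite !lt_min r10 /= xt.
have rr1 : r <= r1 by rewrite ge_min lexx.
have rx : r <= x t by rewrite !ge_min lexx orbT.
have ry : r <= y t by rewrite !ge_min lexx !orbT.
clearbody r.
(* A foot within h0 / 4 of P, shifted by at most h0, stays within r of P. *)
pose h0 := r / 4.
have h00 : 0 < h0 by rewrite divr_gt0.
have h04 : 0 < h0 / 4 by rewrite divr_gt0.
have cxt : x s @[s --> t] --> x t by exact: cx.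
have cyt : y s @[s --> t] --> y t by exact: cy.
have [d1 d10 close] : exists2 d1 : R, 0 < d1 & forall s, `|t - s| < d1 ->
    `|x s - x t| <= h0 / 4 /\ `|y s - y t| <= h0 / 4.
  move/cvgrPdist_le : cxt => /(_ _ h04) hx; move/cvgrPdist_le : cyt => /(_ _ h04) hy.
  have : \forall s \near t, `|x s - x t| <= h0 / 4 /\ `|y s - y t| <= h0 / 4.
    by near=> s; split; rewrite distrC; near: s.
  by move=> /nbhs_ballP[d1 /= d10 h]; exists d1.
pose d2 := Num.min (d1 / 2) D.
have d20 : 0 < d2 by rewrite lt_min D0 divr_gt0.
have dD : d2 <= D by rewrite ge_min lexx orbT.
have close2 s : s \in `[t - d2, t + d2] -> `|x s - x t| <= h0 / 4 /\ `|y s - y t| <= h0 / 4.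
  rewrite in_itv/= => /andP[s1 s2]; apply: close; rewrite ltr_norml.
  have : d2 <= d1 / 2 by rewrite ge_min lexx.
  by move=> h; apply/andP; split; lra.
exists d2, h0; split => //; split => // s h sJ hn hh [cl nO].
have [c1 c2] := close2 s sJ.
have bx : `|h * dy t| <= h0 by rewrite normrM; apply: le_trans hh; exact: ler_piMr.
have by_ : `|h * dx t| <= h0 by rewrite normrM; apply: le_trans hh; exact: ler_piMr.
have hr : h0 / 4 + h0 < r by rewrite /h0; lra.
have e1 : `|(shifted s h).1 - x t| < r.
  rewrite /= (_ : x s + h * dy t - x t = (x s - x t) + h * dy t); last by ring.
  by apply: le_lt_trans hr; apply: (le_trans (ler_normD _ _)); exact: lerD.
have e2 : `|(shifted s h).2 - y t| < r.
  rewrite /= (_ : y s - h * dx t - y t = (y s - y t) - h * dx t); last by ring.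
  by apply: le_lt_trans hr; apply: (le_trans (ler_normB _ _)); exact: lerD.
have q : quadrant (shifted s h).
  move: e1 e2; rewrite !ltr_norml => /andP[e1 _] /andP[e2 _]; split.
    by move: rx e1; set u := (shifted s h).1 => ? ?; lra.
  by move: ry e2; set u := (shifted s h).2 => ? ?; lra.
have [s' s'l e] := boundary_on_arc cl nO q.
have sJD : s \in `[t - D, t + D].
  by move: sJ; rewrite !in_itv/= => /andP[s1 s2]; apply/andP; split; lra.
have [s'J|/negP/negP s'J] := boolP (s' \in `[t - D, t + D]).
  have U0 : U (shifted s h) s' = 0 by rewrite e /tan_coord/= !subrr !mulr0 addr0.
  have V0 : V (shifted s h) s' = 0 by rewrite e /nor_coord/= !subrr !mulr0 subr0.
  have ss := foot_unique arcD sJD (shifted_tan s h) s'J U0.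
  by move: V0; rewrite ss shifted_nor => /eqP; rewrite oppr_eq0 (negbTE hn).
apply: (sep s' s'l s'J); split; apply: lt_le_trans rr1.
  by move: e1; rewrite e.
by move: e2; rewrite e.
Unshelve. all: end_near. Qed.

Lemma continuous_shifted_path s0 s1 h1 h2 :
  continuous (fun u : R => shifted (s0 + u * (s1 - s0)) (h1 + u * (h2 - h1))).
Proof.
have [cx cy _ _] := la_cont arcD.
have clin (c e : R) : continuous (fun u : R => c + u * e).
  by move=> u; apply: cvgD; [exact: cvg_cst|apply: cvgM; [exact: cvg_id|exact: cvg_cst]].
move=> u; apply: cvg_pairR.
  apply: cvgD; first exact: (@cvg_comp _ _ _ _ x _ _ _ (clin s0 (s1 - s0) u) (cx _)).
  by apply: cvgM; [exact: clin|exact: cvg_cst].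
apply: cvgB; first exact: (@cvg_comp _ _ _ _ y _ _ _ (clin s0 (s1 - s0) u) (cy _)).
by apply: cvgM; [exact: clin|exact: cvg_cst].
Qed.

(** Each half of the rectangle is convex in the coordinates (s, h). *)
Lemma same_side d1 h0 s0 s1 h1 h2 : 0 < d1 ->
  (forall s h, s \in `[t - d1, t + d1] -> h != 0 -> `|h| <= h0 ->
    ~ (closure Om (shifted s h) /\ ~ Om (shifted s h))) ->
  s0 \in `[t - d1, t + d1] -> s1 \in `[t - d1, t + d1] ->
  (0 < h1 /\ 0 < h2) \/ (h1 < 0 /\ h2 < 0) -> `|h1| <= h0 -> `|h2| <= h0 ->
  Om (shifted s0 h1) -> Om (shifted s1 h2).
Proof.
move=> d10 avoid; rewrite !in_itv/= => /andP[a1 a2] /andP[b1 b2] sgn n1 n2 O1.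
have := path_stays_in oOm (@continuous_shifted_path s0 s1 h1 h2).
rewrite !mul0r !mul1r !addr0 !(addrC s0) !(addrC h1) !subrK; apply => // u.
rewrite in_itv/= => /andP[u0 u1].
have conv (p q c : R) : p <= c -> q <= c -> p + u * (q - p) <= c.
  move=> pc qc; have -> : p + u * (q - p) = (1 - u) * p + u * q by ring.
  have : (1 - u) * p <= (1 - u) * c by apply: ler_wpM2l => //; lra.
  have : u * q <= u * c by apply: ler_wpM2l.
  by move=> k1 k2; lra.
have conv' (p q c : R) : c <= p -> c <= q -> c <= p + u * (q - p).
  move=> pc qc; have := conv (- p) (- q) (- c); rewrite !lerN2 => /(_ pc qc).
  by move=> h; lra.
have conv0 (p q : R) : 0 < p -> 0 < q -> 0 < p + u * (q - p).
  move=> p0 q0; apply: lt_le_trans (conv' p q (Num.min p q) _ _); rewrite ?ge_min ?lexx ?orbT//.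
  by rewrite lt_min p0.
apply: avoid.
- by rewrite in_itv/= conv// conv'.
- case: sgn => -[s1p s2p]; first by rewrite gt_eqF// conv0.
  have := conv0 (- h1) (- h2); rewrite !oppr_gt0 => /(_ s1p s2p) h.
  by rewrite lt_eqF//; lra.
- move: n1 n2; rewrite !ler_norml => /andP[k1 k2] /andP[k3 k4].
  by rewrite conv// conv'.
Qed.

(** The exterior normal at t points to the side h > 0, which is therefore outside;
    as P lies on the boundary, the other side is inside. *)
Lemma side_of_foot : exists2 d1 : R, 0 < d1 & forall d, 0 < d -> d <= d1 ->
  \forall p \near P, forall s0, s0 \in `[t - d, t + d] -> U p s0 = 0 ->
    (Om p -> 0 < V p s0) /\ (~ closure Om p -> V p s0 < 0).
Proof.
have [d1 [h0 [d10 dD h00 [close avoid]]]] := box_exists.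
exists d1 => // d d0 dd1.
have [a1 b1] := unit_coord_le arcD.
have h04 : 0 < h0 / 4 by rewrite divr_gt0.
have tJ : t \in `[t - d1, t + d1] by rewrite in_itv/=; apply/andP; split; lra.
have [clP nP] := arc_on_boundary t_in.
have Jsub s : s \in `[t - d, t + d] -> s \in `[t - d1, t + d1].
  by rewrite !in_itv/= => /andP[s1 s2]; apply/andP; split; lra.
have small p s0 : `|x t - p.1| <= h0 / 4 -> `|y t - p.2| <= h0 / 4 -> s0 \in `[t - d1, t + d1] ->
    `|V p s0| <= h0.
  move=> p1 p2 s0J; have [c1 c2] := close s0 s0J.
  have a1' : `|- dx t| <= 1 by rewrite normrN.
  rewrite /nor_coord -mulNr; apply: (le_trans (norm_comb_le _ _ b1 a1')).
  have -> : x s0 - p.1 = (x s0 - x t) + (x t - p.1) by ring.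
  have -> : y s0 - p.2 = (y s0 - y t) + (y t - p.2) by ring.
  by apply: (le_trans (lerD (ler_normD _ _) (ler_normD _ _))); lra.
have box (e : R) : 0 < e -> \forall p \near P, `|x t - p.1| <= e /\ `|y t - p.2| <= e.
  move=> e0; exists (ball (x t) e, ball (y t) e) => /=; first by split; exact: nbhsx_ballx.
  by move=> q [/= q1 q2]; split; exact: ltW.
have nonzero p s0 : s0 \in `[t - d1, t + d1] -> U p s0 = 0 -> V p s0 = 0 -> closure Om p /\ ~ Om p.
  move=> s0J foot v0; rewrite (foot_shifted foot) v0 oppr0 /shifted !mul0r addr0 subr0.
  by apply: arc_on_boundary; apply: tD; move: s0J; rewrite !in_itv/= => /andP[? ?]; apply/andP; split; lra.
have outside p s0 : `|x t - p.1| <= h0 / 4 -> `|y t - p.2| <= h0 / 4 ->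
    s0 \in `[t - d1, t + d1] -> U p s0 = 0 -> Om p -> 0 < V p s0.
  move=> p1 p2 s0J foot Op; have vs := small p s0 p1 p2 s0J.
  have [//|v0|/esym v0] := ltgtP 0 (V p s0); last by have [_] := nonzero p s0 s0J foot v0.
  exfalso.
  have [h [hp hh hn]] : exists h : R, [/\ 0 < h, h <= h0 & ~ Om (shifted t h)].
    have e1 : \forall h \near 0^'+, [/\ 0 < h, h <= h0 & ~ Om (shifted t h)].
      near=> h; split; near: h; [exact: nbhs_right_gt|exact: nbhs_right_le|exact: exterior].
    by have [h ?] := @filter_ex _ _ _ _ e1; exists h.
  apply: hn; rewrite (foot_shifted foot) in Op.
  apply: (same_side d10 avoid s0J tJ _ _ _ Op); first by left; rewrite oppr_gt0.
    by rewrite normrN.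
  by rewrite ger0_norm// ltW.
have arc1 := arcs d10 dD.
have L0 := la_L arc1.
have [q [s1 [s1J foot1 Oq vq small1]]] : exists q s1, [/\ s1 \in `[t - d1, t + d1], U q s1 = 0, Om q,
    0 < V q s1 & `|V q s1| <= h0].
  have e0 : 0 < Num.min (h0 / 4) (L * d1 ^+ 2) by rewrite lt_min h04 mulr_gt0// exprn_gt0.
  have [q [Oq [q1 q2]]] := clP _ (box _ e0).
  have q1' : `|x t - q.1| <= h0 / 4 by apply: (le_trans q1); rewrite ge_min lexx.
  have q2' : `|y t - q.2| <= h0 / 4 by apply: (le_trans q2); rewrite ge_min lexx.
  have q1'' : `|x t - q.1| <= L * d1 ^+ 2 by apply: (le_trans q1); rewrite ge_min lexx orbT.
  have q2'' : `|y t - q.2| <= L * d1 ^+ 2 by apply: (le_trans q2); rewrite ge_min lexx orbT.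
  have [s1 s1J foot1] := foot_exists arc1 q1'' q2''.
  by exists q, s1; split => //; [exact: outside|exact: small].
apply: filterS (box _ h04) => p [p1 p2] s0 s0J foot.
have s0J' := Jsub s0 s0J; split; first exact: outside.
move=> ncl; have vs := small p s0 p1 p2 s0J'.
have [v0|//|/esym v0] := ltgtP 0 (V p s0); last by have [] := nonzero p s0 s0J' foot v0.
exfalso; apply: ncl; apply: subset_closure; rewrite (foot_shifted foot).
rewrite (foot_shifted foot1) in Oq.
apply: (same_side d10 avoid s1J s0J' _ _ _ Oq); rewrite ?normrN//.
by right; rewrite !oppr_lt0.
Unshelve. all: end_near. Qed.
End sides_of_the_arc.

(** * Extension of the arc to the whole line *)

Section clamped_arc.
Variable R : realType.
Notation mu := (@lebesgue_measure R).

(** Composition with this retraction extends a function on [0, l] to the line by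
    constants and preserves continuity. *)
Definition clamp (l s : R) : R := Num.max 0 (Num.min s l).

Lemma clamp_in l s : 0 <= l -> clamp l s \in `[0, l].
Proof. by move=> l0; rewrite in_itv/= /clamp le_max lexx/= ge_max l0 ge_min lexx orbT. Qed.

Lemma clamp_id l s : s \in `[0, l] -> clamp l s = s.
Proof. by rewrite in_itv/= /clamp => /andP[s0 sl]; rewrite min_l// max_r. Qed.

Lemma continuous_clamp l : continuous (clamp l).
Proof.
move=> s; apply: (@continuous_max R R (cst 0) (fun s => Num.min s l)); first exact: cvg_cst.
by apply: (@continuous_min R R id (cst l)); [exact: cvg_id|exact: cvg_cst].
Qed.

Lemma continuous_comp_clamp (l : R) (f : R -> R) : 0 <= l ->
  {within `[0, l], continuous f} -> continuous (f \o clamp l).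
Proof.
move=> l0 /subspace_continuousP cf s.
have h := cf _ (clamp_in s l0).
apply: (cvg_comp _ f _ h).
move=> A; rewrite /within/= => nA.
have := continuous_clamp nA; rewrite !nbhs_simpl/=.
by apply: filterS => u; apply; exact: clamp_in.
Qed.

(** The case u = s, excluded in the definition of the derivative, is included. *)
Lemma has_derivative_slope (l : R) (f df : R -> R) (s e : R) : has_derivative_on `[0, l] f df ->
  s \in `[0, l] -> 0 < e -> exists2 d, 0 < d & forall u, u \in `[0, l] -> `|u - s| < d ->
    `|f u - f s - df s * (u - s)| <= e * `|u - s|.
Proof.
move=> hf sI e0; have := hf s sI; move/cvgrPdist_le => /(_ _ e0).
rewrite /within/= => /nbhs_ballP[d /= d0 h]; exists d => // u uI ud.
have [->|us] := eqVneq u s; first by rewrite !subrr mulr0 subr0 normr0 mulr0.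
have := h u; rewrite /ball/= distrC => /(_ ud us uI).
have us0 : u - s != 0 by rewrite subr_eq0.
move=> h1; have -> : f u - f s - df s * (u - s) = - (df s - (f u - f s) / (u - s)) * (u - s) by field.
by rewrite normrM normrN ler_wpM2r.
Qed.

Lemma has_derivative_continuous (l : R) (f df : R -> R) :
  has_derivative_on `[0, l] f df -> {within `[0, l], continuous f}.
Proof.
move=> hf; apply/subspace_continuousP => s sI.
have [d d0 h] := has_derivative_slope hf sI ltr01.
apply/cvgrPdist_le => e e0; rewrite /within/=.
pose K := `|df s| + 1; have K0 : 0 < K by rewrite ltr_wpDl.
apply/nbhs_ballP; exists (Num.min d (e / K)) => /=; first by rewrite lt_min d0 divr_gt0.
move=> u; rewrite /ball/= distrC lt_min => /andP[u1 u2] uI; rewrite distrC.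
have := h u uI u1; rewrite mul1r => h1.
have -> : f u - f s = (f u - f s - df s * (u - s)) + df s * (u - s) by ring.
apply: (le_trans (ler_normD _ _)); rewrite normrM.
move: u2; rewrite ltr_pdivlMr// /K => u2.
by lra.
Qed.

Lemma is_derive_comp_clamp (l : R) (f df : R -> R) (s : R) : has_derivative_on `[0, l] f df ->
  s \in `]0, l[ -> is_derive s 1 (f \o clamp l) (df s).
Proof.
move=> hf; rewrite in_itv/= => /andP[s0 sl].
have sI : s \in `[0, l] by rewrite in_itv/= !ltW.
have cs : clamp l s = s by exact: clamp_id.
have hc : h^-1 *: ((f \o clamp l) (h *: (1 : R) + s) - (f \o clamp l) s) @[h --> 0^'] --> df s.
  apply/cvgrPdist_le => e e0.
  have [d d0 h] := has_derivative_slope hf sI e0.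
  apply/nbhs_ballP; exists (Num.min d (Num.min s (l - s))) => /=.
    by rewrite !lt_min d0 s0 subr_gt0.
  move=> v; rewrite /ball/= sub0r normrN !lt_min => /andP[v1 /andP[v2 v3]] v0.
  have vI : v *: (1 : R) + s \in `[0, l].
    rewrite /GRing.scale/= mulr1 in_itv/=.
    move: v2 v3; rewrite !ltr_norml => /andP[? ?] /andP[? ?]; apply/andP; split; lra.
  rewrite (clamp_id vI) cs.
  have := h _ vI; rewrite /GRing.scale/= mulr1 addrK => /(_ v1) k.
  rewrite distrC.
  have -> : v^-1 * (f (v + s) - f s) - df s = v^-1 * (f (v + s) - f s - df s * v) by field.
  rewrite normrM normfV mulrC ler_pdivrMr ?normr_gt0//.
split; first by apply/cvg_ex; exists (df s); exact: hc.
by apply/cvg_lim => //; exact: hc.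
Qed.

Lemma hoelder_bounded (l : R) (f : R -> R) : 0 <= l -> hoelder_continuous_on `[0, l] f ->
  exists2 M, 0 <= M & forall s, s \in `[0, l] -> `|f s| <= M.
Proof.
move=> l0 [k [lam [lam0 _ h]]]; exists (`|f 0| + `|k| * l `^ lam).
  by rewrite addr_ge0// mulr_ge0// powR_ge0.
have I0 : (0 : R) \in `[0, l] by rewrite in_itv/= lexx.
move=> s sI; have -> : f s = f 0 + (f s - f 0) by ring.
apply: (le_trans (ler_normD _ _)); rewrite lerD2l.
apply: (le_trans (h s 0 sI I0)); apply: (@le_trans _ _ (`|k| * `|s - 0| `^ lam)).
  by apply: ler_wpM2r; [exact: powR_ge0|exact: ler_norm].
apply: ler_wpM2l => //; move: sI; rewrite in_itv/= subr0 => /andP[s0 sl].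
by apply: ge0_ler_powR; rewrite ?nnegrE// ?ger0_norm// ltW.
Qed.

(** A point is negligible, and a function which is measurable off a point is
    measurable. *)
Lemma eq_off_point_integrable (D : set R) (r : R) (f g : R -> R) : measurable D ->
  mu.-integrable D (EFin \o g) -> (forall s, D s -> s != r -> f s = g s) ->
  mu.-integrable D (EFin \o f) /\ \int[mu]_(s in D) f s = \int[mu]_(s in D) g s.
Proof.
move=> mD ig fg.
have mDr : measurable (D `\ r) by exact: measurableD.
have igr : mu.-integrable (D `\ r) (EFin \o g) by apply: integrableS_fin ig => // s [].
have ifr : mu.-integrable (D `\ r) (EFin \o f).
  apply: (@eq_integrable _ (measurableTypeR R) R mu (D `\ r) mDr (EFin \o g) (EFin \o f) _ igr).
  by move=> s /set_mem [Ds /= /eqP sr]; rewrite fg.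
have mDf : measurable_fun (D `\ r) (EFin \o f) by exact: measurable_int ifr.
have mDg : measurable_fun (D `\ r) (EFin \o g) by exact: measurable_int igr.
have iD : mu.-integrable D (EFin \o f).
  have [Dr|Dr] := pselect (D r); last first.
    by rewrite -(_ : D `\ r = D)//; apply/seteqP; split => [s []//|s Ds]; split => // sr; rewrite -sr in Dr.
  have e : D = [set r] `|` (D `\ r) by rewrite setD1K//; exact: mem_set.
  rewrite e; apply: (@integrable_setU R [set r] (D `\ r) (EFin \o f)) => //.
  apply/integrableP; split; first exact: measurable_fun_set1.
  by rewrite integral_set1.
split => //; rewrite /Rintegral.
rewrite -(@integral_setD1 R (EFin \o f) r D)// -(@integral_setD1 R (EFin \o g) r D)//.
congr fine; apply: eq_integral_on => s [Ds /= /eqP sr]; by rewrite fg.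
Qed.
End clamped_arc.

(** * The limits of the double-layer potential *)

Local Opaque dl_kernel.

Section arc_data.
Variable R : realType.
Notation mu := (@lebesgue_measure R).
Variables (alpha beta a b l : R) (x y dx dy ddx ddy mu2 : R -> R) (Om : set (R * R)).
Hypotheses (alpha0 : 0 < alpha) (alpha1 : alpha < 1 / 2) (beta0 : 0 < beta) (beta1 : beta < 1 / 2).
Hypotheses (a0 : 0 < a) (b0 : 0 < b).
Hypothesis arc : admissible_arc a b l x y dx dy ddx ddy.
Hypothesis dom : domain_bounded_by a b l x y dx dy Om.
Hypothesis cmu : {within `[0, l], continuous mu2}.

Let l_gt0 : 0 < l. Proof. exact: arc_l_gt0 arc. Qed.
Let l_ge0 : 0 <= l. Proof. exact: ltW l_gt0. Qed.
Let xc := x \o clamp l.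
Let yc := y \o clamp l.
Let dxc := dx \o clamp l.
Let dyc := dy \o clamp l.
Let mc := mu2 \o clamp l.

Definition dl_density (s : R) (p : R * R) : R :=
  dl_kernel alpha beta (xc s) (yc s) (dxc s) (dyc s) p.1 p.2.
Let N := dl_density.

Lemma arc_coord_ge0 s : s \in `[0, l] -> 0 <= x s /\ 0 <= y s.
Proof.
rewrite in_itv/= => /andP[]; rewrite le_eqVlt => /predU1P[<-|s0] sl.
  by have [-> ->] := arc_start arc; rewrite lexx ltW.
move: sl; rewrite le_eqVlt => /predU1P[->|sl].
  by have [-> ->] := arc_end arc; rewrite lexx ltW.
have [] : quadrant (x s, y s) by apply: (arc_in_quadrant arc); rewrite in_itv/= s0.
by move=> /= h1 h2; rewrite !ltW.
Qed.

Lemma clamped_continuous : [/\ continuous xc, continuous yc, continuous dxc, continuous dyc & continuous mc].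
Proof.
split; apply: continuous_comp_clamp => //.
- exact: has_derivative_continuous (arc_dx arc).
- exact: has_derivative_continuous (arc_dy arc).
- exact: arc_dx_continuous arc.
- exact: arc_dy_continuous arc.
Qed.

Lemma clamped_speed_le s : `|dxc s| <= 1 /\ `|dyc s| <= 1.
Proof.
have h := arc_unit_speed arc (clamp_in s l_ge0).
have le1 (u v : R) : u ^+ 2 + v ^+ 2 = 1 -> `|u| <= 1.
  move=> e; rewrite -(@ler_pXn2r _ 2)// ?nnegrE// real_normK ?num_real// expr1n -e.
  by rewrite lerDl sqr_ge0.
by split; [exact: le1 h|rewrite addrC in h; exact: le1 h].
Qed.

Lemma sqdist_arc_gt0 p s : ~ arc_image l x y p -> 0 < sqdist xc yc p s.
Proof.
move=> np; rewrite /sqdist lt_def addr_ge0 ?sqr_ge0// andbT; apply/eqP => /eqP.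
rewrite paddr_eq0 ?sqr_ge0// !sqrf_eq0 !subr_eq0 => /andP[/eqP e1 /eqP e2].
apply: np; exists (clamp l s); first exact: clamp_in.
by rewrite [RHS]surjective_pairing -e1 -e2.
Qed.

Lemma sqdist_simple t s : t \in `[0, l] -> s \in `[0, l] -> s != t -> 0 < sqdist xc yc (xc t, yc t) s.
Proof.
move=> tl sl st; rewrite /sqdist/= lt_def addr_ge0 ?sqr_ge0// andbT; apply/eqP => /eqP.
rewrite paddr_eq0 ?sqr_ge0// !sqrf_eq0 !subr_eq0 /xc /yc /= !clamp_id// => /andP[/eqP e1 /eqP e2].
by move/eqP: st; apply; exact: (arc_simple arc).
Qed.

Lemma dl_density_cvg (T : Type) (F : set_system T) (u : T -> R) (q : T -> R * R) (s : R) (p : R * R) :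
  Filter F -> quadrant p -> 0 < sqdist xc yc p s -> u z @[z --> F] --> s ->
  (q z).1 @[z --> F] --> p.1 -> (q z).2 @[z --> F] --> p.2 ->
  N (u z) (q z) @[z --> F] --> N s p.
Proof.
move=> FF [p1 p2] r0 us q1 q2; have [cx cy cdx cdy _] := clamped_continuous.
have [x0 y0] := arc_coord_ge0 (clamp_in s l_ge0).
have comp (f : R -> R) : continuous f -> f (u z) @[z --> F] --> f s.
  by move=> cf; exact: (@cvg_comp _ _ _ u f F (nbhs s) _ us (cf s)).
apply: (dl_kernel_cvg alpha0 alpha1 beta0 FF) => //; try exact: comp.
- by apply: nearW => z; have [] := arc_coord_ge0 (clamp_in (u z) l_ge0).
- by apply: nearW => z; have [] := arc_coord_ge0 (clamp_in (u z) l_ge0).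
Qed.

Lemma local_arc_exists t : t \in `]0, l[ -> exists D L : R, [/\ 0 < D,
  forall s, s \in `[t - D, t + D] -> s \in `]0, l[ &
  forall d, 0 < d -> d <= D -> local_arc xc yc dxc dyc t d L].
Proof.
rewrite in_itv/= => /andP[t0 tl].
have [M1 M10 hM1] := hoelder_bounded l_ge0 (arc_ddx_hoelder arc).
have [M2 M20 hM2] := hoelder_bounded l_ge0 (arc_ddy_hoelder arc).
pose L := 1 + M1 + M2.
have L0 : 0 < L by rewrite /L; lra.
pose D := Num.min (Num.min (t / 2) ((l - t) / 2)) (8^-1 / L).
have D0 : 0 < D by rewrite !lt_min !divr_gt0// ?subr_gt0.
have Dt : D <= t / 2 by rewrite !ge_min lexx.
have Dl : D <= (l - t) / 2 by rewrite !ge_min lexx orbT.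
have DL : D <= 8^-1 / L by rewrite ge_min lexx orbT.
rewrite ler_pdivlMr// in DL.
have sub s : s \in `[t - D, t + D] -> s \in `]0, l[.
  by rewrite !in_itv/= => /andP[s1 s2]; apply/andP; split; lra.
exists D, L; split => // d d0 dD.
have sub' s : s \in `[t - d, t + d] -> s \in `]0, l[.
  by rewrite !in_itv/= => /andP[s1 s2]; apply: sub; rewrite in_itv/=; apply/andP; split; lra.
have cl s : s \in `[t - d, t + d] -> s \in `[0, l].
  by move=> sJ; apply: subset_itv_oo_cc; exact: sub'.
have der (f df : R -> R) : has_derivative_on `[0, l] f df -> forall s, s \in `[t - d, t + d] ->
    is_derive s 1 (f \o clamp l) ((df \o clamp l) s).
  by move=> hf s sJ; rewrite /= clamp_id ?cl//; apply: is_derive_comp_clamp => //; exact: sub'.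
have lip (f df : R -> R) (M : R) : has_derivative_on `[0, l] f df ->
    (forall s, s \in `[0, l] -> `|df s| <= M) -> M <= L ->
    forall s s', s \in `[t - d, t + d] -> s' \in `[t - d, t + d] ->
    `|(f \o clamp l) s - (f \o clamp l) s'| <= L * `|s - s'|.
  move=> hf hM ML s s' sJ s'J; have [u [uJ _ _ ->]] := MVT_points (der f df hf) sJ s'J.
  rewrite normrM; apply: ler_wpM2r => //; apply: le_trans ML; apply: hM; exact: clamp_in.
have ct : t \in `[t - d, t + d] by rewrite in_itv/=; apply/andP; split; lra.
have [cx cy cdx cdy _] := clamped_continuous.
split => //.
- have : L * d <= L * D by rewrite ler_pM2l.
  by move=> h; lra.
- exact: der (arc_dx arc).
- exact: der (arc_dy arc).
- by apply: lip (arc_ddx arc) hM1 _; rewrite /L; lra.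
- by apply: lip (arc_ddy arc) hM2 _; rewrite /L; lra.
- by rewrite /dxc /dyc /= clamp_id ?cl//; apply: (arc_unit_speed arc); exact: cl.
Qed.

Lemma arc_on_boundary s : s \in `[0, l] -> closure Om (xc s, yc s) /\ ~ Om (xc s, yc s).
Proof.
move=> sl; have : (closure Om `\` interior Om) (xc s, yc s).
  rewrite (dom_boundary dom); right; exists s => //.
  by rewrite /xc /yc /= clamp_id.
by have /interior_id -> := dom_open dom.
Qed.

Lemma boundary_on_arc p : closure Om p -> ~ Om p -> quadrant p ->
  exists2 s, s \in `[0, l] & p = (xc s, yc s).
Proof.
move=> cl nO [p1 p2]; have : (closure Om `\` interior Om) p.
  by split => //; have /interior_id -> := dom_open dom.
rewrite (dom_boundary dom) => -[[[_ h]|[h _]]|[s sl <-]].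
- by rewrite h ltxx in p2.
- by rewrite h ltxx in p1.
- by exists s => //; rewrite /xc /yc /= clamp_id.
Qed.

Lemma potential_integrandE p s : quadrant p -> s \in `]0, l[ -> 0 < sqdist xc yc p s ->
  potential_integrand alpha beta x y dx dy mu2 p s = mc s * N s p.
Proof.
move=> [p1 p2] sl r0; have [xs ys] := arc_in_quadrant arc sl.
have cs : clamp l s = s by apply: clamp_id; exact: subset_itv_oo_cc.
rewrite /potential_integrand /N /dl_density /mc /xc /yc /dxc /dyc /= cs.
rewrite -(@normal_derivative_q2E R alpha beta alpha0 alpha1 beta0 x y dx dy s p.1 p.2)//; first by ring.
by move: r0; rewrite /sqdist /xc /yc /= cs.
Qed.

Lemma direct_integrandE t s : t \in `]0, l[ -> s \in `]0, l[ -> s != t ->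
  mu2 s * K2 alpha beta x y dx dy s t = mc s * N s (xc t, yc t).
Proof.
move=> tl sl st.
have tl' : t \in `[0, l] by exact: subset_itv_oo_cc.
have sl' : s \in `[0, l] by exact: subset_itv_oo_cc.
have hP : quadrant (xc t, yc t).
  by rewrite /xc /yc /= clamp_id//; exact: (arc_in_quadrant arc).
rewrite -(potential_integrandE hP sl (sqdist_simple tl' sl' st)).
rewrite /potential_integrand /K2 /xc /yc /= clamp_id//; ring.
Qed.

Lemma itv_interior s : s \in `[0, l] -> s != 0 -> s != l -> s \in `]0, l[.
Proof.
rewrite !in_itv/= => /andP[s0 sl] n0 nl.
by rewrite !lt_def s0 sl n0 eq_sym nl.
Qed.

(** The integrand of the potential and the kernel of the extended arc differ at
    most at the end points, where the fundamental solution degenerates. *)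
Lemma potential_eq p : quadrant p -> ~ arc_image l x y p ->
  mu.-integrable `[0, l] (EFin \o potential_integrand alpha beta x y dx dy mu2 p) /\
  double_layer_potential alpha beta l x y dx dy mu2 p = \int[mu]_(s in `[0, l]) (mc s * N s p).
Proof.
move=> hp np; have [cx cy cdx cdy cm] := clamped_continuous.
have pos s := @sqdist_arc_gt0 p s np.
have ig : mu.-integrable `[0, l] (EFin \o (fun s => mc s * N s p)).
  apply: (integrable_off_curve cm dl_density_cvg _ hp) => //.
  exact: segment_compact.
pose f := potential_integrand alpha beta x y dx dy mu2 p.
pose g s := if s == 0 then f s else mc s * N s p.
have mI : measurable (`[0, l]%classic : set R) by exact: measurable_itv.
have [i1 e1] := @eq_off_point_integrable R `[0, l]%classic 0 g _ mI ig
  (fun s _ (s0 : s != 0) => ifN_eq _ _ s0).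
have fg s : `[0, l]%classic s -> s != l -> f s = g s.
  move=> sI sl; rewrite /g; case: eqP => // /eqP s0.
  by apply: potential_integrandE => //; exact: itv_interior.
have [i2 e2] := eq_off_point_integrable mI i1 fg.
by split => //; rewrite /double_layer_potential e2 e1.
Qed.

Section at_a_point.
Variable t : R.
Hypothesis tl : t \in `]0, l[.
Notation P := (xc t, yc t).

Let tl' : t \in `[0, l]. Proof. exact: subset_itv_oo_cc. Qed.
Let ct : clamp l t = t. Proof. exact: clamp_id. Qed.
Let P_in : quadrant P.
Proof. by rewrite /xc /yc /= ct; exact: (arc_in_quadrant arc). Qed.

Lemma dl_density_near_angle eps : 0 < eps -> exists C delta : R, [/\ 0 <= C, 0 < delta &
  forall s p, `|s - t| <= delta -> `|xc t - p.1| <= delta -> `|yc t - p.2| <= delta ->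
    0 < sqdist xc yc p s ->
    `|N s p + angle_density xc yc dxc dyc p s / (2 * pi)|
      <= C * sqdist xc yc p s `^ (- 4^-1) + eps * `|angle_density xc yc dxc dyc p s|].
Proof.
move=> eps0; have [cx cy _ _ _] := clamped_continuous; have [x0 y0] := P_in.
apply: (dl_kernel_near_angle alpha0 alpha1 beta0 beta1 cx cy) => // s; by have [] := clamped_speed_le s.
Qed.

Lemma direct_eq :
  mu.-integrable `[0, l] (EFin \o (fun s => mu2 s * K2 alpha beta x y dx dy s t)) /\
  \int[mu]_(s in `[0, l]) (mu2 s * K2 alpha beta x y dx dy s t)
   = \int[mu]_(s in `[0, l]) (mc s * N s P).
Proof.
have [cx cy cdx cdy cm] := clamped_continuous.
have [D [L [D0 tD arcs]]] := local_arc_exists tl.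
have tD' s : s \in `[t - D, t + D] -> s \in `[0, l] by move=> sJ; apply: subset_itv_oo_cc; exact: tD.
have ig : mu.-integrable `[0, l] (EFin \o (fun s => mc s * N s P)).
  exact: (direct_value_integrable l_ge0 tD' D0 arcs cm P_in (fun s => @sqdist_simple t s tl')
    dl_density_cvg dl_density_near_angle).
pose f s := mu2 s * K2 alpha beta x y dx dy s t.
pose g s := if s == 0 then f s else mc s * N s P.
pose h s := if s == l then f s else g s.
have mI : measurable (`[0, l]%classic : set R) by exact: measurable_itv.
have [i1 e1] := @eq_off_point_integrable R `[0, l]%classic 0 g _ mI ig
  (fun s _ (s0 : s != 0) => ifN_eq _ _ s0).
have [i2 e2] := @eq_off_point_integrable R `[0, l]%classic l h _ mI i1
  (fun s _ (s0 : s != l) => ifN_eq _ _ s0).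
have fh s : `[0, l]%classic s -> s != t -> f s = h s.
  move=> sI st; rewrite /h; case: eqP => // /eqP sl; rewrite /g; case: eqP => // /eqP s0.
  by apply: direct_integrandE => //; exact: itv_interior.
have [i3 e3] := eq_off_point_integrable mI i2 fh.
by split => //; rewrite e3 e2 e1.
Qed.

Lemma exterior_normal : \forall h \near 0^'+, ~ Om (xc t + h * dyc t, yc t - h * dxc t).
Proof. by rewrite /xc /yc /dxc /dyc /= ct; exact: (dom_exterior_normal dom tl). Qed.

(** Both one-sided limits at once: the sign of the jump is the side of the arc. *)
Lemma potential_near eps : 0 < eps -> \forall p \near P, quadrant p ->
  (Om p -> `|double_layer_potential alpha beta l x y dx dy mu2 p
     - (- (1 / 2) * mu2 t + \int[mu]_(s in `[0, l]) (mu2 s * K2 alpha beta x y dx dy s t))| <= eps) /\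
  (~ closure Om p -> `|double_layer_potential alpha beta l x y dx dy mu2 p
     - (1 / 2 * mu2 t + \int[mu]_(s in `[0, l]) (mu2 s * K2 alpha beta x y dx dy s t))| <= eps).
Proof.
move=> eps0; have [cx cy cdx cdy cm] := clamped_continuous.
have [D [L [D0 tD arcs]]] := local_arc_exists tl.
have tD' s : s \in `[t - D, t + D] -> s \in `[0, l] by move=> sJ; apply: subset_itv_oo_cc; exact: tD.
have simple s := @sqdist_simple t s tl'.
have [d1 d10 side] := side_of_foot tD' D0 arcs P_in simple (dom_open dom) boundary_on_arc
  arc_on_boundary exterior_normal.
have [d [d0 dd1 dD jump]] := jump_near l_ge0 tD' D0 arcs cm P_in simple
    dl_density_cvg dl_density_near_angle eps0 d10.
have [_ ->] := direct_eq.
have mt : mc t = mu2 t by rewrite /mc /= ct.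
have off p : Om p \/ ~ closure Om p -> ~ arc_image l x y p.
  move=> h [s sl e]; have := arc_on_boundary sl; rewrite /xc /yc /= clamp_id// e => -[c1 c2].
  by case: h.
near=> p => hp.
have hs : forall s0, s0 \in `[t - d, t + d] -> tan_coord xc yc dxc dyc t p s0 = 0 ->
    (Om p -> 0 < nor_coord xc yc dxc dyc t p s0) /\ (~ closure Om p -> nor_coord xc yc dxc dyc t p s0 < 0).
  by near: p; exact: side.
have hj : quadrant p -> (forall s, s \in `[0, l] -> 0 < sqdist xc yc p s) ->
    exists s0 : R, [/\ s0 \in `[t - d, t + d], tan_coord xc yc dxc dyc t p s0 = 0,
      nor_coord xc yc dxc dyc t p s0 != 0 &
      `|\int[mu]_(s in `[0, l]) (mc s * N s p) - \int[mu]_(s in `[0, l]) (mc s * N s P)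
        + Num.sg (nor_coord xc yc dxc dyc t p s0) / 2 * mc t| <= eps].
  by near: p; exact: jump.
split=> hO.
  have np := off p (or_introl hO).
  have [_ ->] := potential_eq hp np.
  have [s0 [s0J foot _]] := hj hp (fun s _ => sqdist_arc_gt0 s np).
  have [/(_ hO) v0 _] := hs s0 s0J foot.
  by rewrite gtr0_sg// mt mulNr opprD opprK addrCA addrC.
have np := off p (or_intror hO).
have [_ ->] := potential_eq hp np.
have [s0 [s0J foot _]] := hj hp (fun s _ => sqdist_arc_gt0 s np).
have [_ /(_ hO) v0] := hs s0 s0J foot.
by rewrite ltr0_sg// mt mulN1r mulNr opprD addrCA addrC mul1r.
Unshelve. all: end_near. Qed.
End at_a_point.
End arc_data.

Theorem theorem3 (R : realType) (alpha beta a b l : R)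
    (x y dx dy ddx ddy mu2 : R -> R) (Om : set (R * R)) :
  0 < alpha -> alpha < 1 / 2 -> 0 < beta -> beta < 1 / 2 ->
  0 < a -> 0 < b ->
  admissible_arc a b l x y dx dy ddx ddy ->
  domain_bounded_by a b l x y dx dy Om ->
  {within `[0, l], continuous mu2} ->
  let w2 := double_layer_potential alpha beta l x y dx dy mu2 in
  (forall p : R * R, quadrant p -> ~ arc_image l x y p ->
     lebesgue_measure.-integrable `[0, l]
       (EFin \o potential_integrand alpha beta x y dx dy mu2 p)) /\
  forall t : R, t \in `]0, l[ ->
    let direct_value :=
      \int[lebesgue_measure]_(s in `[0, l])
        (mu2 s * K2 alpha beta x y dx dy s t) in
    [/\ lebesgue_measure.-integrable `[0, l]
          (EFin \o (fun s => mu2 s * K2 alpha beta x y dx dy s t)),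
        w2 p @[p --> within Om (nbhs (x t, y t))]
          --> - (1 / 2) * mu2 t + direct_value &
        w2 p @[p --> within (@quadrant R `\` closure Om) (nbhs (x t, y t))]
          --> 1 / 2 * mu2 t + direct_value].
Proof.
move=> al0 al1 be0 be1 a0 b0 arc dom cmu w2; split.
  by move=> p hp np; have [] := potential_eq al0 al1 be0 a0 b0 arc cmu hp np.
move=> t tl direct_value.
have ct : clamp l t = t by apply: clamp_id; exact: subset_itv_oo_cc.
split.
- by have [] := direct_eq al0 al1 be0 be1 a0 b0 arc cmu tl.
- apply/cvgrPdist_le => eps eps0; rewrite near_withinE.
  have := potential_near al0 al1 be0 be1 a0 b0 arc dom cmu tl eps0; rewrite /= ct.
  apply: filterS => p h pO; rewrite distrC.
  by have [/(_ pO)] := h (dom_in_quadrant dom pO).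
- apply/cvgrPdist_le => eps eps0; rewrite near_withinE.
  have := potential_near al0 al1 be0 be1 a0 b0 arc dom cmu tl eps0; rewrite /= ct.
  apply: filterS => p h [hp pO]; rewrite distrC.
  by have [_ /(_ pO)] := h hp.
Qed.
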